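(* Let $A,N_1,\dots,N_q\in\mathbb R^{n\times n}$, $B\in\mathbb R^{n\times m}$, $C\in\mathbb R^{p\times n}$ be such that $(A,B,N_i)$ is stabilizable and $(A,C,N_i)$ is observable. Let $P>0$ satisfy $$A^\top P^{-1}+P^{-1}A+\sum_{i,j=1}^q N_i^\top P^{-1}N_jk_{ij}-C^\top C+P^{-1}BB^\top P^{-1}\le 0,$$ and let $Q>0$ be the stabilizing solution of $$A^\top Q+QA+\sum_{i,j=1}^q N_i^\top QN_jk_{ij}+C^\top C-QBB^\top Q=0.$$ Let $1\le r<n$, let $\sigma_1\ge\dots\ge\sigma_n>0$ be the square roots of the eigenvalues of $PQ$, and let $(A_r,B_r,C_r,N_{i,r})$ be the coefficients of the reduced system obtained by LQG balanced truncation, with $\Sigma_r=\operatorname{diag}(\sigma_1,\dots,\sigma_r)$. Let $T>0$ and $u^{(1)}\in L^2_T$. Let $x,y$ be the state and output of the full system with $x(0)=0$ and control $u(t)=-B^\top Qx(t)+u^{(1)}(t)$, and let $x_r,y_r$ be the state and output of the reduced system with $x_r(0)=0$ and control $u_r(t)=-B_r^\top\Sigma_rx_r(t)+u^{(1)}(t)$. Then $$\left\|\begin{bmatrix}u-u_r\\ y-y_r\end{bmatrix}\right\|_{L^2_T}\le 2\sum_{k=r+1}^n\frac{\sigma_k}{\sqrt{1+\sigma_k^2}}\,\|u^{(1)}\|_{L^2_T}.$$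
   Context: Probability setting: $(\Omega,\mathcal F,(\mathcal F_t)_{t\ge0},\mathbb P)$ is a filtered probability space with right-continuous complete filtration; $W=(W_1,\dots,W_q)^\top$ is an adapted $\mathbb R^q$-valued mean-zero Wiener process with covariance matrix $K=(k_{ij})$, i.e. $\mathbb E[W(t)W(t)^\top]=Kt$, whose increments $W(t+h)-W(t)$ are independent of $\mathcal F_t$. For adapted processes, $\|v\|_{L^2_T}^2=\mathbb E\int_0^T\|v(s)\|_2^2ds$; $v\in L^2_T$ means this is finite, and $L^2$ denotes the case $T=\infty$. Full system: $dx(t)=[Ax(t)+Bu(t)]dt+\sum_{i=1}^qN_ix(t)dW_i(t)$, $x(0)=x_0\in\mathbb R^n$, $y(t)=Cx(t)$. Its state and output are written $x(\cdot,x_0,u)$, $y(\cdot,x_0,u)$. For feedback controls the state is the solution of the linear SDE obtained by inserting the feedback. Definitions: $(A,N_i)$ is stable (mean square asymptotically) if there are $M\ge1$, $c>0$ with $\mathbb E\|x(t,x_0,0)\|_2^2\le Me^{-ct}\|x_0\|_2^2$ for all $x_0$, $t\ge0$. $(A,B,N_i)$ is stabilizable if for every $x_0$ there is $u\in L^2$ with $x(\cdot,x_0,u)\in L^2$. $(A,C,N_i)$ is observable if $y(t,x_0,0)=0$ a.s. for all $t\ge0$ implies $x_0=0$. A solution $Q$ of the Riccati equation is stabilizing if $(A-BB^\top Q,N_i)$ is stable; under the assumptions of the claim a stabilizing solution exists and is positive definite. LQG balanced truncation: choose a nonsingular $S_b\in\mathbb R^{n\times n}$ with $S_bPS_b^\top=S_b^{-\top}QS_b^{-1}=\Sigma_n=\operatorname{diag}(\sigma_1,\dots,\sigma_n)$,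 and put $(A_n,N_{i,n},B_n,C_n)=(S_bAS_b^{-1},S_bN_iS_b^{-1},S_bB,CS_b^{-1})$. Then $A_r,N_{i,r}$ are the upper-left $r\times r$ blocks of $A_n,N_{i,n}$, $B_r$ consists of the first $r$ rows of $B_n$, and $C_r$ of the first $r$ columns of $C_n$. The reduced system with control $w$ is $dx_r(t)=[A_rx_r(t)+B_rw(t)]dt+\sum_{i=1}^qN_{i,r}x_r(t)dW_i(t)$, $y_r(t)=C_rx_r(t)$. *)

(* Defs.v *)
From HB Require Import structures.
From mathcomp Require Import all_boot all_order all_algebra.
From mathcomp Require Import all_classical all_reals all_analysis.

Set Implicit Arguments.
Unset Strict Implicit.
Unset Printing Implicit Defensive.

Import Order.TTheory GRing.Theory Num.Theory.
Import numFieldNormedType.Exports.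

Local Open Scope classical_set_scope.
Local Open Scope ring_scope.

(** * Matrices *)

Section Matrices.
Variable R : realType.

(* The squared Euclidean norm; the library norm `|v| on matrices is the sup
   norm. *)
Definition sqnorm2 n (v : 'cV[R]_n) : R := \sum_(i < n) (v i 0) ^+ 2.

Definition posdefmx n (M : 'M[R]_n) : Prop :=
  M^T = M /\ forall v : 'cV[R]_n, v != 0 -> 0 < (v^T *m M *m v) 0 0.

Definition possemidefmx n (M : 'M[R]_n) : Prop :=
  M^T = M /\ forall v : 'cV[R]_n, 0 <= (v^T *m M *m v) 0 0.

(* The Loewner order. *)
Definition mxle n (X Y : 'M[R]_n) : Prop := possemidefmx (Y - X).

Definition diagf n (sigma : 'I_n -> R) : 'M[R]_n := diag_mx (\row_i sigma i).

Definition lqg_balancing n (P Q : 'M[R]_n) (sigma : 'I_n -> R)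
    (S : 'M[R]_n) : Prop :=
  [/\ S \in unitmx,
      S *m P *m S^T = diagf sigma &
      (invmx S)^T *m Q *m invmx S = diagf sigma].

Definition trunc_state r n (h : (r <= n)%N) (S M : 'M[R]_n) : 'M[R]_r :=
  mxsub (widen_ord h) (widen_ord h) (S *m M *m invmx S).

Definition trunc_input r n m (h : (r <= n)%N) (S : 'M[R]_n)
    (B : 'M[R]_(n, m)) : 'M[R]_(r, m) :=
  rowsub (widen_ord h) (S *m B).

Definition trunc_output r n p (h : (r <= n)%N) (S : 'M[R]_n)
    (C : 'M[R]_(p, n)) : 'M[R]_(p, r) :=
  colsub (widen_ord h) (C *m invmx S).

End Matrices.

(** * Processes on a filtered probability space

    A process is a function R -> Omega -> 'cV[R]_k of which only the values at
    times t >= 0 are relevant; a filtration is a family of set systems indexed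
    by R of which only the members at times t >= 0 are relevant. *)

Section Processes.
Context (R : realType) (d : measure_display) (Omega : measurableType d).
Variable Pr : probability Omega R.
Variable F : R -> set (set Omega).

Definition usual_filtration : Prop :=
  [/\ forall t : R, 0 <= t -> sigma_algebra setT (F t),
      forall t : R, 0 <= t -> F t `<=` measurable,
      forall s t : R, 0 <= s -> s <= t -> F s `<=` F t,
      forall t : R, 0 <= t -> F t = \bigcap_(s in [set s | t < s]) F s &
      Pr.-negligible `<=` F 0].

Definition measurable_wrt (G : set (set Omega)) k
    (X : Omega -> 'cV[R]_k) : Prop :=
  forall (i : 'I_k) (E : set R), measurable E ->
    G ((fun w => X w i 0) @^-1` E).

Definition sigma_of k (X : Omega -> 'cV[R]_k) : set (set Omega) :=
  <<s [set A | exists (i : 'I_k) (E : set R),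
         measurable E /\ A = (fun w => X w i 0) @^-1` E] >>.

Definition independent_of k (X : Omega -> 'cV[R]_k)
    (G : set (set Omega)) : Prop :=
  forall A E, G A -> sigma_of X E -> Pr (A `&` E) = (Pr A * Pr E)%E.

(* The law N(0, v).  The case v = 0 is separate because normal_prob 0 0 is, by
   convention, the uniform law on [0, 1]. *)
Definition centered_normal (v : R) (E : set R) : \bar R :=
  if v == 0 then \d_(0 : R) E else normal_prob 0 (Num.sqrt v) E.

(* The law of a Gaussian vector is given through the laws of all its linear
   combinations, so that K may be singular. *)
Definition gaussian_centered k (X : Omega -> 'cV[R]_k) (S : 'M[R]_k) : Prop :=
  forall (a : 'cV[R]_k) (E : set R), measurable E ->
    Pr ((fun w => (a^T *m X w) 0 0) @^-1` E) =
    centered_normal ((a^T *m S *m a) 0 0) E.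

Record wiener q (K : 'M[R]_q) (W : R -> Omega -> 'cV[R]_q) : Prop := {
  wiener_start : {ae Pr, forall w, W 0 w = 0};
  wiener_continuous : {ae Pr, forall w,
    {within `[0, +oo[%classic, continuous (fun t => W t w)}};
  wiener_adapted : forall t : R, 0 <= t -> measurable_wrt (F t) (W t);
  wiener_mean : forall (t : R) i, 0 <= t ->
    ('E_Pr[fun w => (W t w i 0)%R] = 0)%E;
  wiener_covariance : forall (t : R) i j, 0 <= t ->
    ('E_Pr[fun w => ((W t w *m (W t w)^T) i j)%R] = (K i j * t)%:E)%E;
  wiener_gaussian : forall t h : R, 0 <= t -> 0 <= h ->
    gaussian_centered (fun w => W (t + h) w - W t w) (h *: K);
  wiener_independent : forall t h : R, 0 <= t -> 0 <= h ->
    independent_of (fun w => W (t + h) w - W t w) (F t) }.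

Definition L2norm (D : set R) k (v : R -> Omega -> 'cV[R]_k) : \bar R :=
  sqrte (\int[Pr]_w \int[lebesgue_measure]_(t in D) (sqnorm2 (v t w))%:E)%E.

Definition L2process (D : set R) k (v : R -> Omega -> 'cV[R]_k) : Prop :=
  [/\ forall i : 'I_k, measurable_fun (D `*` [set: Omega])
        (fun z : measurableTypeR R * Omega => v z.1 z.2 i 0),
      forall t, D t -> measurable_wrt (F t) (v t) &
      (L2norm D v < +oo)%E].

(** ** The Ito integral *)

(* Encodes \sum_(j < size) step_value j * 1_(time j, time j.+1]. *)
Record step_process k := StepProcess {
  step_size : nat;
  step_time : nat -> R;
  step_value : nat -> Omega -> 'cV[R]_k }.

Definition step_admissible k (s : step_process k) : Prop :=
  [/\ 0 <= step_time s 0%N,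
      forall j, step_time s j <= step_time s j.+1,
      forall j, measurable_wrt (F (step_time s j)) (step_value s j) &
      forall j, (\int[Pr]_w (sqnorm2 (step_value s j w))%:E < +oo)%E].

Definition step_fun k (s : step_process k) (t : R) (w : Omega) : 'cV[R]_k :=
  \sum_(j < step_size s)
    \1_(`]step_time s j, step_time s j.+1]%classic) t *: step_value s j w.

Definition step_integral k (s : step_process k) (b : R -> Omega -> R)
    (t : R) (w : Omega) : 'cV[R]_k :=
  \sum_(j < step_size s)
    (b (Num.min (step_time s j.+1) t) w - b (Num.min (step_time s j) t) w)
      *: step_value s j w.

(* M t is (a version of) the integral of v over [0, t] with respect to the
   scalar Brownian motion b, for 0 <= t <= T.  Measurability of M must be
   required: the Lebesgue integral of a nonmeasurable nonnegative function is a
   lower integral, so convergence alone would not determine M t. *)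
Definition ito_integral (T : R) k (v : R -> Omega -> 'cV[R]_k)
    (b : R -> Omega -> R) (M : R -> Omega -> 'cV[R]_k) : Prop :=
  (forall t : R, 0 <= t <= T -> measurable_wrt (F t) (M t)) /\
  exists s : nat -> step_process k,
    [/\ forall l, step_admissible (s l),
        (fun l => L2norm `[0, T] (fun t w => v t w - step_fun (s l) t w))
          @ \oo --> 0%E &
        forall t : R, 0 <= t <= T ->
          (fun l => \int[Pr]_w
             (sqnorm2 (M t w - step_integral (s l) b t w))%:E)%E
            @ \oo --> 0%E].

(** ** Linear stochastic systems *)

Section Systems.
Variables (q : nat) (W : R -> Omega -> 'cV[R]_q).

(* x solves dx = (A x + B u) dt + \sum_i N_i x dW_i, x(0) = x0 on [0, T].
   Solutions are determined up to modification: the quantities E |x(t)|^2 and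
   L2norm do not depend on the version, in particular the continuous version
   is a solution in this sense. *)
Definition solution_on (T : R) n m (A : 'M[R]_n) (B : 'M[R]_(n, m))
    (N : 'I_q -> 'M[R]_n) (x0 : 'cV[R]_n) (u : R -> Omega -> 'cV[R]_m)
    (x : R -> Omega -> 'cV[R]_n) : Prop :=
  L2process `[0, T] x /\
  exists M : 'I_q -> R -> Omega -> 'cV[R]_n,
    (forall i, ito_integral T (fun t w => N i *m x t w)
                 (fun t w => W t w i 0) (M i)) /\
    forall t : R, 0 <= t <= T -> {ae Pr, forall w,
      x t w = x0
        + \col_a (\int[lebesgue_measure]_(s in `[0, t])
                    ((A *m x s w + B *m u s w) a 0))
        + \sum_(i < q) M i t w}.

Definition solution n m (A : 'M[R]_n) (B : 'M[R]_(n, m))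
    (N : 'I_q -> 'M[R]_n) (x0 : 'cV[R]_n) (u : R -> Omega -> 'cV[R]_m)
    (x : R -> Omega -> 'cV[R]_n) : Prop :=
  forall T, 0 < T -> solution_on T A B N x0 u x.

Definition uncontrolled_solution n (A : 'M[R]_n) (N : 'I_q -> 'M[R]_n)
    (x0 : 'cV[R]_n) (x : R -> Omega -> 'cV[R]_n) : Prop :=
  solution A (0 : 'M[R]_(n, 0)) N x0 (fun _ _ => 0) x.

Definition stable n (A : 'M[R]_n) (N : 'I_q -> 'M[R]_n) : Prop :=
  exists M c : R, [/\ 1 <= M, 0 < c &
    forall (x0 : 'cV[R]_n) (x : R -> Omega -> 'cV[R]_n),
      uncontrolled_solution A N x0 x ->
      forall t : R, 0 <= t ->
        (\int[Pr]_w (sqnorm2 (x t w))%:E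
           <= (M * expR (- c * t) * sqnorm2 x0)%:E)%E].

Definition stabilizable n m (A : 'M[R]_n) (B : 'M[R]_(n, m))
    (N : 'I_q -> 'M[R]_n) : Prop :=
  forall x0 : 'cV[R]_n,
    exists (u : R -> Omega -> 'cV[R]_m) (x : R -> Omega -> 'cV[R]_n),
      [/\ L2process `[0, +oo[ u, solution A B N x0 u x &
          L2process `[0, +oo[ x].

Definition observable n p (A : 'M[R]_n) (C : 'M[R]_(p, n))
    (N : 'I_q -> 'M[R]_n) : Prop :=
  forall (x0 : 'cV[R]_n) (x : R -> Omega -> 'cV[R]_n),
    uncontrolled_solution A N x0 x ->
    (forall t : R, 0 <= t -> {ae Pr, forall w, C *m x t w = 0}) ->
    x0 = 0.

End Systems.

End Processes.

(* Main.v *)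
(** Closing the loop with [u = - B^T Q x + u1] turns the two Riccati relations
    into Lyapunov inequalities for the system with input [u1] and output
    [(u - u1, y)]: [Q] is its observability Gramian and [P^-1 + Q] the inverse of
    its (generalized) controllability Gramian.  Balancing makes both diagonal,
    with entries [sigma_k] and [sigma_k + 1 / sigma_k].

    Removing the last state, with [x] and [z] the states before and after, the
    function [|x - z|_Q^2 + (q / xi) |x + z|_Xi^2], where [Xi = P^-1 + Q] and [q],
    [xi] are the last diagonal entries of [Q] and [Xi], satisfies a dissipation
    inequality with gain [2 sigma / sqrt (1 + sigma^2)].  Gains add up along the
    chain of successive truncations: storage functions are added and minimized
    over the intermediate states (a Schur complement), so that the intermediate
    stochastic equations need not be solved.

    It remains to see that the expectation of a quadratic form of two solutions is
    the integral of its generator, which only requires the product rule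
    [E (Z Z')(T) = E int (a Z' + a' Z + sum k_ij v_i v'_j)].  It follows from the
    Ito isometry, the orthogonality of the increments of Ito integrals to the past
    and Fubini's theorem. *)

Require Import Defs.
From HB Require Import structures.
From mathcomp Require Import all_boot all_order all_algebra.
From mathcomp Require Import all_classical all_reals all_analysis.
From mathcomp Require Import measurable_realfun.
From mathcomp Require Import ring lra.

Set Implicit Arguments.
Unset Strict Implicit.
Unset Printing Implicit Defensive.

Import Order.TTheory GRing.Theory Num.Theory.
Import numFieldNormedType.Exports.

Local Open Scope classical_set_scope.
Local Open Scope ring_scope.

(** * Square-integrable functions *)

(** The weight [q / xi] is forced. Truncation deletes the last drift component [c0] of the full
    system at the truncated state. It enters the generators of |x - z|_Q^2 and |x + z|_Xi^2 only
    multiplied by the last coordinate of x, with opposite signs and with factors q and xi, so the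
    weighted sum is free of it. The mixed noise terms cancel in the same way, and the deleted noise
    leaves a nonpositive remainder. Since x + z is driven by 2 u, the gain is 2 sqrt (q / xi), where
    q = sigma and xi = sigma + 1 / sigma. This weight depends on the removed coordinate, which is
    why one state goes at a time; truncation preserves both Lyapunov inequalities, so the step can
    be repeated.

    Solutions are determined only up to modification, so no pathwise Ito formula is at hand. All
    stochastic arguments are identities between inner products in L2 of Omega and in L2 of time x
    Omega. *)

Section SquareIntegrable.
Context d (T : measurableType d) (R : realType) (mu : {measure set T -> \bar R}).
Implicit Types f g h : T -> R.

Definition sqint f :=
  measurable_fun setT f /\ mu.-integrable setT (fun x => (f x ^+ 2)%:E).

(** The L2 inner product on functions rather than on classes. It has a real value by convention even
    when the product is not integrable, hence the [sqint] hypotheses in its rules. *)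
Definition ip f g : R := \int[mu]_x (f x * g x).

Lemma sqint_intr f : measurable_fun setT f ->
  (\int[mu]_x (f x ^+ 2)%:E < +oo)%E -> sqint f.
Proof.
move=> mf foo; split=> //; apply/integrableP; split.
  by apply/measurable_EFinP; exact: measurable_funX.
apply: le_lt_trans foo; rewrite le_eqVlt; apply/orP; left; apply/eqP.
by apply: eq_integral => x _; rewrite gee0_abs// lee_fin sqr_ge0.
Qed.

Lemma sqint_lty f : sqint f -> (\int[mu]_x (f x ^+ 2)%:E < +oo)%E.
Proof. by move=> [_ /integrable_lty]; exact. Qed.

Lemma sqint_mul f g : sqint f -> sqint g ->
  mu.-integrable setT (fun x => (f x * g x)%:E).
Proof.
move=> [mf intf] [mg intg].
have intfg := integrableD measurableT intf intg.
apply: le_integrable intfg => //.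
  by apply/measurable_EFinP; exact: measurable_funM.
move=> x _ /=; rewrite lee_fin [leRHS]ger0_norm ?addr_ge0 ?sqr_ge0//.
by rewrite ler_norml; apply/andP; split; have := sqr_ge0 (f x + g x);
  have := sqr_ge0 (f x - g x); have := sqr_ge0 (f x); have := sqr_ge0 (g x); nra.
Qed.

Lemma sqintD f g : sqint f -> sqint g -> sqint (fun x => f x + g x).
Proof.
move=> sf sg; split; first by apply: measurable_funD; [apply: sf.1|apply: sg.1].
have /= := integrableD measurableT
  (integrableD measurableT sf.2 (integrableZl measurableT 2 (sqint_mul sf sg)))
  sg.2.
apply: eq_integrable => // x _ /=.
by rewrite -!EFinM -!EFinD; congr (_%:E); ring.
Qed.

Lemma sqintZ (c : R) f : sqint f -> sqint (fun x => c * f x).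
Proof.
move=> sf; split; first by apply: measurable_funM => //; exact: sf.1.
have := integrableZl measurableT (c ^+ 2) sf.2.
by apply: eq_integrable => // x _ /=; rewrite -EFinM exprMn.
Qed.

Lemma sqintN f : sqint f -> sqint (fun x => - f x).
Proof.
move=> /(sqintZ (-1)); congr sqint.
by apply/funext => x; rewrite mulN1r.
Qed.

Lemma sqintB f g : sqint f -> sqint g -> sqint (fun x => f x - g x).
Proof. by move=> sf /sqintN sg; exact: sqintD. Qed.

Lemma sqint0 : sqint (fun=> 0).
Proof.
split=> //; apply: eq_integrable (integrable0 mu _) => // x _.
by rewrite expr0n.
Qed.

Lemma sqint_sum I (s : seq I) (f : I -> T -> R) :
  (forall i, sqint (f i)) -> sqint (fun x => \sum_(i <- s) f i x).
Proof.
move=> sf; elim: s => [|i s IH].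
  have -> : (fun x => \sum_(i <- [::]) f i x) = (fun=> 0); last exact: sqint0.
  by apply/funext => x; rewrite big_nil.
have -> : (fun x => \sum_(j <- i :: s) f j x) =
    (fun x => f i x + \sum_(j <- s) f j x).
  by apply/funext => x; rewrite big_cons.
exact: sqintD.
Qed.

Lemma sqint_dominated f g : measurable_fun setT f -> sqint g ->
  (forall x, f x ^+ 2 <= g x ^+ 2) -> sqint f.
Proof.
move=> mf [mg ig] fg; split=> //; apply: le_integrable ig => //.
  by apply/measurable_EFinP; exact: measurable_funX.
by move=> x _ /=; rewrite lee_fin !ger0_norm ?sqr_ge0.
Qed.

Lemma ipE f g : sqint f -> sqint g ->
  (ip f g)%:E = (\int[mu]_x (f x * g x)%:E)%E.
Proof.
move=> sf sg; rewrite /ip /Rintegral fineK//.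
by apply: integrable_fin_num => //; exact: sqint_mul.
Qed.

Lemma ipC f g : ip f g = ip g f.
Proof. by apply: eq_Rintegral => x _; rewrite mulrC. Qed.

Lemma ipDl f g h : sqint f -> sqint g -> sqint h ->
  ip (fun x => f x + g x) h = ip f h + ip g h.
Proof.
move=> sf sg sh; rewrite /ip -RintegralD//; try exact: sqint_mul.
by apply: eq_Rintegral => x _; rewrite mulrDl.
Qed.

Lemma ipZl (c : R) f h : sqint f -> sqint h ->
  ip (fun x => c * f x) h = c * ip f h.
Proof.
move=> sf sh; rewrite /ip -RintegralZl//; try exact: sqint_mul.
by apply: eq_Rintegral => x _; rewrite mulrA.
Qed.

Lemma ipNl f h : sqint f -> sqint h -> ip (fun x => - f x) h = - ip f h.
Proof.
move=> sf sh; rewrite -mulN1r -ipZl//; congr ip.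
by apply/funext => x; rewrite mulN1r.
Qed.

Lemma ipBl f g h : sqint f -> sqint g -> sqint h ->
  ip (fun x => f x - g x) h = ip f h - ip g h.
Proof. by move=> sf sg sh; rewrite ipDl ?ipNl//; exact: sqintN. Qed.

Lemma ipDr f g h : sqint f -> sqint g -> sqint h ->
  ip h (fun x => f x + g x) = ip h f + ip h g.
Proof. by move=> *; rewrite ipC ipDl// !(ipC h). Qed.

Lemma ipBr f g h : sqint f -> sqint g -> sqint h ->
  ip h (fun x => f x - g x) = ip h f - ip h g.
Proof. by move=> *; rewrite ipC ipBl// !(ipC h). Qed.

Lemma ipZr (c : R) f h : sqint f -> sqint h ->
  ip h (fun x => c * f x) = c * ip h f.
Proof. by move=> *; rewrite ipC ipZl// (ipC h). Qed.

Lemma ip_suml I (s : seq I) (f : I -> T -> R) h :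
  (forall i, sqint (f i)) -> sqint h ->
  ip (fun x => \sum_(i <- s) f i x) h = \sum_(i <- s) ip (f i) h.
Proof.
move=> sf sh; elim: s => [|i s IH].
  rewrite big_nil /ip; under eq_Rintegral do rewrite big_nil mul0r.
  by rewrite /Rintegral integral0.
rewrite big_cons -IH -ipDl//; last exact: sqint_sum.
by apply: eq_Rintegral => x _; rewrite big_cons.
Qed.

Lemma ip_sumr I (s : seq I) (f : I -> T -> R) h :
  (forall i, sqint (f i)) -> sqint h ->
  ip h (fun x => \sum_(i <- s) f i x) = \sum_(i <- s) ip h (f i).
Proof.
by move=> sf sh; rewrite ipC ip_suml//; apply: eq_bigr => i _; rewrite ipC.
Qed.

Lemma ip_ge0 f : 0 <= ip f f.
Proof. by apply: Rintegral_ge0 => x _; rewrite -expr2 sqr_ge0. Qed.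

Lemma ip_ae_eq f f' g : measurable_fun setT f -> measurable_fun setT f' ->
  measurable_fun setT g ->
  {ae mu, forall x, f x = f' x} -> ip f g = ip f' g.
Proof.
move=> mf mf' mg [N [mN N0 fN]]; rewrite /ip /Rintegral; congr fine.
apply: ae_eq_integral => //; [exact/measurable_EFinP/measurable_funM|
  exact/measurable_EFinP/measurable_funM|].
exists N; split=> // x /= nfg; apply: fN => /= ff; apply: nfg => _.
by rewrite ff.
Qed.

(* The discriminant argument for the form [ip] on square-integrable functions. *)
Lemma ip_cauchy_schwarz f g : sqint f -> sqint g ->
  ip f g ^+ 2 <= ip f f * ip g g.
Proof.
move=> sf sg.
have quad c : 0 <= ip f f - c * ip f g *+ 2 + c ^+ 2 * ip g g.
  have := ip_ge0 (fun x => f x - c * g x).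
  have scg := sqintZ c sg.
  rewrite (ipBl sf scg (sqintB sf scg)) !ipBr// !(ipZl, ipZr)// (ipC g f).
  by congr (0 <= _); ring.
have := ip_ge0 g; rewrite le_eqVlt => /orP[/eqP g0|g0].
  rewrite -g0 mulr0; have [->|fg0] := eqVneq (ip f g) 0; first by rewrite expr0n.
  (* When [ip g g = 0] the form is affine in its parameter; this parameter gives it the value -1. *)
  have := quad ((ip f f + 1) / (ip f g *+ 2)); rewrite -g0 mulr0 addr0.
  rewrite -mulrnAr mulrVK ?unitfE ?mulrn_eq0//; lra.
have := quad (ip f g / ip g g) => /(mulr_ge0 (ltW g0)).
set a := ip f g; set b := ip g g in g0 *.
have -> : b * (ip f f - a / b * a *+ 2 + (a / b) ^+ 2 * b) =
    ip f f * b - a ^+ 2 by field; rewrite gt_eqF.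
by rewrite subr_ge0.
Qed.

Lemma ip_cvg0 (f : nat -> T -> R) g : (forall l, sqint (f l)) -> sqint g ->
  ip (f l) (f l) @[l --> \oo] --> (0 : R) -> ip (f l) g @[l --> \oo] --> (0 : R).
Proof.
move=> sf sg f0; apply/norm_cvg0P.
have bnd l : 0 <= `|ip (f l) g| <= Num.sqrt (ip (f l) (f l) * ip g g).
  rewrite normr_ge0/= -sqrtr_sqr ler_wsqrtr//.
  exact: ip_cauchy_schwarz.
apply: (@squeeze_cvgr _ _ _ _ (cst 0) (fun l => Num.sqrt (ip (f l) (f l) * ip g g))).
- exact: nearW.
- exact: cvg_cst.
- rewrite -[X in _ --> X](sqrtr0 R) -(mul0r (ip g g)).
  apply: continuous_cvg; first exact: sqrt_continuous.
  by apply: cvgM => //; exact: cvg_cst.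
Qed.

(** Expanding around the limits leaves three error terms: two pair a null sequence with a fixed
    function, and the last pairs two null sequences. *)
Lemma ip_cvg (f g : nat -> T -> R) f0 g0 :
  (forall l, sqint (f l)) -> (forall l, sqint (g l)) -> sqint f0 -> sqint g0 ->
  ip (fun x => f0 x - f l x) (fun x => f0 x - f l x) @[l --> \oo] --> (0 : R) ->
  ip (fun x => g0 x - g l x) (fun x => g0 x - g l x) @[l --> \oo] --> (0 : R) ->
  ip (f l) (g l) @[l --> \oo] --> ip f0 g0.
Proof.
move=> sf sg sf0 sg0 cf cg.
have sdf l : sqint (fun x => f0 x - f l x) by exact: sqintB.
have sdg l : sqint (fun x => g0 x - g l x) by exact: sqintB.
have E l : ip (f l) (g l) = ip f0 g0 - ip (fun x => f0 x - f l x) g0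
    - ip (fun x => g0 x - g l x) f0
    + ip (fun x => f0 x - f l x) (fun x => g0 x - g l x).
  rewrite (ipBl _ _ (sdg l))// !ipBr// !ipBl// (ipC g0 f0) (ipC (g l) f0); ring.
pose p l := ip f0 g0 - ip (fun x => f0 x - f l x) g0
    - ip (fun x => g0 x - g l x) f0.
have cp : p l @[l --> \oo] --> ip f0 g0.
  rewrite -[X in _ --> X]subr0; apply: cvgB; last exact: ip_cvg0.
  rewrite -[X in _ --> X]subr0; apply: cvgB; last exact: ip_cvg0.
  exact: cvg_cst.
pose z l := ip (fun x => f0 x - f l x) (fun x => g0 x - g l x).
rewrite (_ : (fun l => ip (f l) (g l)) = p \+ z); last first.
  by apply/funext => l; rewrite E.
rewrite -[X in _ --> X]addr0; apply: (cvgD cp); rewrite /z.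
apply/norm_cvg0P.
apply: (@squeeze_cvgr _ _ _ _ (cst 0) (fun l =>
  Num.sqrt (ip (fun x => f0 x - f l x) (fun x => f0 x - f l x) *
            ip (fun x => g0 x - g l x) (fun x => g0 x - g l x)))).
- apply: nearW => l; rewrite normr_ge0/= -sqrtr_sqr ler_wsqrtr//.
  exact: ip_cauchy_schwarz.
- exact: cvg_cst.
- rewrite -[X in _ --> X](sqrtr0 R) -(mul0r 0).
  apply: continuous_cvg; first exact: sqrt_continuous.
  exact: cvgM.
Qed.

End SquareIntegrable.

(** * Independence *)

Section SubSigmaAlgebra.
Context (Omega : pointedType) (R : realType).
Implicit Types (G : set (set Omega)) (f g : Omega -> R).

Definition smeas G f := forall E : set R, measurable E -> G (f @^-1` E).

(** Members of a filtration are bare set systems. Passing to the measurable type that they generate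
    lets [smeas] inherit its closure properties from [measurable_fun]. *)
Lemma smeasP G f : sigma_algebra setT G ->
  smeas G f <-> measurable_fun [set: g_sigma_algebraType G] f.
Proof.
move=> sG; split=> [mf _ E mE|mf E mE].
  by rewrite setTI; apply: sub_gen_smallest; exact: mf.
have /= := mf measurableT E mE; rewrite setTI /measurable/=.
by rewrite sigma_algebra_id.
Qed.

Lemma smeasS G H f : G `<=` H -> smeas G f -> smeas H f.
Proof. by move=> GH Gf E mE; apply: GH; exact: Gf. Qed.

Lemma smeas_cst G c : sigma_algebra setT G -> smeas G (fun=> c).
Proof. by move=> sG; apply/smeasP. Qed.

Lemma smeasD G f g : sigma_algebra setT G -> smeas G f -> smeas G g ->
  smeas G (fun w => f w + g w).
Proof.
by move=> sG /(smeasP _ sG) mf /(smeasP _ sG) mg; apply/smeasP => //;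
  exact: measurable_funD.
Qed.

Lemma smeasM G f g : sigma_algebra setT G -> smeas G f -> smeas G g ->
  smeas G (fun w => f w * g w).
Proof.
by move=> sG /(smeasP _ sG) mf /(smeasP _ sG) mg; apply/smeasP => //;
  exact: measurable_funM.
Qed.

Lemma smeasB G f g : sigma_algebra setT G -> smeas G f -> smeas G g ->
  smeas G (fun w => f w - g w).
Proof.
by move=> sG /(smeasP _ sG) mf /(smeasP _ sG) mg; apply/smeasP => //;
  exact: measurable_funB.
Qed.

Lemma smeas_sum G I (s : seq I) (f : I -> Omega -> R) :
  sigma_algebra setT G -> (forall i, smeas G (f i)) ->
  smeas G (fun w => \sum_(i <- s) f i w).
Proof.
move=> sG mf; elim: s => [|i s IH].
  rewrite (_ : (fun w => _) = fun=> 0); first exact: smeas_cst.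
  by apply/funext => w; rewrite big_nil.
rewrite (_ : (fun w => _) = fun w => f i w + \sum_(j <- s) f j w).
  exact: smeasD.
by apply/funext => w; rewrite big_cons.
Qed.

End SubSigmaAlgebra.

Section Independence.
Context d (Omega : measurableType d) (R : realType) (P : probability Omega R).

Lemma smeas_measurable (G : set (set Omega)) (f : Omega -> R) :
  G `<=` measurable -> smeas G f -> measurable_fun setT f.
Proof. by move=> GM Gf _ E mE; rewrite setTI; apply: GM; exact: Gf. Qed.

Section Pair.
Variables X Y : {RV P >-> R}.
Hypothesis indXY : forall A B, measurable A -> measurable B ->
  P (X @^-1` A `&` Y @^-1` B) = (P (X @^-1` A) * P (Y @^-1` B))%E.

Let mXY : measurable_fun setT (fun w => (X w, Y w)).
Proof. exact: measurable_fun_pair. Qed.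

Let XY : {mfun Omega >-> (R * R)%type} :=
  HB.pack (fun w => (X w, Y w)) (isMeasurableFun.Build _ _ _ _ _ mXY).

(** Independence fixes the joint law on rectangles, and the product measure is determined by its
    values there. *)
Let lawXY (A : set (R * R)) : measurable A ->
  (distribution P X \x distribution P Y)%E A = distribution P XY A.
Proof.
by move=> mA; apply: product_measure_unique.
Qed.

Let mmul : measurable_fun [set: (R * R)%type] (fun z => (z.1 * z.2)%:E).
Proof. exact/measurable_EFinP/measurable_funM. Qed.

Let int_law (Z : {RV P >-> R}) : P.-integrable setT (EFin \o Z) ->
  (distribution P Z).-integrable setT EFin.
Proof.
by move=> iZ; apply: integrable_pushforward => //; rewrite preimage_setT.
Qed.

Let tonelli (g h : R -> \bar R) : measurable_fun setT g -> measurable_fun setT h ->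
  (forall x, 0 <= g x)%E -> (forall x, 0 <= h x)%E ->
  (\int[P]_w (g (X w) * h (Y w)) =
   (\int[P]_w g (X w)) * (\int[P]_w h (Y w)))%E.
Proof.
move=> mg mh g0 h0.
have mgh : measurable_fun [set: (R * R)%type] (fun z => g z.1 * h z.2)%E.
  by apply: emeasurable_funM; apply: measurableT_comp.
transitivity (\int[distribution P XY]_z (g z.1 * h z.2))%E.
  by rewrite ge0_integral_distribution// => z; rewrite mule_ge0.
transitivity (\int[distribution P X \x distribution P Y]_z (g z.1 * h z.2))%E.
  by apply: eq_measure_integral => A mA _; apply/esym; exact: lawXY.
rewrite (fubini_tonelli1 (fun z => g z.1 * h z.2)%E)//=; last first.
  by move=> z; rewrite mule_ge0.
rewrite /fubini_F/=.
transitivity (\int[distribution P X]_x (g x * \int[P]_w h (Y w)))%E.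
  apply: eq_integral => x _; rewrite ge0_integralZl//.
  by rewrite ge0_integral_distribution.
rewrite ge0_integralZr//; last exact: integral_ge0.
by rewrite ge0_integral_distribution.
Qed.

(** By Tonelli under the product law, E |X Y| = E |X| E |Y|. Only first moments enter, so the lemma
    applies to a squared coefficient times a squared increment, where Cauchy-Schwarz would ask for
    fourth moments. *)
Lemma integrable_mul_indep :
  P.-integrable setT (EFin \o X) -> P.-integrable setT (EFin \o Y) ->
  P.-integrable setT (fun w => (X w * Y w)%:E).
Proof.
move=> iX iY; apply/integrableP; split.
  by apply/measurable_EFinP; exact: measurable_funM.
rewrite (_ : (fun w => _) = fun w => (`|(X w)%:E| * `|(Y w)%:E|)%E); last first.
  by apply/funext => w; rewrite EFinM abseM.
rewrite (tonelli (g := abse \o EFin) (h := abse \o EFin))//=; last 2 first.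
  by apply: measurableT_comp => //; exact/measurable_EFinP.
  by apply: measurableT_comp => //; exact/measurable_EFinP.
move: iX iY => /integrableP[_ iX] /integrableP[_ iY].
by rewrite lte_mul_pinfty ?integral_ge0// ge0_fin_numE ?integral_ge0.
Qed.

Lemma Rintegral_mul_indep :
  P.-integrable setT (EFin \o X) -> P.-integrable setT (EFin \o Y) ->
  \int[P]_w (X w * Y w) = (\int[P]_w X w) * (\int[P]_w Y w).
Proof.
move=> iX iY; have iXY := integrable_mul_indep iX iY.
rewrite /Rintegral -fineM ?integrable_fin_num//; congr fine.
transitivity (\int[distribution P XY]_z (z.1 * z.2)%:E)%E.
  by rewrite integral_distribution.
transitivity (\int[distribution P X \x distribution P Y]_z (z.1 * z.2)%:E)%E.
  by apply: eq_measure_integral => A mA _; apply/esym; exact: lawXY.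
rewrite -(integral12_prod_meas1 (f := fun z : R * R => (z.1 * z.2)%:E))/=; last first.
  apply/integrable12ltyP => //=.
  have -> : (\int[distribution P X]_x \int[distribution P Y]_y `|(x * y)%:E| =
      \int[P]_w `|(X w * Y w)%:E|)%E; last by have /integrableP[] := iXY.
  transitivity (\int[distribution P X \x distribution P Y]_z `|(z.1 * z.2)%:E|)%E.
    rewrite (fubini_tonelli1 (fun z : R * R => `|(z.1 * z.2)%:E|%E))//=.
    by apply/measurable_EFinP/measurableT_comp => //; exact: measurable_funM.
  transitivity (\int[distribution P XY]_z `|(z.1 * z.2)%:E|)%E.
    by apply: eq_measure_integral => A mA _; exact: lawXY.
  rewrite ge0_integral_distribution//; apply/measurable_EFinP/measurableT_comp => //.
  exact: measurable_funM.
rewrite /fubini_F/=.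
transitivity (\int[distribution P X]_x (x%:E * \int[P]_w (Y w)%:E))%E.
  apply: eq_integral => x _.
  under eq_integral do rewrite EFinM.
  rewrite integralZl//; last exact: int_law.
  by rewrite integral_distribution.
have -> : (\int[P]_w (Y w)%:E = (fine (\int[P]_w (Y w)%:E))%:E)%E.
  by rewrite fineK// integrable_fin_num.
rewrite integralZr//; last exact: int_law.
by rewrite integral_distribution.
Qed.

End Pair.

Definition indep_sets (G H : set (set Omega)) :=
  forall A E, G A -> H E -> P (A `&` E) = (P A * P E)%E.

Section SubSigma.
Variables (G H : set (set Omega)).
Hypotheses (GM : G `<=` measurable) (HM : H `<=` measurable).
Hypothesis GH : indep_sets G H.
Variables (X Y : Omega -> R).
Hypotheses (GX : smeas G X) (HY : smeas H Y).

Let X' : {RV P >-> R} :=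
  HB.pack X (isMeasurableFun.Build _ _ _ _ _ (smeas_measurable GM GX)).
Let Y' : {RV P >-> R} :=
  HB.pack Y (isMeasurableFun.Build _ _ _ _ _ (smeas_measurable HM HY)).

Let indXY A B : measurable A -> measurable B ->
  P (X' @^-1` A `&` Y' @^-1` B) = (P (X' @^-1` A) * P (Y' @^-1` B))%E.
Proof. by move=> mA mB; apply: GH; [exact: GX|exact: HY]. Qed.

Lemma integrable_mul_indep_sets :
  P.-integrable setT (EFin \o X) -> P.-integrable setT (EFin \o Y) ->
  P.-integrable setT (fun w => (X w * Y w)%:E).
Proof. exact: (integrable_mul_indep indXY). Qed.

Lemma Rintegral_mul_indep_sets :
  P.-integrable setT (EFin \o X) -> P.-integrable setT (EFin \o Y) ->
  \int[P]_w (X w * Y w) = (\int[P]_w X w) * (\int[P]_w Y w).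
Proof. exact: (Rintegral_mul_indep indXY). Qed.

End SubSigma.
End Independence.

(** * Ito integrals *)

Section WienerIncrements.
Context (R : realType) (d : measure_display) (Omega : measurableType d).
Variables (Pr : probability Omega R) (F : R -> set (set Omega)).
Hypothesis hF : usual_filtration Pr F.
Variables (q : nat) (K : 'M[R]_q) (W : R -> Omega -> 'cV[R]_q).
Hypothesis hW : wiener Pr F K W.

Lemma filtration_sigma_algebra t : 0 <= t -> sigma_algebra setT (F t).
Proof. by case: hF => h _ _ _ _; exact: h. Qed.

Lemma filtration_measurable t : 0 <= t -> F t `<=` measurable.
Proof. by case: hF => _ h _ _ _; exact: h. Qed.

Lemma filtration_le s t : 0 <= s -> s <= t -> F s `<=` F t.
Proof. by case: hF => _ _ h _ _; exact: h. Qed.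

Definition adapted_sqint t (X : Omega -> R) := smeas (F t) X /\ sqint Pr X.

Lemma adapted_sqint_le s t X : 0 <= s -> s <= t ->
  adapted_sqint s X -> adapted_sqint t X.
Proof.
by move=> s0 st [mX sX]; split=> //; exact: smeasS (filtration_le s0 st) mX.
Qed.

Definition incr i s t (w : Omega) : R := W t w i 0 - W s w i 0.

Lemma wiener_entry_sqint t i : 0 <= t -> sqint Pr (fun w => W t w i 0).
Proof.
move=> t0; apply: sqint_intr.
  apply: (smeas_measurable (filtration_measurable t0)).
  exact: (wiener_adapted hW t0).
have := wiener_covariance hW i i t0; rewrite unlock => covE.
rewrite (eq_integral (fun w => ((W t w *m (W t w)^T) i i)%:E)) ?covE ?ltry//.
by move=> w _; rewrite !mxE big_ord1 !mxE expr2.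
Qed.

Lemma wiener_entry_adapted t i : 0 <= t ->
  adapted_sqint t (fun w => W t w i 0).
Proof.
move=> t0; split; last exact: wiener_entry_sqint.
exact: (wiener_adapted hW t0).
Qed.

Lemma wiener_ip t i j : 0 <= t ->
  ip Pr (fun w => W t w i 0) (fun w => W t w j 0) = K i j * t.
Proof.
move=> t0; apply: EFin_inj; rewrite -(wiener_covariance hW i j t0).
rewrite ipE; [|exact: wiener_entry_sqint..].
rewrite unlock; apply: eq_integral => w _.
by rewrite !mxE big_ord1 !mxE.
Qed.

(** Read off the covariance at time 1, an inner product. *)
Lemma wiener_cov_sym i j : K i j = K j i.
Proof.
by have := wiener_ip i j ler01; rewrite ipC wiener_ip// !mulr1.
Qed.

Lemma incr_sqint i s t : 0 <= s -> 0 <= t -> sqint Pr (incr i s t).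
Proof. by move=> s0 t0; apply: sqintB; exact: wiener_entry_sqint. Qed.

Lemma incr_adapted i s t : 0 <= s -> s <= t -> adapted_sqint t (incr i s t).
Proof.
move=> s0 st; have t0 := le_trans s0 st.
split; last exact: incr_sqint.
apply: smeasB; first exact: filtration_sigma_algebra.
  by have [] := wiener_entry_adapted i t0.
by have [] := adapted_sqint_le s0 st (wiener_entry_adapted i s0).
Qed.

Lemma sqint_integrable (X : Omega -> R) : sqint Pr X ->
  Pr.-integrable setT (EFin \o X).
Proof.
move=> sX; have s1 : sqint Pr (fun=> 1).
  split=> //; rewrite expr1n.
  exact: (@finite_measure_integrable_cst _ _ _ Pr setT 1).
have := sqint_mul sX s1.
by apply: eq_integrable => // w _ /=; rewrite mulr1.
Qed.

Lemma incr_mean i s t : 0 <= s -> 0 <= t -> \int[Pr]_w incr i s t w = 0.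
Proof.
move=> s0 t0; rewrite RintegralB//;
  [|exact/sqint_integrable/wiener_entry_sqint..].
have := wiener_mean hW i t0; have := wiener_mean hW i s0.
by rewrite unlock /Rintegral => -> ->; rewrite subrr.
Qed.

Let sigma_incr s t := sigma_of (fun w => W t w - W s w).

Let sigma_incr_measurable s t : 0 <= s -> 0 <= t ->
  sigma_incr s t `<=` measurable.
Proof.
move=> s0 t0; apply: smallest_sub; first exact: sigma_algebra_measurable.
move=> _ [i [E [mE ->]]].
have := (incr_sqint i s0 t0).1 measurableT E mE; rewrite setTI.
by congr (measurable _); apply/seteqP; split=> w /=; rewrite /incr !mxE.
Qed.

Let smeas_incr i s t : smeas (sigma_incr s t) (incr i s t).
Proof.
move=> E mE; apply: sub_gen_smallest; exists i, E; split=> //.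
by apply/seteqP; split=> w /=; rewrite /incr !mxE.
Qed.

Let incr_indep s t : 0 <= s -> s <= t -> indep_sets Pr (F s) (sigma_incr s t).
Proof.
move=> s0 st; have ts : 0 <= t - s by rewrite subr_ge0.
by have := wiener_independent hW s0 ts; rewrite subrKC.
Qed.

Section Orthogonality.
Variables (s t : R) (X : Omega -> R).
Hypotheses (s0 : 0 <= s) (st : s <= t).
Hypotheses (mX : smeas (F s) X) (iX : Pr.-integrable setT (EFin \o X)).

Let t0 : 0 <= t. Proof. exact: le_trans st. Qed.

Lemma Rintegral_mul_incr i : \int[Pr]_w (X w * incr i s t w) = 0.
Proof.
rewrite (Rintegral_mul_indep_sets (filtration_measurable s0)
  (sigma_incr_measurable s0 t0) (incr_indep s0 st))//.
- by rewrite incr_mean// mulr0.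
- exact/sqint_integrable/incr_sqint.
Qed.

Let smeas_incr2 i j :
  smeas (sigma_incr s t) (fun w => incr i s t w * incr j s t w).
Proof.
by apply: smeasM; [exact: smallest_sigma_algebra|exact: smeas_incr|
  exact: smeas_incr].
Qed.

Let integrable_incr2 i j :
  Pr.-integrable setT (EFin \o (fun w => incr i s t w * incr j s t w)).
Proof. by apply: sqint_mul; exact: incr_sqint. Qed.

Lemma integrable_mul_incr2 i j :
  Pr.-integrable setT (fun w => (X w * (incr i s t w * incr j s t w))%:E).
Proof.
exact: (integrable_mul_indep_sets (filtration_measurable s0)
  (sigma_incr_measurable s0 t0) (incr_indep s0 st)).
Qed.

(** Independence concerns the whole increment vector, and a product of two of its components is
    still measurable for the sigma-algebra that it generates. *)
Lemma Rintegral_mul_incr2 i j :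
  \int[Pr]_w (X w * (incr i s t w * incr j s t w)) =
  (\int[Pr]_w X w) * ip Pr (incr i s t) (incr j s t).
Proof.
exact: (Rintegral_mul_indep_sets (filtration_measurable s0)
  (sigma_incr_measurable s0 t0) (incr_indep s0 st)).
Qed.

End Orthogonality.

(** Expand [W t] as [W s] plus the increment: the mixed terms vanish by independence, so [K i j * t]
    is [K i j * s] plus the covariance sought. *)
Lemma incr_cov i j s t : 0 <= s -> s <= t ->
  ip Pr (incr i s t) (incr j s t) = K i j * (t - s).
Proof.
move=> s0 st; have t0 := le_trans s0 st.
have sW k u (u0 : 0 <= u) := wiener_entry_sqint k u0.
have orth k l : ip Pr (fun w => W s w k 0) (incr l s t) = 0.
  apply: Rintegral_mul_incr => //; last exact/sqint_integrable/sW.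
  by have [] := wiener_entry_adapted k s0.
have sI k := incr_sqint k s0 t0.
have := wiener_ip i j t0; have := wiener_ip i j s0.
rewrite [in X in _ -> X -> _](_ : (fun w => W t w i 0) =
    fun w => W s w i 0 + incr i s t w); last first.
  by apply/funext => w; rewrite /incr subrKC.
rewrite [in X in _ -> X -> _](_ : (fun w => W t w j 0) =
    fun w => W s w j 0 + incr j s t w); last first.
  by apply/funext => w; rewrite /incr subrKC.
rewrite (ipDl (sW i _ s0) (sI i) (sqintD (sW j _ s0) (sI j))).
rewrite (ipDr (sW j _ s0) (sI j) (sW i _ s0)) (ipDr (sW j _ s0) (sI j) (sI i)).
by rewrite (ipC _ (incr i s t)) !orth => ->; lra.
Qed.

(** The square is [X ^+ 2] times a squared increment, two independent integrable variables. *)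
Lemma sqint_mul_incr i s t X : 0 <= s -> s <= t -> adapted_sqint s X ->
  sqint Pr (fun w => X w * incr i s t w).
Proof.
move=> s0 st [mX sX]; have t0 := le_trans s0 st; split.
  by apply: measurable_funM; [exact: sX.1|have [] := incr_sqint i s0 t0].
have mXX : smeas (F s) (fun w => X w * X w).
  by apply: smeasM => //; exact: filtration_sigma_algebra.
have := integrable_mul_incr2 s0 st mXX (sqint_mul sX sX) i i.
by apply: eq_integrable => // w _; congr (_%:E); ring.
Qed.

Lemma adapted_mul_incr i s t X : 0 <= s -> s <= t -> adapted_sqint s X ->
  adapted_sqint t (fun w => X w * incr i s t w).
Proof.
move=> s0 st aX; split; last exact: sqint_mul_incr.
have t0 := le_trans s0 st.
apply: smeasM; first exact: filtration_sigma_algebra.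
  by have [] := adapted_sqint_le s0 st aX.
by have [] := incr_adapted i s0 st.
Qed.

Lemma ip_mul_incr0 i s t X Y : 0 <= s -> s <= t -> adapted_sqint s X ->
  adapted_sqint s Y -> ip Pr Y (fun w => X w * incr i s t w) = 0.
Proof.
move=> s0 st [mX sX] [mY sY].
rewrite /ip; under eq_Rintegral do rewrite mulrA.
apply: Rintegral_mul_incr => //; last exact: sqint_mul.
by apply: smeasM => //; exact: filtration_sigma_algebra.
Qed.

Lemma ip_mul_incr_same i j s t X Y : 0 <= s -> s <= t -> adapted_sqint s X ->
  adapted_sqint s Y ->
  ip Pr (fun w => X w * incr i s t w) (fun w => Y w * incr j s t w) =
  K i j * (t - s) * ip Pr X Y.
Proof.
move=> s0 st [mX sX] [mY sY].
rewrite /ip; under eq_Rintegral do rewrite mulrACA.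
rewrite (Rintegral_mul_incr2 s0 st)//; last exact: sqint_mul.
  by rewrite incr_cov// mulrC.
by apply: smeasM => //; exact: filtration_sigma_algebra.
Qed.

Lemma incr_add i s t u w : incr i s u w = incr i s t w + incr i t u w.
Proof. by rewrite /incr; ring. Qed.

Lemma mul_incr_add i s t u (X : Omega -> R) :
  (fun w => X w * incr i s u w) =
  (fun w => X w * incr i s t w + X w * incr i t u w).
Proof. by apply/funext => w; rewrite (incr_add i s t u) mulrDr. Qed.

Let ip_mul_incr_start i j s t t' X Y : 0 <= s -> s <= t -> t <= t' ->
  adapted_sqint s X -> adapted_sqint s Y ->
  ip Pr (fun w => X w * incr i s t w) (fun w => Y w * incr j s t' w) =
  K i j * (t - s) * ip Pr X Y.
Proof.
move=> s0 st tt' aX aY; have t0 := le_trans s0 st.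
rewrite (mul_incr_add j s t) ipDr; first last.
- exact: sqint_mul_incr.
- by apply: sqint_mul_incr => //; exact: adapted_sqint_le aY.
- exact: sqint_mul_incr.
rewrite ip_mul_incr_same// ip_mul_incr0 ?addr0//.
- exact: adapted_sqint_le aY.
- exact: adapted_mul_incr.
Qed.

(** Split the first increment at [s']. What precedes [s'] is known at [s'] and is orthogonal to the
    second increment; what follows starts together with the second increment, and the longer of the
    two is cut at the end of the shorter. *)
Let ip_mul_incr_sorted i j s t s' t' X Y :
  0 <= s -> s <= t -> s <= s' -> s' <= t' ->
  adapted_sqint s X -> adapted_sqint s' Y ->
  ip Pr (fun w => X w * incr i s t w) (fun w => Y w * incr j s' t' w) =
  K i j * Num.max 0 (Num.min t t' - Num.max s s') * ip Pr X Y.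
Proof.
move=> s0 st ss' s't' aX aY; have s'0 := le_trans s0 ss'.
rewrite (max_idPr ss'); have [ts'|s't] := leP t s'.
  rewrite ip_mul_incr0//; last first.
    exact: (adapted_sqint_le (le_trans s0 st) ts') (adapted_mul_incr i s0 st aX).
  rewrite (max_idPl _) ?mulr0 ?mul0r// subr_le0.
  by rewrite ge_min ts'.
have aX' := adapted_sqint_le s0 ss' aX.
rewrite (mul_incr_add i s s') ipDl; first last.
- exact: sqint_mul_incr.
- by apply: sqint_mul_incr => //; exact: ltW.
- exact: sqint_mul_incr.
rewrite ip_mul_incr0 ?add0r//; last exact: adapted_mul_incr.
have [tt'|/ltW t't] := leP t t'.
  rewrite ip_mul_incr_start//; last exact: ltW.
  by rewrite (max_idPr _)// subr_ge0 ltW.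
rewrite ipC ip_mul_incr_start// wiener_cov_sym (ipC _ Y X).
by rewrite (max_idPr _)// subr_ge0.
Qed.

(** The factor with [Num.max] is the length of the overlap of the two intervals. Allowing arbitrary
    positions spares a common refinement of two partitions in the isometry. *)
Lemma ip_mul_incr i j s t s' t' X Y : 0 <= s -> s <= t -> 0 <= s' -> s' <= t' ->
  adapted_sqint s X -> adapted_sqint s' Y ->
  ip Pr (fun w => X w * incr i s t w) (fun w => Y w * incr j s' t' w) =
  K i j * Num.max 0 (Num.min t t' - Num.max s s') * ip Pr X Y.
Proof.
move=> s0 st s'0 s't' aX aY; case/orP: (le_total s s') => [ss'|s's].
  exact: ip_mul_incr_sorted.
rewrite ipC ip_mul_incr_sorted// wiener_cov_sym (ipC _ Y X).
by rewrite (minC t') (maxC s').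
Qed.

End WienerIncrements.

(** * Products of a function of time and a random variable *)

Section Tensor.
Context d1 d2 (T1 : measurableType d1) (T2 : measurableType d2) (R : realType).
Variable m1 : {sigma_finite_measure set T1 -> \bar R}.
Variable m2 : {sigma_finite_measure set T2 -> \bar R}.

Let measurable_tensor (f : T1 -> R) (g : T2 -> R) :
  measurable_fun setT f -> measurable_fun setT g ->
  measurable_fun [set: T1 * T2] (fun z => f z.1 * g z.2).
Proof. by move=> mf mg; apply: measurable_funM; exact: measurableT_comp. Qed.

Lemma integrable_tensor (f : T1 -> R) (g : T2 -> R) :
  m1.-integrable setT (EFin \o f) -> m2.-integrable setT (EFin \o g) ->
  (m1 \x m2)%E.-integrable setT (fun z => (f z.1 * g z.2)%:E).
Proof.
move=> /integrableP[/measurable_EFinP mf if_] /integrableP[/measurable_EFinP mg ig].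
have mfg := measurable_tensor mf mg.
apply/integrable12ltyP; first exact/measurable_EFinP.
have -> : (\int[m1]_x \int[m2]_y `|(f x * g y)%:E| =
    (\int[m1]_x `|(f x)%:E|) * (\int[m2]_y `|(g y)%:E|))%E.
  rewrite -ge0_integralZr//; last 2 first.
  - by do 2 apply: measurableT_comp => //.
  - exact: integral_ge0.
  apply: eq_integral => x _; rewrite -ge0_integralZl//; last first.
    by do 2 apply: measurableT_comp => //.
  by apply: eq_integral => y _; rewrite EFinM abseM.
by rewrite lte_mul_pinfty ?integral_ge0// ge0_fin_numE ?integral_ge0.
Qed.

Lemma Rintegral_tensor (f : T1 -> R) (g : T2 -> R) :
  m1.-integrable setT (EFin \o f) -> m2.-integrable setT (EFin \o g) ->
  \int[(m1 \x m2)%E]_z (f z.1 * g z.2) = (\int[m1]_x f x) * (\int[m2]_y g y).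
Proof.
move=> if_ ig; rewrite /Rintegral -fineM ?integrable_fin_num//; congr fine.
rewrite -(integral12_prod_meas1 (integrable_tensor if_ ig)) /fubini_F/=.
rewrite -[X in (_ * X)%E]fineK ?integrable_fin_num// -integralZr//.
apply: eq_integral => x _; rewrite fineK ?integrable_fin_num//.
by rewrite -integralZl//.
Qed.

Lemma sqint_tensor (f : T1 -> R) (g : T2 -> R) : sqint m1 f -> sqint m2 g ->
  sqint (m1 \x m2)%E (fun z => f z.1 * g z.2).
Proof.
move=> [mf sf] [mg sg]; split; first exact: measurable_tensor.
have := integrable_tensor (f := fun x => f x ^+ 2) (g := fun x => g x ^+ 2) sf sg.
by apply: eq_integrable => // z _ /=; rewrite exprMn.
Qed.

Lemma ip_tensor (f f' : T1 -> R) (g g' : T2 -> R) :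
  sqint m1 f -> sqint m1 f' -> sqint m2 g -> sqint m2 g' ->
  ip (m1 \x m2)%E (fun z => f z.1 * g z.2) (fun z => f' z.1 * g' z.2) =
  ip m1 f f' * ip m2 g g'.
Proof.
move=> sf sf' sg sg'; rewrite -Rintegral_tensor; [|exact: sqint_mul..].
by apply: eq_Rintegral => z _; rewrite mulrACA.
Qed.

End Tensor.

Section Interval.
Context (R : realType).
Implicit Types s t : R.

Lemma indic_itv_sqint s t :
  sqint (@lebesgue_measure R) (\1_(`]s, t]%classic) : measurableTypeR R -> R).
Proof.
split; first exact: measurable_indic.
have : lebesgue_measure.-integrable setT
    (EFin \o (\1_(`]s, t]%classic) : R -> R)) by exact: integrable_indic_itv.
apply: eq_integrable => // x _ /=.
by rewrite indicE; case: (_ \in _); rewrite ?expr1n ?expr0n.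
Qed.

(** The same overlap length as in [ip_mul_incr]; the Ito isometry for step processes rests on this
    coincidence. *)
Lemma ip_indic_itv s t s' t' :
  ip (@lebesgue_measure R) (\1_(`]s, t]%classic)) (\1_(`]s', t']%classic)) =
  Num.max 0 (Num.min t t' - Num.max s s').
Proof.
transitivity (\int[@lebesgue_measure R]_x
    (\1_(`]Num.max s s', Num.min t t']%classic) x : R)).
  apply: eq_Rintegral => x _; rewrite !indicE -natrM mulnb.
  congr (_%:R); congr nat_of_bool.
  by apply/andP/idP; rewrite !inE/= !in_itv/= gt_max le_min;
    [case=> /andP[-> ->] /andP[-> ->]|case/andP => /andP[-> ->] /andP[-> ->]].
rewrite /Rintegral integral_indic// setIT.
have := lebesgue_measure_itv (`]Num.max s s', Num.min t t']); rewrite /= lte_fin.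
move=> ->; set b := Num.min t t'; set a := Num.max s s'.
have [lt|le] := ltP a b; rewrite ?EFinB/=; apply/esym.
  by apply/max_idPr; rewrite subr_ge0 ltW.
by apply/max_idPl; rewrite subr_le0.
Qed.

End Interval.

(** * Isometry and orthogonality for step processes *)

Section ItoIsometry.
Context (R : realType) (d : measure_display) (Omega : measurableType d).
Variables (Pr : probability Omega R) (F : R -> set (set Omega)).
Hypothesis hF : usual_filtration Pr F.
Variables (q : nat) (K : 'M[R]_q) (W : R -> Omega -> 'cV[R]_q).
Hypothesis hW : wiener Pr F K W.

Local Notation leb := (@lebesgue_measure R).
Local Notation prodm := (leb \x Pr)%E.

(** Extension by zero, so that the L2 geometry of processes on [0, T] is that of [ip] on the whole
    of time x Omega, for every [T]. *)
Definition cutoff T (v : R -> Omega -> R) (z : measurableTypeR R * Omega) : R :=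
  \1_(`[0, T]%classic) z.1 * v z.1 z.2.

Section Elementary.

(** The intervals for different [j] are not related to each other; they may overlap or be empty.
    Each coefficient need only be known at the start of its own interval. *)
Record elem_ok (al be : nat -> R) (X : nat -> Omega -> R) : Prop := ElemOk {
  elem_start : forall j, 0 <= al j;
  elem_le : forall j, al j <= be j;
  elem_adapted : forall j, adapted_sqint Pr F (al j) (X j) }.

Definition elem_fun n (al be : nat -> R) (X : nat -> Omega -> R)
    (z : measurableTypeR R * Omega) : R :=
  \sum_(j < n) \1_(`]al j, be j]%classic) z.1 * X j z.2.

Definition elem_int i n (al be : nat -> R) (X : nat -> Omega -> R) w : R :=
  \sum_(j < n) X j w * incr W i (al j) (be j) w.

Lemma elem_fun_sqint n al be X : elem_ok al be X ->
  sqint prodm (elem_fun n al be X).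
Proof.
move=> ok; apply: sqint_sum => j; apply: sqint_tensor.
  exact: indic_itv_sqint.
by have [] := elem_adapted ok j.
Qed.

Lemma elem_int_sqint i n al be X : elem_ok al be X ->
  sqint Pr (elem_int i n al be X).
Proof.
move=> ok; apply: sqint_sum => j.
exact: (sqint_mul_incr hF hW) (elem_start ok j) (elem_le ok j) (elem_adapted ok j).
Qed.

(** Both sides are double sums over pairs of intervals and agree term by term, the overlap length
    appearing in each. *)
Lemma ip_elem i i' n al be X n' al' be' X' :
  elem_ok al be X -> elem_ok al' be' X' ->
  ip Pr (elem_int i n al be X) (elem_int i' n' al' be' X') =
  K i i' * ip prodm (elem_fun n al be X) (elem_fun n' al' be' X').
Proof.
move=> ok ok'.
have sI j := sqint_mul_incr hF hW i (elem_start ok j) (elem_le ok j) (elem_adapted ok j).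
have sI' j := sqint_mul_incr hF hW i' (elem_start ok' j) (elem_le ok' j) (elem_adapted ok' j).
have sX j : sqint Pr (X j) by have [] := elem_adapted ok j.
have sX' j : sqint Pr (X' j) by have [] := elem_adapted ok' j.
have sE j := sqint_tensor (indic_itv_sqint (al j) (be j)) (sX j).
have sE' j := sqint_tensor (indic_itv_sqint (al' j) (be' j)) (sX' j).
rewrite (ip_suml _ (fun j : 'I_n => sI j)); last exact: elem_int_sqint.
rewrite (ip_suml _ (fun j : 'I_n => sE j)); last exact: elem_fun_sqint.
rewrite mulr_sumr; apply: eq_bigr => j _.
rewrite (ip_sumr _ (fun j : 'I_n' => sI' j))//.
rewrite (ip_sumr _ (fun j : 'I_n' => sE' j))//.
rewrite mulr_sumr; apply: eq_bigr => j' _.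
rewrite (ip_mul_incr hF hW); [|exact: (elem_start ok)|exact: (elem_le ok)|
  exact: (elem_start ok')|exact: (elem_le ok')|exact: (elem_adapted ok)|
  exact: (elem_adapted ok')].
rewrite ip_tensor//; [|exact: indic_itv_sqint..].
by rewrite ip_indic_itv mulrA.
Qed.

End Elementary.

Section Steps.
Variables (k : nat) (s : step_process R Omega k) (a : 'I_k).
Hypothesis adm : step_admissible Pr F s.

Let time_ge0 j : 0 <= step_time s j.
Proof.
case: adm => t0 tle _ _; elim: j => // j IH; exact: le_trans (tle j).
Qed.

Let time_le j : step_time s j <= step_time s j.+1.
Proof. by case: adm. Qed.

Lemma sqr_entry_le (v : 'cV[R]_k) : v a 0 ^+ 2 <= sqnorm2 v.
Proof.
rewrite /sqnorm2 (bigD1 a)//= lerDl sumr_ge0// => i _; exact: sqr_ge0.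
Qed.

Let value_adapted j :
  adapted_sqint Pr F (step_time s j) (fun w => step_value s j w a 0).
Proof.
case: adm => _ _ mv iv; split; first exact: mv.
have mva b : measurable_fun setT (fun w => step_value s j w b 0).
  apply: (smeas_measurable (filtration_measurable hF (time_ge0 j))).
  exact: mv.
apply: sqint_intr => //; apply: le_lt_trans (iv j).
apply: ge0_le_integral => //.
- by move=> w _; rewrite lee_fin sqr_ge0.
- exact/measurable_EFinP/measurable_funX.
- by apply/measurable_EFinP/measurable_sum => b; exact: measurable_funX.
- by move=> w _; rewrite lee_fin sqr_entry_le.
Qed.

(** Restriction of a step process to [0, T]. An interval starting after [T] collapses to the point
    [T], where its coefficient need not be known yet; [stopped_value] therefore sets it to 0, which
    is harmless because the increment vanishes. *)
Definition stopped T j := Num.min (step_time s j) T.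
Definition stopped_value T j w :=
  if step_time s j <= T then step_value s j w a 0 else 0.

Lemma stopped_ok T : 0 <= T ->
  elem_ok (stopped T) (fun j => stopped T j.+1) (stopped_value T).
Proof.
move=> T0; split=> j; rewrite /stopped ?le_min ?time_ge0//.
  by rewrite ge_min time_le/= ge_min lexx orbT.
rewrite /stopped_value; have [jT|jT] := leP; first exact: value_adapted.
split; last exact: sqint0.
by apply: smeas_cst; apply: (filtration_sigma_algebra hF); rewrite ?le_min ?time_ge0.
Qed.

Lemma step_integral_elem i T w : 0 <= T ->
  step_integral s (fun t w => W t w i 0) T w a 0 =
  elem_int i (step_size s) (stopped T) (fun j => stopped T j.+1)
    (stopped_value T) w.
Proof.
move=> T0; rewrite /step_integral summxE; apply: eq_bigr => j _.
rewrite !mxE mulrC /stopped_value /incr /stopped; case: leP => // jT.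
have -> : Num.min (step_time s j.+1) T = T.
  by apply/min_idPr; exact: le_trans (ltW jT) (time_le _).
by rewrite subrr mulr0 mul0r.
Qed.

Lemma step_fun_elem T : 0 <= T ->
  cutoff T (fun t w => step_fun s t w a 0) =
  elem_fun (step_size s) (stopped T) (fun j => stopped T j.+1)
    (stopped_value T).
Proof.
move=> T0; apply/funext => -[t w]; rewrite /cutoff /step_fun summxE mulr_sumr.
apply: eq_bigr => j _ /=; rewrite !mxE mulrA /stopped_value /stopped.
have tj1 := time_le j; have tj0 := time_ge0 j.
case: leP => jT.
  congr (_ * _); rewrite !indicE -natrM mulnb; congr (_%:R); congr nat_of_bool.
  apply/andP/idP; rewrite !inE/= !in_itv/= ?le_min.
    by case=> /andP[t0 tT] /andP[-> ->]; rewrite tT.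
  move=> /andP[lt /andP[-> ->]]; rewrite lt; split=> //.
  by rewrite (le_trans tj0) ?ltW.
rewrite mulr0 !indicE -natrM mulnb; apply/eqP; rewrite mulf_eq0; apply/orP; left.
apply/eqP; rewrite (_ : _ && _ = false)//; apply/negbTE/negP.
move=> /andP[]; rewrite !inE/= !in_itv/= => /andP[_ tT] /andP[jt _].
by have := lt_trans (le_lt_trans tT jT) jt; rewrite ltxx.
Qed.

(* Between [t] and [T] each increment is taken over an interval starting after
   both [t] and the time at which its coefficient is known. *)
Lemma ip_step_integral_orth i t T Y : 0 <= t -> t <= T -> adapted_sqint Pr F t Y ->
  let I t w := step_integral s (fun t w => W t w i 0) t w a 0 in
  ip Pr Y (I T) = ip Pr Y (I t).
Proof.
move=> t0 tT aY I; have T0 := le_trans t0 tT.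
have okT := stopped_ok T0; have okt := stopped_ok t0.
have [mY sY] := aY.
have sI u : 0 <= u -> sqint Pr (I u).
  move=> u0; rewrite (_ : I u = elem_int i (step_size s) (stopped u)
    (fun j => stopped u j.+1) (stopped_value u)).
    exact/elem_int_sqint/stopped_ok.
  by apply/funext => w; rewrite -step_integral_elem.
apply/eqP; rewrite -subr_eq0 -ipBr//; [apply/eqP|exact: sI..].
pose al j := Num.max t (stopped T j).
have al_le j : al j <= al j.+1.
  have := elem_le okT j; rewrite /al => h.
  by rewrite ge_max le_max lexx/= le_max h orbT.
have al0 j : 0 <= al j by rewrite le_max t0.
rewrite (_ : (fun w => _) = fun w => \sum_(j < step_size s)
    stopped_value T j w * incr W i (al j) (al j.+1) w); last first.
  apply/funext => w; rewrite /I /step_integral !summxE -sumrB.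
  apply: eq_bigr => j _; rewrite !mxE -mulrBl mulrC.
  (* Clipping times to [t, T] yields the difference between stopping at [T] and stopping at [t], up
     to [W t], which cancels in increments. *)
  have stop u : W (Num.max t (Num.min u T)) w i 0 =
      W (Num.min u T) w i 0 - W (Num.min u t) w i 0 + W t w i 0.
    have [ut|/ltW tu] := leP u t.
      by rewrite (min_idPl (le_trans ut tT)) (max_idPl ut) subrr add0r.
    by rewrite (max_idPr _) ?addrNK// le_min tu.
  rewrite /stopped_value /incr /al /stopped !stop.
  have [jT|] := boolP (step_time s j <= T); first by congr (_ * _); ring.
  rewrite -ltNge => /ltW jT; have jT1 := le_trans jT (time_le j).
  rewrite (min_idPr jT) (min_idPr jT1) (min_idPr (le_trans tT jT)).
  by rewrite (min_idPr (le_trans tT jT1)); ring.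
have sS j : adapted_sqint Pr F (al j) (stopped_value T j).
  apply: (adapted_sqint_le hF _ _ (elem_adapted okT j)); first exact: elem_start okT j.
  by rewrite le_max lexx orbT.
have sSI j := sqint_mul_incr hF hW i (al0 j) (al_le j) (sS j).
rewrite (ip_sumr _ (fun j : 'I_(step_size s) => sSI j))// big1// => j _.
rewrite (ip_mul_incr0 hF hW)//.
by apply: (adapted_sqint_le hF t0 _ aY); rewrite le_max lexx.
Qed.

End Steps.
End ItoIsometry.

(** * From iterated integrals to the product measure *)

Section Cutoff.
Context (R : realType) (d : measure_display) (Omega : measurableType d).
Variables (Pr : probability Omega R) (F : R -> set (set Omega)).

Local Notation leb := (@lebesgue_measure R).
Local Notation prodm := (leb \x Pr)%E.
Implicit Types T : R.

Lemma cutoff_patch T (v : R -> Omega -> R) :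
  cutoff T v = (fun z => v z.1 z.2) \_ (`[0, T]%classic `*` [set: Omega]).
Proof.
apply/funext => -[t w]; rewrite /cutoff patchE indicE/=.
have -> : ((t, w) \in `[0, T]%classic `*` [set: Omega]) = (t \in `[0, T]%classic).
  by apply/idP/idP; rewrite !inE//= => -[].
by case: (_ \in _); rewrite ?mul1r ?mul0r.
Qed.

Lemma measurable_cutoff T (v : R -> Omega -> R) :
  measurable_fun (`[0, T]%classic `*` [set: Omega])
    (fun z : measurableTypeR R * Omega => v z.1 z.2) ->
  measurable_fun setT (cutoff T v).
Proof.
rewrite cutoff_patch => mv.
have mD : measurable (`[0, T]%classic `*` [set: Omega] :
    set (measurableTypeR R * Omega)).
  by apply: measurableX => //; exact: measurable_itv.
exact: (measurable_restrictT _ mD).1 mv.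
Qed.

Lemma integral_cutoff_sqr T (v : R -> Omega -> R) :
  measurable_fun setT (cutoff T v) ->
  (\int[prodm]_z (cutoff T v z ^+ 2)%:E =
   \int[Pr]_w \int[leb]_(t in `[0%R, T]) (v t w ^+ 2)%:E)%E.
Proof.
move=> mv.
rewrite (fubini_tonelli2 (fun z => (cutoff T v z ^+ 2)%:E))/=; last 2 first.
- exact/measurable_EFinP/measurable_funX.
- by move=> z; rewrite lee_fin sqr_ge0.
apply: eq_integral => w _; rewrite /fubini_G [RHS]integral_mkcond.
apply: eq_integral => t _; rewrite patchE /cutoff/= indicE.
by case: (_ \in _); rewrite ?mul1r// mul0r expr0n.
Qed.

Lemma measurable_cutoff_section T (v : R -> Omega -> R) w :
  measurable_fun setT (cutoff T v) ->
  measurable_fun (`[0, T]%classic : set (measurableTypeR R)) (v ^~ w).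
Proof.
move=> mv; apply/measurable_restrictT => //.
rewrite (_ : _ \_ _ = fun t => cutoff T v (t, w)).
  by apply: (measurableT_comp mv); exact: measurable_fun_pair.
apply/funext => t; rewrite patchE /cutoff indicE/=.
by case: (_ \in _); rewrite ?mul1r ?mul0r.
Qed.

Lemma measurable_integral_cutoff_sqr T (v : R -> Omega -> R) :
  measurable_fun setT (cutoff T v) ->
  measurable_fun setT (fun w => \int[leb]_(t in `[0%R, T]) (v t w ^+ 2)%:E)%E.
Proof.
move=> mv.
have := measurable_fun_fubini_tonelli_G (m1 := leb) (fun z => (cutoff T v z ^+ 2)%:E).
rewrite /fubini_G/= => h.
rewrite (_ : (fun w => _) =
  fun w => (\int[leb]_t (cutoff T v (t, w) ^+ 2)%:E)%E).
  apply: h; first exact/measurable_EFinP/measurable_funX.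
  by move=> z; rewrite lee_fin sqr_ge0.
apply/funext => w; rewrite [LHS]integral_mkcond.
apply: eq_integral => t _; rewrite patchE /cutoff/= indicE.
by case: (_ \in _); rewrite ?mul1r// mul0r expr0n.
Qed.

(** The left side is what [L2norm] takes the square root of. Measurability is asked of the cutoffs
    only, since processes are constrained only on [0, T]. *)
Lemma integral_sqnorm2_cutoff T k (v : R -> Omega -> 'cV[R]_k) :
  (forall a, measurable_fun setT (cutoff T (fun t w => v t w a 0))) ->
  (\int[Pr]_w \int[leb]_(t in `[0%R, T]) (sqnorm2 (v t w))%:E =
   \sum_(a < k) \int[prodm]_z (cutoff T (fun t w => v t w a 0) z ^+ 2)%:E)%E.
Proof.
move=> mv; under [RHS]eq_bigr do rewrite integral_cutoff_sqr//.
rewrite -ge0_integral_sum//; last 2 first.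
- by move=> a; exact: (measurable_integral_cutoff_sqr (mv a)).
- by move=> a w _; apply: integral_ge0 => t _; rewrite lee_fin sqr_ge0.
apply: eq_integral => w _; rewrite -ge0_integral_sum//.
- by apply: eq_integral => t _; rewrite /sqnorm2 sumEFin.
- move=> a; apply/measurable_EFinP/measurable_funX.
  exact: (measurable_cutoff_section w (mv a)).
- by move=> a t _; rewrite lee_fin sqr_ge0.
Qed.

Lemma sqrte_lty (x : \bar R) : (0 <= x)%E -> (sqrte x < +oo)%E -> (x < +oo)%E.
Proof.
move=> x0 sx; have := sqrte_fin_num x0.
by rewrite !ge0_fin_numE ?sqrte_ge0// sx.
Qed.

Lemma L2process_sqint T k (v : R -> Omega -> 'cV[R]_k) a :
  L2process Pr F `[0, T] v -> sqint prodm (cutoff T (fun t w => v t w a 0)).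
Proof.
case=> mv _ fin; have mc b := measurable_cutoff (v := fun t w => v t w b 0) (mv b).
apply: sqint_intr => //; have := integral_sqnorm2_cutoff mc => E.
have : (\int[Pr]_w \int[leb]_(t in `[0%R, T]) (sqnorm2 (v t w))%:E < +oo)%E.
  apply: sqrte_lty => //; apply: integral_ge0 => w _; apply: integral_ge0 => t _.
  by rewrite lee_fin sumr_ge0// => i _; exact: sqr_ge0.
rewrite E; apply: le_lt_trans; rewrite (bigD1 a)//= leeDl// sume_ge0// => b _.
by apply: integral_ge0 => z _; rewrite lee_fin sqr_ge0.
Qed.

End Cutoff.

(** * Passage to the limit in the Ito integral *)

Section ItoIntegral.
Context (R : realType) (d : measure_display) (Omega : measurableType d).
Variables (Pr : probability Omega R) (F : R -> set (set Omega)).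
Hypothesis hF : usual_filtration Pr F.
Variables (q : nat) (K : 'M[R]_q) (W : R -> Omega -> 'cV[R]_q).
Hypothesis hW : wiener Pr F K W.

Local Notation leb := (@lebesgue_measure R).
Local Notation prodm := (leb \x Pr)%E.
Local Notation entry v a := (fun t w => v t w a 0).

Let ereal_ip_cvg0 d' (T' : measurableType d') (mu : {measure set T' -> \bar R})
    (f : nat -> T' -> R) (e : nat -> \bar R) :
  (forall l, sqint mu (f l)) ->
  (forall l, (\int[mu]_x (f l x ^+ 2)%:E <= e l)%E) -> e l @[l --> \oo] --> 0%E ->
  ip mu (f l) (f l) @[l --> \oo] --> (0 : R).
Proof.
move=> sf fe e0.
have : (\int[mu]_x (f l x ^+ 2)%:E)%E @[l --> \oo] --> (0%R)%:E.
  apply: (@squeeze_cvge _ _ _ _ (cst 0%E) _ e) => //; last exact: cvg_cst.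
  apply: nearW => l; rewrite fe andbT.
  by apply: integral_ge0 => x _; rewrite lee_fin sqr_ge0.
exact: fine_cvg.
Qed.

Section OneIntegral.
Variables (T : R) (T0 : 0 <= T) (k : nat) (v M : R -> Omega -> 'cV[R]_k) (i : 'I_q).
Hypothesis hM : ito_integral Pr F T v (fun t w => W t w i 0) M.
Hypothesis sv : forall a, sqint prodm (cutoff T (entry v a)).

Let adm_sqint s t a : step_admissible Pr F s -> 0 <= t ->
  sqint Pr (fun w => step_integral (k := k) s (fun t w => W t w i 0) t w a 0).
Proof.
move=> adm t0; rewrite (_ : (fun w => _) = elem_int W i (step_size s)
   (stopped s t) (fun j => stopped s t j.+1) (stopped_value s a t)).
  by apply: (elem_int_sqint hF hW); exact: stopped_ok.
by apply/funext => w; rewrite (step_integral_elem W a adm).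
Qed.

Let mM t a : 0 <= t <= T -> measurable_fun setT (fun w => M t w a 0).
Proof.
case: hM => mM _ tT; have /andP[t0 _] := tT.
apply: (smeas_measurable (filtration_measurable hF t0)).
exact: (mM t tT).
Qed.

Lemma ito_approx : exists s : nat -> step_process R Omega k,
  [/\ forall l, step_admissible Pr F (s l),
      forall a, let D l z := cutoff T (entry v a) z -
            cutoff T (entry (step_fun (s l)) a) z in
        ip prodm (D l) (D l) @[l --> \oo] --> (0 : R) &
      forall t a, 0 <= t <= T -> sqint Pr (fun w => M t w a 0) /\
        let D l w := M t w a 0 -
          step_integral (s l) (fun t w => W t w i 0) t w a 0 in
        ip Pr (D l) (D l) @[l --> \oo] --> (0 : R)].
Proof.
case: hM => _ [s [adm cv cM]]; exists s; split=> //.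
- move=> a D.
  have ss l b : sqint prodm (cutoff T (entry (step_fun (s l)) b)).
    rewrite (step_fun_elem b (adm l) T0).
    exact: elem_fun_sqint (stopped_ok hF b (adm l) T0).
  have DE l b z : cutoff T (fun t w => (v t w - step_fun (s l) t w) b 0) z =
      cutoff T (entry v b) z - cutoff T (entry (step_fun (s l)) b) z.
    by rewrite /cutoff !mxE mulrBr.
  have sD l b : sqint prodm
      (cutoff T (fun t w => (v t w - step_fun (s l) t w) b 0)).
    by rewrite (funext (DE l b)); exact: sqintB.
  apply: (ereal_ip_cvg0 (e := fun l => (\int[Pr]_w \int[leb]_(t in `[0%R, T])
    (sqnorm2 (v t w - step_fun (s l) t w))%:E)%E)).
  + by move=> l; rewrite /D; exact: sqintB.
  + move=> l; rewrite integral_sqnorm2_cutoff; last by move=> b; exact: (sD l b).1.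
    have -> : D l = cutoff T (fun t w => (v t w - step_fun (s l) t w) a 0).
      by apply/funext => z; rewrite DE.
    rewrite (bigD1 a)//=.
    rewrite leeDl// sume_ge0// => b _.
    by apply: integral_ge0 => z _; rewrite lee_fin sqr_ge0.
  + pose n l := L2norm Pr `[0, T] (fun t w => v t w - step_fun (s l) t w).
    rewrite (_ : (fun l => _) = fun l => (n l * n l)%E); last first.
      apply/funext => l; rewrite /n /L2norm -expe2 sqr_sqrte//.
      apply: integral_ge0 => w _; apply: integral_ge0 => t _.
      by rewrite lee_fin sumr_ge0// => b _; exact: sqr_ge0.
    by rewrite -[X in _ --> X](mule0 0%E); apply: cvgeM.
- move=> t a tT; have /andP[t0 _] := tT.
  have sI l b := adm_sqint b (adm l) t0.
  have mD l b : measurable_fun setT (fun w =>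
      (M t w - step_integral (s l) (fun t w => W t w i 0) t w) b 0).
    rewrite (_ : (fun w => _) = fun w => M t w b 0 -
        step_integral (s l) (fun t w => W t w i 0) t w b 0).
      by apply: measurable_funB; [exact: mM|exact: (sI l b).1].
    by apply/funext => w; rewrite !mxE.
  have le l : (\int[Pr]_w ((M t w a 0 -
        step_integral (s l) (fun t w => W t w i 0) t w a 0) ^+ 2)%:E <=
      \int[Pr]_w (sqnorm2 (M t w -
        step_integral (s l) (fun t w => W t w i 0) t w))%:E)%E.
    apply: ge0_le_integral => //.
    + by move=> w _; rewrite lee_fin sqr_ge0.
    + apply/measurable_EFinP/measurable_funX.
      by apply: measurable_funB; [exact: mM|exact: (sI l a).1].
    + by apply/measurable_EFinP/measurable_sum => b; exact: measurable_funX.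
    + move=> w _; rewrite lee_fin; apply: le_trans (sqr_entry_le a _).
      by rewrite !mxE.
  (* A sequence converging to 0 is eventually finite, so [M t] is at finite L2 distance from some
     step integral, which is itself square-integrable. *)
  have sM : sqint Pr (fun w => M t w a 0).
    have : \forall l \near \oo, (\int[Pr]_w (sqnorm2 (M t w -
        step_integral (s l) (fun t w => W t w i 0) t w))%:E)%E \is a fin_num.
      by have /fine_cvgP[] := cM t tT.
    case=> l _ /(_ l (leqnn l)) fin.
    have : sqint Pr (fun w => M t w a 0 -
        step_integral (s l) (fun t w => W t w i 0) t w a 0).
      apply: sqint_intr.
        by apply: measurable_funB; [exact: mM|exact: (sI l a).1].
      by apply: le_lt_trans (le l) _; rewrite ltey_eq fin.
    move=> /sqintD/(_ (sI l a)); congr sqint.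
    by apply/funext => w; rewrite subrK.
  split=> //; apply: (ereal_ip_cvg0 _ le (cM t tT)) => l.
  exact: sqintB.
Qed.

Lemma ito_adapted t a : 0 <= t <= T ->
  adapted_sqint Pr F t (fun w => M t w a 0).
Proof.
move=> tT; split; first by case: hM => h _; exact: h.
by have [s [_ _ /(_ t a tT)[]]] := ito_approx.
Qed.

(** The limit of [ip_step_integral_orth]: the two approximating real sequences are equal, hence so
    are their limits. *)
Lemma ito_orth t a Y : 0 <= t <= T -> adapted_sqint Pr F t Y ->
  ip Pr Y (fun w => M T w a 0) = ip Pr Y (fun w => M t w a 0).
Proof.
move=> /[dup] tT /andP[t0 tleT] [mY sY].
have TT : 0 <= T <= T by rewrite T0 lexx.
have [s [adm _ cM]] := ito_approx.
have lim u : 0 <= u <= T -> ip Pr Y (fun w =>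
    step_integral (s l) (fun t w => W t w i 0) u w a 0) @[l --> \oo] -->
    ip Pr Y (fun w => M u w a 0).
  move=> uT; have /andP[u0 _] := uT; have [sM cMu] := cM u a uT.
  apply: (ip_cvg (f := fun=> Y)) => //.
    by move=> l; exact: (adm_sqint a (adm l) u0).
  rewrite [X in X @ _ --> _](_ : _ = fun=> 0); first exact: cvg_cst.
  apply/funext => l; rewrite /ip; under eq_Rintegral do rewrite subrr mul0r.
  by rewrite /Rintegral integral0.
have lT := lim T TT; have lt := lim t tT.
rewrite -(cvg_lim (@norm_hausdorff _ R^o) lT) -(cvg_lim (@norm_hausdorff _ R^o) lt).
congr (limn _); apply/funext => l.
exact: (ip_step_integral_orth hF hW a (adm l) i t0 tleT (conj mY sY)).
Qed.

End OneIntegral.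

Let cvg_eq (f g : nat -> R) (x : R) : f =1 g ->
  f l @[l --> \oo] --> x -> g l @[l --> \oo] --> x.
Proof. by move=> /funext ->. Qed.

(** Both sides of [ip_elem] converge along the two approximating sequences, which may have unrelated
    partitions and different Wiener components. *)
Lemma ito_isometry T k k' (v M : R -> Omega -> 'cV[R]_k)
    (v' M' : R -> Omega -> 'cV[R]_k') i j a b : 0 <= T ->
  ito_integral Pr F T v (fun t w => W t w i 0) M ->
  ito_integral Pr F T v' (fun t w => W t w j 0) M' ->
  (forall a, sqint prodm (cutoff T (entry v a))) ->
  (forall a, sqint prodm (cutoff T (entry v' a))) ->
  ip Pr (fun w => M T w a 0) (fun w => M' T w b 0) =
  K i j * ip prodm (cutoff T (entry v a)) (cutoff T (entry v' b)).
Proof.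
move=> T0 hM hM' sv sv'; have TT : 0 <= T <= T by rewrite T0 lexx.
have [s [adm cv cM]] := ito_approx T0 hM sv.
have [s' [adm' cv' cM']] := ito_approx T0 hM' sv'.
have [sM {}cM] := cM T a TT; have [sM' {}cM'] := cM' T b TT.
have ok l := stopped_ok hF a (adm l) T0.
have ok' l := stopped_ok hF b (adm' l) T0.
have IE l : (fun w => step_integral (s l) (fun t w => W t w i 0) T w a 0) =
  elem_int W i (step_size (s l)) (stopped (s l) T)
    (fun j => stopped (s l) T j.+1) (stopped_value (s l) a T).
  by apply/funext => w; rewrite (step_integral_elem W a (adm l)).
have IE' l : (fun w => step_integral (s' l) (fun t w => W t w j 0) T w b 0) =
  elem_int W j (step_size (s' l)) (stopped (s' l) T)
    (fun j => stopped (s' l) T j.+1) (stopped_value (s' l) b T).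
  by apply/funext => w; rewrite (step_integral_elem W b (adm' l)).
have lhs : ip Pr (elem_int W i (step_size (s l)) (stopped (s l) T)
      (fun j => stopped (s l) T j.+1) (stopped_value (s l) a T))
    (elem_int W j (step_size (s' l)) (stopped (s' l) T)
      (fun j => stopped (s' l) T j.+1) (stopped_value (s' l) b T)) @[l --> \oo] -->
    ip Pr (fun w => M T w a 0) (fun w => M' T w b 0).
  apply: ip_cvg => //.
  - by move=> l; exact: (elem_int_sqint hF hW _ _ (ok l)).
  - by move=> l; exact: (elem_int_sqint hF hW _ _ (ok' l)).
  - apply: cvg_eq cM => l; congr (ip _ _ _); apply/funext => w;
      by rewrite -[in RHS]IE.
  - apply: cvg_eq cM' => l; congr (ip _ _ _); apply/funext => w;
      by rewrite -[in RHS]IE'.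
have rhs : K i j * ip prodm (elem_fun (step_size (s l)) (stopped (s l) T)
      (fun j => stopped (s l) T j.+1) (stopped_value (s l) a T))
    (elem_fun (step_size (s' l)) (stopped (s' l) T)
      (fun j => stopped (s' l) T j.+1) (stopped_value (s' l) b T)) @[l --> \oo] -->
    K i j * ip prodm (cutoff T (entry v a)) (cutoff T (entry v' b)).
  apply: cvgM; first exact: cvg_cst.
  apply: ip_cvg => //.
  - by move=> l; exact: elem_fun_sqint (ok l).
  - by move=> l; exact: elem_fun_sqint (ok' l).
  - apply: cvg_eq (cv a) => l.
    by rewrite -(step_fun_elem a (adm l) T0).
  - apply: cvg_eq (cv' b) => l.
    by rewrite -(step_fun_elem b (adm' l) T0).
rewrite -(cvg_lim (@norm_hausdorff _ R^o) lhs) -(cvg_lim (@norm_hausdorff _ R^o) rhs).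
congr (limn _); apply/funext => l.
exact: (ip_elem hF hW).
Qed.

End ItoIntegral.

(** * The product rule *)

Section RealFubini.
Context d1 d2 (T1 : measurableType d1) (T2 : measurableType d2) (R : realType).
Variable m1 : {sigma_finite_measure set T1 -> \bar R}.
Variable m2 : {sigma_finite_measure set T2 -> \bar R}.
Variable f : T1 * T2 -> R.
Hypothesis intf : (m1 \x m2)%E.-integrable setT (EFin \o f).

Let integrable_fine d (T : measurableType d) (mu : {measure set T -> \bar R})
    (g : T -> \bar R) : mu.-integrable setT g ->
  mu.-integrable setT (fun x => (fine (g x))%:E).
Proof.
move=> ig; have /integrableP[mg _] := ig.
apply: le_integrable ig => //.
  by apply/measurable_EFinP; apply: measurableT_comp => //; exact: measurable_fine.
by move=> x _ /=; case: (g x) => [r||] //=; rewrite normr0 leey.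
Qed.

Lemma integrable_Rfubini1 :
  m1.-integrable setT (fun x => (\int[m2]_y f (x, y))%:E).
Proof. exact/integrable_fine/(integrable_fubini_F intf). Qed.

Let intG : m2.-integrable setT (fun y => \int[m1]_x (f (x, y))%:E)%E.
Proof.
have := measurable_fubini_G intf => mG.
apply/integrableP; split; first exact: mG.
have mf : measurable_fun setT (EFin \o f) by exact: measurable_int intf.
apply: (le_lt_trans _ ((integrable21ltyP m1 m2 mf).1 intf)).
apply: ge0_le_integral => //.
- exact: measurableT_comp.
- apply: (measurable_fun_fubini_tonelli_G (abse \o (EFin \o f))) => //=.
  exact: measurableT_comp.
- move=> y _; apply: le_abse_integral => //.
  by apply: (measurableT_comp mf); exact: measurable_fun_pair.
Qed.

Lemma integrable_Rfubini2 :
  m2.-integrable setT (fun y => (\int[m1]_x f (x, y))%:E).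
Proof. exact: integrable_fine intG. Qed.

(** The inner integral in Fubini's theorem may be infinite on a null set, where [fine] returns 0;
    integrability makes this change invisible. *)
Let Rintegral_fine d (T : measurableType d) (mu : {measure set T -> \bar R})
    (g : T -> \bar R) : mu.-integrable setT g ->
  \int[mu]_x fine (g x) = fine (\int[mu]_x g x)%E.
Proof.
move=> ig; congr fine; have ifg := integrable_fine ig.
apply: ae_eq_integral => //; [exact: measurable_int ifg|exact: measurable_int ig|].
have := integrable_ae measurableT ig; apply: filterS => x h _.
by rewrite fineK//; exact: h.
Qed.

Lemma Rintegral_fubini1 :
  \int[m1]_x \int[m2]_y f (x, y) = \int[(m1 \x m2)%E]_z f z.
Proof.
rewrite -[RHS](congr1 fine (integral12_prod_meas1 intf)).
by rewrite -(Rintegral_fine (integrable_fubini_F intf)).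
Qed.

Lemma Rintegral_fubini2 :
  \int[m2]_y \int[m1]_x f (x, y) = \int[(m1 \x m2)%E]_z f z.
Proof.
rewrite -[RHS](congr1 fine (integral21_prod_meas1 intf)).
by rewrite -(Rintegral_fine intG).
Qed.

End RealFubini.

Section ProductSections.
Context d1 d2 (T1 : measurableType d1) (T2 : measurableType d2) (R : realType).
Variable m1 : {sigma_finite_measure set T1 -> \bar R}.
Variable m2 : {sigma_finite_measure set T2 -> \bar R}.
Implicit Types u v : T1 * T2 -> R.

Lemma sqint_sections v : sqint (m1 \x m2)%E v ->
  {ae m1, forall s, sqint m2 (fun w => v (s, w))}.
Proof.
move=> [mv iv]; have := ae_integrable1 iv; apply: filterS => s is_; split=> //.
by apply: (measurableT_comp mv); exact: measurable_fun_pair.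
Qed.

Lemma ip_prod_sections u v : sqint (m1 \x m2)%E u -> sqint (m1 \x m2)%E v ->
  m1.-integrable setT
    (fun s => (ip m2 (fun w => u (s, w)) (fun w => v (s, w)))%:E) /\
  \int[m1]_s ip m2 (fun w => u (s, w)) (fun w => v (s, w)) = ip (m1 \x m2)%E u v.
Proof.
move=> su sv; have iuv := sqint_mul su sv; split.
  exact: (integrable_Rfubini1 iuv).
exact: (Rintegral_fubini1 iuv).
Qed.

Lemma ae_eq_Rintegral_integrable (f g : T1 -> R) :
  m1.-integrable setT (EFin \o f) -> m1.-integrable setT (EFin \o g) ->
  {ae m1, forall x, f x = g x} -> \int[m1]_x f x = \int[m1]_x g x.
Proof.
move=> iF iG fg; congr fine.
apply: ae_eq_integral => //; [exact: measurable_int iF|exact: measurable_int iG|].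
by apply: filterS fg => x -> _.
Qed.

End ProductSections.

(** With increasing exhaustions the products of equal index already cover: a point in the product of
    indices i and j lies in that of index [maxn i j]. *)
Lemma sigma_finite_prod d1 d2 (T1 : measurableType d1) (T2 : measurableType d2)
    (R : realType) (m1 : {sigma_finite_measure set T1 -> \bar R})
    (m2 : {sigma_finite_measure set T2 -> \bar R}) :
  sigma_finite setT (m1 \x m2)%E.
Proof.
have [F [coverF incF finF]] := (sigma_finiteP _ _).1 (sigma_finiteT m1).
have [G [coverG incG finG]] := (sigma_finiteP _ _).1 (sigma_finiteT m2).
exists (fun k => F k `*` G k) => [|k].
  apply/seteqP; split=> // -[x y] _.
  have [i _ Fx] : (\bigcup_k F k) x by rewrite -coverF.
  have [j _ Gy] : (\bigcup_k G k) y by rewrite -coverG.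
  exists (maxn i j) => //; split.
    by move: x Fx; apply/subsetPset/incF/leq_maxl.
  by move: y Gy; apply/subsetPset/incG/leq_maxr.
have [mFk fFk] := finF k; have [mGk fGk] := finG k.
split; first exact: measurableX.
by rewrite product_measure1E// lte_mul_pinfty// ge0_fin_numE.
Qed.

(** * Exchange of integrals over a region of pairs of times *)

Section RelFubini.
Context d1 d2 (T1 : measurableType d1) (T2 : measurableType d2) (R : realType).
Variables (mu : {sigma_finite_measure set T1 -> \bar R}).
Variables (P : {sigma_finite_measure set T2 -> \bar R}).
Variables (rel : T1 * T1 -> bool) (one : T1 -> R) (u v : T1 * T2 -> R).
Hypotheses (mrel : measurable_fun setT rel) (sone : sqint mu one).
Hypotheses (su : sqint (mu \x P)%E u) (sv : sqint (mu \x P)%E v).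
Hypothesis (hu : forall z, one z.1 * u z = u z).
Hypothesis (hv : forall z, one z.1 * v z = v z).

(* The canonical sigma-finite structure on products only covers
   subprobabilities. *)
Let mu2 : {sigma_finite_measure set (T1 * T1)%type -> \bar R} :=
  HB.pack (mu \x mu)%E
    (Measure_isSigmaFinite.Build _ _ _ (mu \x mu)%E (sigma_finite_prod mu mu)).

Let mu2E (f : T1 * T1 -> \bar R) :
  (\int[mu2]_p f p = \int[(mu \x mu)%E]_p f p)%E.
Proof. by []. Qed.

(** Lifts to pairs of times. The factor [one] in the idle variable keeps the lifts
    square-integrable, so their product is integrable; by [hu] and [hv] it does not alter that
    product. *)
Let u3 (p : (T1 * T1) * T2) : R := one p.1.2 * u (p.1.1, p.2).
Let v3 (p : (T1 * T1) * T2) : R := one p.1.1 * v (p.1.2, p.2).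

Let mu3 : measurable_fun setT u3.
Proof.
apply: measurable_funM.
  by apply: (measurableT_comp sone.1); exact: measurableT_comp.
by apply: (measurableT_comp su.1); apply: measurable_fun_pair => //;
  exact: measurableT_comp.
Qed.

Let mv3 : measurable_fun setT v3.
Proof.
apply: measurable_funM.
  by apply: (measurableT_comp sone.1); exact: measurableT_comp.
by apply: (measurableT_comp sv.1); apply: measurable_fun_pair => //;
  exact: measurableT_comp.
Qed.

Let e (f : T1 * T2 -> R) (s : T1) := (\int[P]_w (f (s, w) ^+ 2)%:E)%E.

Let e0 f s : (0 <= e f s)%E.
Proof. by apply: integral_ge0 => w _; rewrite lee_fin sqr_ge0. Qed.

Let msqr (f : T1 * T2 -> R) : measurable_fun setT f ->
  measurable_fun setT (fun z => (f z ^+ 2)%:E).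
Proof. by move=> mf; apply/measurable_EFinP; exact: measurable_funX. Qed.

Let me (f : T1 * T2 -> R) : measurable_fun setT f ->
  measurable_fun setT (e f).
Proof.
move=> mf; apply: (measurable_fun_fubini_tonelli_F (m2 := P)
  (fun z => (f z ^+ 2)%:E)); first exact: msqr.
by move=> z; rewrite lee_fin sqr_ge0.
Qed.

Let integral_e (f : T1 * T2 -> R) : sqint (mu \x P)%E f ->
  (\int[mu]_s e f s < +oo)%E.
Proof.
move=> sf; have := sqint_lty sf.
rewrite (fubini_tonelli1 (fun z => (f z ^+ 2)%:E))//.
  by apply: msqr; have [] := sf.
by move=> z; rewrite lee_fin sqr_ge0.
Qed.

Let m1s : measurable_fun setT (fun s => (one s ^+ 2)%:E).
Proof. by apply/measurable_EFinP; apply: measurable_funX; exact: sone.1. Qed.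

Let sqr1_ge0 s : (0 <= (one s ^+ 2)%:E)%E.
Proof. by rewrite lee_fin sqr_ge0. Qed.

Let section (f : T1 * T2 -> R) s : measurable_fun setT f ->
  measurable_fun setT (fun w => (f (s, w) ^+ 2)%:E).
Proof.
move=> mf; apply/measurable_EFinP; apply: measurable_funX.
by apply: (measurableT_comp mf); exact: measurable_fun_pair.
Qed.

Let su3 : sqint (mu2 \x P)%E u3.
Proof.
apply: sqint_intr => //.
rewrite (fubini_tonelli1 (m1 := mu2) (m2 := P) (fun p => (u3 p ^+ 2)%:E)); last 2 first.
- by apply/measurable_EFinP; exact: measurable_funX.
- by move=> p; rewrite lee_fin sqr_ge0.
rewrite (_ : fubini_F _ _ = fun p => ((one p.2 ^+ 2)%:E * e u p.1)%E); last first.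
  apply/funext => -[s t]; rewrite /fubini_F /e -ge0_integralZl//.
  - by apply: eq_integral => w _; rewrite /u3/= exprMn EFinM.
  - by apply: section; exact: su.1.
  - by move=> w _; rewrite lee_fin sqr_ge0.
rewrite mu2E (fubini_tonelli1 (fun p => ((one p.2 ^+ 2)%:E * e u p.1)%E)); last 2 first.
- by apply: emeasurable_funM; [exact: (measurableT_comp m1s)|
    exact: (measurableT_comp (me su.1))].
- by move=> p; rewrite mule_ge0.
rewrite (_ : fubini_F _ _ = fun s => ((\int[mu]_t (one t ^+ 2)%:E) * e u s)%E).
  rewrite ge0_integralZl//; [|by apply: me; exact: su.1|exact: integral_ge0].
  rewrite lte_mul_pinfty ?integral_ge0// ?integral_e//.
  by rewrite ge0_fin_numE ?integral_ge0//; exact: sqint_lty.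
apply/funext => s; rewrite /fubini_F/=.
by rewrite ge0_integralZr.
Qed.

Let sv3 : sqint (mu2 \x P)%E v3.
Proof.
apply: sqint_intr => //.
rewrite (fubini_tonelli1 (m1 := mu2) (m2 := P) (fun p => (v3 p ^+ 2)%:E)); last 2 first.
- by apply/measurable_EFinP; exact: measurable_funX.
- by move=> p; rewrite lee_fin sqr_ge0.
rewrite (_ : fubini_F _ _ = fun p => ((one p.1 ^+ 2)%:E * e v p.2)%E); last first.
  apply/funext => -[s t]; rewrite /fubini_F /e -ge0_integralZl//.
  - by apply: eq_integral => w _; rewrite /v3/= exprMn EFinM.
  - by apply: section; exact: sv.1.
  - by move=> w _; rewrite lee_fin sqr_ge0.
rewrite mu2E (fubini_tonelli1 (fun p => ((one p.1 ^+ 2)%:E * e v p.2)%E)); last 2 first.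
- by apply: emeasurable_funM; [exact: (measurableT_comp m1s)|
    exact: (measurableT_comp (me sv.1))].
- by move=> p; rewrite mule_ge0.
rewrite (_ : fubini_F _ _ = fun s => ((one s ^+ 2)%:E * (\int[mu]_t e v t))%E).
  rewrite ge0_integralZr//; last exact: integral_ge0.
  rewrite lte_mul_pinfty ?integral_ge0// ?integral_e//.
  by rewrite ge0_fin_numE ?integral_ge0//; exact: sqint_lty.
apply/funext => s; rewrite /fubini_F/=.
by rewrite ge0_integralZl//; apply: me; exact: sv.1.
Qed.

Let J (p : (T1 * T1) * T2) : R :=
  if rel p.1 then u (p.1.1, p.2) * v (p.1.2, p.2) else 0.

Let JE p : J p = if rel p.1 then u3 p * v3 p else 0.
Proof.
rewrite /J; case: ifP => // _; rewrite /u3 /v3 -[in LHS]hu -[in LHS]hv/=.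
by ring.
Qed.

Let intJ : (mu2 \x P)%E.-integrable setT (EFin \o J).
Proof.
apply: le_integrable (sqint_mul su3 sv3) => //.
  rewrite (funext JE); apply/measurable_EFinP.
  apply: measurable_fun_ifT => //; first exact: measurableT_comp.
  exact: measurable_funM.
move=> p _; rewrite lee_fin JE; case: ifP => // _.
by rewrite normr0.
Qed.

Let G (p : T1 * T1) : R := \int[P]_w J (p, w).

Let intG : (mu \x mu)%E.-integrable setT (EFin \o G).
Proof. exact: (integrable_Rfubini1 intJ). Qed.

Let cut_sqint (b : T1 -> bool) (f : T1 * T2 -> R) : measurable_fun setT b ->
  sqint (mu \x P)%E f -> sqint (mu \x P)%E (fun z => if b z.1 then f z else 0).
Proof.
move=> mb sf; apply: sqint_dominated (sf) _ => [|z].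
  by apply: measurable_fun_ifT => //; [exact: measurableT_comp|exact: sf.1].
by case: ifP => // _; rewrite expr0n sqr_ge0.
Qed.

Let mrel1 s : measurable_fun setT (fun t => rel (s, t)).
Proof. by apply: (measurableT_comp mrel); exact: measurable_fun_pair. Qed.

Let mrel2 t : measurable_fun setT (fun s => rel (s, t)).
Proof. by apply: (measurableT_comp mrel); exact: measurable_fun_pair. Qed.

(** The inner integral as an inner product of a frozen section of [u] with a cut of [v]. This needs
    a square-integrable section, which almost every one is. *)
Let G1 s : sqint P (fun w => u (s, w)) ->
  \int[mu]_t G (s, t) = ip (mu \x P)%E (fun z => one z.1 * u (s, z.2))
    (fun z => if rel (s, z.1) then v z else 0).
Proof.
move=> sus; have sa := cut_sqint (mrel1 s) sv.
have [_ <-] := ip_prod_sections (sqint_tensor sone sus) sa.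
apply: eq_Rintegral => t _; apply: eq_Rintegral => w _.
rewrite /J/=; case: ifP => // _; rewrite ?mulr0// -[in LHS]hv/=; ring.
Qed.

Let G2 t : sqint P (fun w => v (t, w)) ->
  \int[mu]_s G (s, t) = ip (mu \x P)%E (fun z => one z.1 * v (t, z.2))
    (fun z => if rel (z.1, t) then u z else 0).
Proof.
move=> svt; have sb := cut_sqint (mrel2 t) su.
have [_ <-] := ip_prod_sections (sqint_tensor sone svt) sb.
apply: eq_Rintegral => s _; apply: eq_Rintegral => w _.
rewrite /J/=; case: ifP => // _; rewrite ?mulr0// -[in LHS]hu/=; ring.
Qed.

(* Fubini for [E (u s * v t)] over the region [rel (s, t)]. *)
Lemma exchange_rel (g1 g2 : T1 -> R) :
  mu.-integrable setT (EFin \o g1) -> mu.-integrable setT (EFin \o g2) ->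
  (forall s, sqint P (fun w => u (s, w)) ->
    ip (mu \x P)%E (fun z => one z.1 * u (s, z.2))
      (fun z => if rel (s, z.1) then v z else 0) = g1 s) ->
  (forall t, sqint P (fun w => v (t, w)) ->
    ip (mu \x P)%E (fun z => one z.1 * v (t, z.2))
      (fun z => if rel (z.1, t) then u z else 0) = g2 t) ->
  \int[mu]_s g1 s = \int[mu]_t g2 t.
Proof.
move=> ig1 ig2 h1 h2.
transitivity (\int[mu]_s \int[mu]_t G (s, t)).
  apply/esym/ae_eq_Rintegral_integrable => //.
    exact: (integrable_Rfubini1 intG).
  by apply: filterS (sqint_sections su) => s sus; rewrite G1// h1.
rewrite (Rintegral_fubini1 intG) -(Rintegral_fubini2 intG).
apply: ae_eq_Rintegral_integrable => //.
  exact: (integrable_Rfubini2 intG).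
by apply: filterS (sqint_sections sv) => t svt; rewrite G2// h2.
Qed.

End RelFubini.

(** * Time integrals of processes *)

Section TimeIntegral.
Context (R : realType) (d : measure_display) (Omega : measurableType d).
Variable Pr : probability Omega R.

Local Notation leb := (@lebesgue_measure R).
Local Notation prodm := (leb \x Pr)%E.
Local Notation time := (measurableTypeR R).
Implicit Types (T : R) (v : time * Omega -> R) (Y : Omega -> R).

Definition tens T Y (z : time * Omega) : R := \1_(`[0, T]%classic) z.1 * Y z.2.

Definition supported T v := forall z, ~ (0 <= z.1 <= T) -> v z = 0.

Definition tint v (w : Omega) : R := \int[leb]_s v (s, w).

Lemma indic_cc_sqint T :
  sqint leb (\1_(`[0, T]%classic) : time -> R).
Proof.
split; first exact: measurable_indic.
have : leb.-integrable setT (EFin \o (\1_(`[0, T]%classic) : R -> R)).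
  exact: integrable_indic_itv.
apply: eq_integrable => // x _ /=.
by rewrite indicE; case: (_ \in _); rewrite ?expr1n ?expr0n.
Qed.

Lemma ip_indic_cc T : 0 < T ->
  ip leb (\1_(`[0, T]%classic)) (\1_(`[0, T]%classic)) = T.
Proof.
move=> T0; transitivity (\int[leb]_s (\1_(`[0, T]%classic) s : R)).
  apply: eq_Rintegral => s _.
  by rewrite indicE; case: (_ \in _); rewrite ?mulr1 ?mulr0.
rewrite /Rintegral integral_indic// setIT.
by have := lebesgue_measure_itv `[0, T]; rewrite /= lte_fin T0 oppr0 adde0 => ->.
Qed.

Lemma tens_sqint T Y : sqint Pr Y -> sqint prodm (tens T Y).
Proof. by move=> sY; apply: sqint_tensor => //; exact: indic_cc_sqint. Qed.

Lemma cutoff_supported T (u : R -> Omega -> R) : supported T (cutoff T u).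
Proof.
by move=> [t w] /= tT; rewrite /cutoff/= indicE memNset ?mul0r//= in_itv.
Qed.

Lemma supported_tens T v Y z : supported T v ->
  tens T Y z * v z = Y z.2 * v z.
Proof.
move=> sv; rewrite /tens indicE.
have [zT|zT] := pselect (0 <= z.1 <= T); last by rewrite (sv z zT) !mulr0.
by rewrite mem_set ?mul1r//= in_itv.
Qed.

Lemma measurable_section2 v w : measurable_fun setT v ->
  measurable_fun setT (fun s => v (s, w)).
Proof. by move=> mv; apply: (measurableT_comp mv); exact: measurable_fun_pair. Qed.

Lemma supported_integrable T v : sqint prodm v -> supported T v ->
  prodm.-integrable setT (EFin \o v).
Proof.
move=> sv hv; have s1 : sqint Pr (fun=> 1).
  split=> //; rewrite expr1n.
  exact: (@finite_measure_integrable_cst _ _ _ Pr setT 1).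
have := sqint_mul (tens_sqint T s1) sv.
by apply: eq_integrable => // z _; rewrite supported_tens// mul1r.
Qed.

(** Cauchy-Schwarz in time against the indicator of [0, T] bounds the squared integral of a path by
    [T] times the energy of the path. *)
Lemma tint_sqint T v : 0 < T -> sqint prodm v -> supported T v ->
  sqint Pr (tint v).
Proof.
move=> T0 sv hv; have iv := supported_integrable sv hv.
have mt : measurable_fun setT (tint v).
  apply/measurable_EFinP.
  exact: (measurable_int _ (integrable_Rfubini2 iv)).
apply: sqint_intr => //.
have mv2 : measurable_fun setT (fun z => (v z ^+ 2)%:E).
  by apply/measurable_EFinP; apply: measurable_funX; have [] := sv.
have mF : measurable_fun setT (fun w => \int[leb]_s (v (s, w) ^+ 2)%:E)%E.
  apply: (measurable_fun_fubini_tonelli_G (m1 := leb)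
    (fun z => (v z ^+ 2)%:E)) => // z.
  by rewrite lee_fin sqr_ge0.
apply: (@le_lt_trans _ _ (\int[Pr]_w (T%:E * \int[leb]_s (v (s, w) ^+ 2)%:E))%E).
  apply: ge0_le_integral => //.
  - by move=> w _; rewrite lee_fin sqr_ge0.
  - exact/measurable_EFinP/measurable_funX.
  - by apply: emeasurable_funM => //; exact: measurable_cst.
  - move=> w _.
    have mvw := measurable_section2 w sv.1.
    have int0 : (0 <= \int[leb]_s (v (s, w) ^+ 2)%:E)%E.
      by apply: integral_ge0 => s _; rewrite lee_fin sqr_ge0.
    (* On a path of infinite energy the bound is +oo, because [T > 0]. *)
    have [|] := boolP ((\int[leb]_s (v (s, w) ^+ 2)%:E)%E \is a fin_num); last first.
      rewrite ge0_fin_numE// -leNgt leye_eq => /eqP ->.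
      by rewrite gt0_muley ?lte_fin ?leey.
    move=> fin; have sw : sqint leb (fun s => v (s, w)).
      by apply: sqint_intr => //; rewrite -ge0_fin_numE.
    have := ip_cauchy_schwarz (indic_cc_sqint T) sw.
    have -> : ip leb (\1_(`[0, T]%classic)) (fun s => v (s, w)) = tint v w.
      apply: eq_Rintegral => s _; have := supported_tens (fun=> 1) (s, w) hv.
      by rewrite /tens/= mulr1 mul1r.
    rewrite ip_indic_cc//.
    move=> le_cs; apply: (@le_trans _ _ (T * ip leb (fun s => v (s, w)) (fun s => v (s, w)))%:E);
      first by rewrite lee_fin.
    rewrite EFinM (ipE sw sw).
    by rewrite le_eqVlt; apply/orP; left; apply/eqP; congr (_ * _)%E;
      apply: eq_integral => s _; rewrite expr2.
rewrite ge0_integralZl//; last 2 first.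
- by move=> w _; apply: integral_ge0 => s _; rewrite lee_fin sqr_ge0.
- by rewrite lee_fin ltW.
rewrite lte_mul_pinfty ?lee_fin ?(ltW T0)//.
rewrite -(fubini_tonelli2 (fun z => (v z ^+ 2)%:E))//; first exact: sqint_lty.
by move=> z; rewrite lee_fin sqr_ge0.
Qed.

(** Fubini, after [Y] has been moved under the time integral along the paths on which [v] is
    integrable, that is, almost all. *)
Lemma tint_ip T v Y : sqint Pr Y -> sqint prodm v -> supported T v ->
  ip Pr Y (tint v) = ip prodm (tens T Y) v.
Proof.
move=> sY sv hv; have sTY := tens_sqint T sY.
rewrite /ip -(Rintegral_fubini2 (sqint_mul sTY sv)).
have iv := supported_integrable sv hv.
have iYv := sqint_mul sTY sv.
have int w : leb.-integrable setT (fun s => (v (s, w))%:E) ->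
    Y w * tint v w = \int[leb]_s (tens T Y (s, w) * v (s, w)).
  move=> ivw; rewrite /tint -RintegralZl//.
  by apply: eq_Rintegral => s _; rewrite supported_tens.
congr fine; apply: ae_eq_integral => //.
- apply/measurable_EFinP; apply: measurable_funM; first exact: sY.1.
  apply/measurable_EFinP.
  exact: (measurable_int _ (integrable_Rfubini2 iv)).
- exact: (measurable_int _ (integrable_Rfubini2 iYv)).
- have := ae_integrable2 iv; apply: filterS => w ivw _.
  by rewrite -int.
Qed.

End TimeIntegral.

Section TimeExchange.
Context (R : realType) (d : measure_display) (Omega : measurableType d).
Variable Pr : probability Omega R.

Local Notation leb := (@lebesgue_measure R).
Local Notation prodm := (leb \x Pr)%E.
Local Notation time := (measurableTypeR R).
Implicit Types u v : time * Omega -> R.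

Definition before t v (z : time * Omega) : R := if z.1 < t then v z else 0.

Definition after t v (z : time * Omega) : R := if t < z.1 then v z else 0.

Lemma before_sqint t v : sqint prodm v -> sqint prodm (before t v).
Proof.
move=> sv; apply: sqint_dominated (sv) _ => [|z].
  rewrite /before; apply: measurable_fun_ifT => //; last exact: sv.1.
  by apply: measurable_fun_ltr => //; exact: measurableT_comp.
by rewrite /before; case: ifP => // _; rewrite expr0n sqr_ge0.
Qed.

Lemma time_exchange T u v (g1 g2 : time -> R) :
  sqint prodm u -> sqint prodm v -> supported T u -> supported T v ->
  leb.-integrable setT (EFin \o g1) -> leb.-integrable setT (EFin \o g2) ->
  (forall s, sqint Pr (fun w => u (s, w)) ->
    ip prodm (tens T (fun w => u (s, w))) (after s v) = g1 s) ->
  (forall t, sqint Pr (fun w => v (t, w)) ->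
    ip prodm (tens T (fun w => v (t, w))) (before t u) = g2 t) ->
  \int[leb]_s g1 s = \int[leb]_t g2 t.
Proof.
move=> su sv hu hv; apply: (exchange_rel (rel := fun p : time * time => p.1 < p.2)
  (one := \1_(`[0, T]%classic)) _ (indic_cc_sqint T) su sv).
- by apply: measurable_fun_ltr; [exact: measurable_fst|exact: measurable_snd].
- by move=> z; have := supported_tens (fun=> 1) z hu; rewrite /tens mulr1 mul1r.
- by move=> z; have := supported_tens (fun=> 1) z hv; rewrite /tens mulr1 mul1r.
Qed.

End TimeExchange.

(** * Ito processes and the expectation of their products *)

Section ProductRule.
Context (R : realType) (d : measure_display) (Omega : measurableType d).
Variables (Pr : probability Omega R) (F : R -> set (set Omega)).

Local Notation leb := (@lebesgue_measure R).
Local Notation prodm := (leb \x Pr)%E.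
Local Notation time := (measurableTypeR R).

(* That [m] is a martingale is expressed by the orthogonality of its increments
   to square-integrable variables of the past. *)
Record ito_process T (a Z m : R -> Omega -> R) : Prop := ItoProcess {
  ito_drift_sqint : sqint prodm (cutoff T a);
  ito_drift_adapted : forall t, 0 <= t <= T -> smeas (F t) (a t);
  ito_state_sqint : sqint prodm (cutoff T Z);
  ito_state_measurable : forall t, 0 <= t <= T -> measurable_fun setT (Z t);
  ito_mart_adapted : forall t, 0 <= t <= T -> adapted_sqint Pr F t (m t);
  ito_mart : forall t Y, 0 <= t <= T -> adapted_sqint Pr F t Y ->
    ip Pr Y (m T) = ip Pr Y (m t);
  ito_eq : forall t, 0 <= t <= T ->
    {ae Pr, forall w, Z t w = tint (cutoff t a) w + m t w} }.

Section CutoffLe.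
Variables (T t : R) (a : R -> Omega -> R).
Hypotheses (tT : t <= T) (sa : sqint prodm (cutoff T a)).

Lemma cutoff_le_sqint : sqint prodm (cutoff t a).
Proof.
have E z : cutoff t a z = \1_(`[0, t]%classic) z.1 * cutoff T a z.
  rewrite /cutoff mulrA; congr (_ * _); rewrite !indicE -natrM mulnb.
  congr (_%:R); congr nat_of_bool; apply/idP/andP; rewrite !inE/= !in_itv/=.
    by move=> /andP[-> zt]; rewrite zt (le_trans zt tT).
  by case.
apply: sqint_dominated sa _ => [|z].
  rewrite (funext E); apply: measurable_funM; last exact: sa.1.
  have [m1 _] := @indic_cc_sqint R t.
  exact: (measurableT_comp m1).
rewrite E indicE; case: (_ \in _); rewrite ?mul1r// mul0r expr0n; exact: sqr_ge0.
Qed.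

Lemma cutoff_after : after t (cutoff T a) = (fun z => cutoff T a z - cutoff t a z).
Proof.
apply/funext => z; rewrite /after /cutoff !indicE.
have [tz|zt] := ltP t z.1.
  rewrite (@memNset _ `[0, t]%classic) ?mul0r ?subr0//= in_itv/=.
  by move=> /andP[_ /le_lt_trans/(_ tz)]; rewrite ltxx.
have -> : (z.1 \in `[0, T]%classic) = (z.1 \in `[0, t]%classic).
  by apply/idP/idP; rewrite !inE/= !in_itv/= zt ?(le_trans zt tT).
by rewrite subrr.
Qed.

(** The two sides can differ only at the time [t] itself, which [before] excludes and [cutoff t]
    includes. *)
Lemma cutoff_before_ae : {ae prodm, forall z, before t (cutoff T a) z = cutoff t a z}.
Proof.
have mt : measurable ([set t] : set time).
  rewrite (_ : [set t] = `[t, t]%classic); first exact: measurable_itv.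
  by rewrite set_itv1.
exists ([set t] `*` setT); split.
- exact: measurableX.
- rewrite product_measure1E//.
  by apply/eqP; rewrite mule_eq0; apply/orP; left; apply/eqP;
    exact: lebesgue_measure_set1.
- move=> [s w] /= h; split=> //=; apply/eqP/negPn/negP => st; apply: h.
  rewrite /before /cutoff !indicE/=.
  have [lt_st|le_ts] := ltP s t.
    have -> // : (s \in `[0, T]%classic) = (s \in `[0, t]%classic).
    by apply/idP/idP; rewrite !inE/= !in_itv/= ?(ltW lt_st)// (le_trans (ltW lt_st) tT).
  rewrite memNset ?mul0r//= in_itv/= => /andP[_ le_st].
  by move: st; rewrite eq_le le_st le_ts.
Qed.

End CutoffLe.

Lemma cutoff_le_supported (T t : R) (a : R -> Omega -> R) : t <= T ->
  supported T (cutoff t a).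
Proof.
move=> tT z zT; apply: cutoff_supported => /andP[z0 zt]; apply: zT.
by rewrite z0 (le_trans zt tT).
Qed.

Section AtTime.
Variables (T : R) (T0 : 0 < T) (a Z m : R -> Omega -> R).
Hypothesis hZ : ito_process T a Z m.

Lemma ito_tint_sqint t : 0 <= t <= T -> sqint Pr (tint (cutoff t a)).
Proof.
move=> /andP[t0 tT]; apply: (tint_sqint T0); last exact: cutoff_le_supported.
exact: cutoff_le_sqint tT (ito_drift_sqint hZ).
Qed.

Lemma ito_mart_sqint t : 0 <= t <= T -> sqint Pr (m t).
Proof. by move=> tT; have [] := ito_mart_adapted hZ tT. Qed.

(** The state equation holds almost surely for each fixed time, hence may be substituted inside an
    inner product at that time. *)
Lemma ip_ito_state t (Y : Omega -> R) : 0 <= t <= T -> sqint Pr Y ->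
  ip Pr (Z t) Y = ip Pr (tint (cutoff t a)) Y + ip Pr (m t) Y.
Proof.
move=> tT sY; have sD := ito_tint_sqint tT; have sm := ito_mart_sqint tT.
rewrite -ipDl//; apply: ip_ae_eq (ito_eq hZ tT).
- exact: ito_state_measurable hZ _ tT.
- exact: (sqintD sD sm).1.
- exact: sY.1.
Qed.

Lemma ito_state_sqint_at t : 0 <= t <= T -> sqint Pr (Z t).
Proof.
move=> tT; have mZ := ito_state_measurable hZ tT.
have sDm := sqintD (ito_tint_sqint tT) (ito_mart_sqint tT).
apply: sqint_intr => //; apply: le_lt_trans (sqint_lty sDm).
rewrite le_eqVlt; apply/orP; left; apply/eqP; apply: ae_eq_integral => //.
- by apply/measurable_EFinP; exact: measurable_funX.
- by apply/measurable_EFinP; apply: measurable_funX; exact: sDm.1.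
- by apply: filterS (ito_eq hZ tT) => w -> _.
Qed.

End AtTime.

Lemma ip0l d' (T' : measurableType d') (mu : {measure set T' -> \bar R})
  (f g : T' -> R) : (forall x, f x = 0) -> ip mu f g = 0.
Proof.
move=> f0; rewrite /ip; under eq_Rintegral do rewrite f0 mul0r.
by rewrite /Rintegral integral0.
Qed.

Section Rule.
Variables (T : R) (T0 : 0 < T) (a Z m a' Z' m' : R -> Omega -> R).
Hypotheses (hZ : ito_process T a Z m) (hZ' : ito_process T a' Z' m').

Let TT : 0 <= T <= T. Proof. by rewrite (ltW T0) lexx. Qed.
Let sa := ito_drift_sqint hZ.
Let sa' := ito_drift_sqint hZ'.
Let sZ := ito_state_sqint hZ.
Let sZ' := ito_state_sqint hZ'.

Let tint_pair (u : R -> Omega -> R) Y : sqint prodm (cutoff T u) -> sqint Pr Y ->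
  leb.-integrable setT
    (fun s => (ip Pr (fun w => cutoff T u (s, w)) Y)%:E) /\
  \int[leb]_s ip Pr (fun w => cutoff T u (s, w)) Y = ip Pr (tint (cutoff T u)) Y.
Proof.
move=> su sY; have hu := @cutoff_supported R d Omega T u.
rewrite ipC (tint_ip sY su hu).
have E s : ip Pr (fun w => tens T Y (s, w)) (fun w => cutoff T u (s, w)) =
    ip Pr (fun w => cutoff T u (s, w)) Y.
  by apply: eq_Rintegral => w _; rewrite supported_tens// mulrC.
have [i1 <-] := ip_prod_sections (tens_sqint T sY) su; split.
  by apply: eq_integrable i1 => // s _; rewrite E.
by apply: eq_Rintegral => s _; rewrite E.
Qed.

(** Write Z = D + m and Z' = D' + m' with D, D' the drift integrals. The integral of E a(s) a'(t)
    over s < t is computed in both orders. Expressing the inner integrals through Z', m' and Z, m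
    gives a linear relation that turns E (D D' + D m' + m D') into the two drift terms. *)
Lemma product_rule : ip Pr (Z T) (Z' T) =
  ip prodm (cutoff T a) (cutoff T Z') + ip prodm (cutoff T a') (cutoff T Z)
  + ip Pr (m T) (m' T).
Proof.
have sDT := ito_tint_sqint T0 hZ TT; have sDT' := ito_tint_sqint T0 hZ' TT.
have sm := ito_mart_sqint hZ TT; have sm' := ito_mart_sqint hZ' TT.
have cutoffE (u : R -> Omega -> R) s : 0 <= s <= T ->
    (fun w => cutoff T u (s, w)) = u s.
  by move=> sT; apply/funext => w; rewrite /cutoff indicE mem_set ?mul1r//= in_itv.
have cutoff0 (u : R -> Omega -> R) s w : ~ (0 <= s <= T) -> cutoff T u (s, w) = 0.
  by move=> sT; exact: (@cutoff_supported R d Omega T u (s, w)).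
have [iaD aD] := tint_pair sa sDT'.
have [iam am] := tint_pair sa sm'.
have [iam' am'] := tint_pair sa' sm.
have [iaZ aZ] := ip_prod_sections sa sZ'.
have [iaZ' aZ'] := ip_prod_sections sa' sZ.
(* [g1 s] is E a(s) times the integral of a' over [s, T], and [g2 t] is E a'(t) times the integral
   of a over [0, t], in the form that holds for Ito processes. *)
pose g1 s := ip Pr (fun w => cutoff T a (s, w)) (tint (cutoff T a'))
  - ip Pr (fun w => cutoff T a (s, w)) (fun w => cutoff T Z' (s, w))
  + ip Pr (fun w => cutoff T a (s, w)) (m' T).
pose g2 s := ip Pr (fun w => cutoff T a' (s, w)) (fun w => cutoff T Z (s, w))
  - ip Pr (fun w => cutoff T a' (s, w)) (m T).
have h1 s : sqint Pr (fun w => cutoff T a (s, w)) ->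
    ip prodm (tens T (fun w => cutoff T a (s, w))) (after s (cutoff T a')) = g1 s.
  move=> sas; have [sT|sT] := pselect (0 <= s <= T); last first.
    rewrite /g1 !ip0l ?subrr ?addr0//; try by move=> w; exact: cutoff0.
    by move=> z; rewrite /tens cutoff0// mulr0.
  have /andP[s0 leT] := sT; have sas' := cutoff_le_sqint leT sa'.
  rewrite (cutoff_after a' leT) ipBr//; last exact: tens_sqint.
  rewrite -!tint_ip//; try exact: cutoff_supported; last exact: cutoff_le_supported.
  rewrite /g1 -addrA; congr (_ + _); rewrite !cutoffE// in sas *.
  have aas : adapted_sqint Pr F s (a s).
    by split=> //; exact: ito_drift_adapted hZ _ sT.
  (* Against [a s], the martingale at [T] may be replaced by its value at [s], which together with
     the drift up to [s] is [Z' s]. *)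
  rewrite (ito_mart hZ' sT aas) (ipC _ _ (Z' s)) (ip_ito_state T0 hZ')//.
  by rewrite !(ipC _ _ (a s)); ring.
have h2 t : sqint Pr (fun w => cutoff T a' (t, w)) ->
    ip prodm (tens T (fun w => cutoff T a' (t, w))) (before t (cutoff T a)) = g2 t.
  move=> sat; have [tT|tT] := pselect (0 <= t <= T); last first.
    rewrite /g2 !ip0l ?subrr//; try by move=> w; exact: cutoff0.
    by move=> z; rewrite /tens cutoff0// mulr0.
  have /andP[t0 leT] := tT; have sat' := cutoff_le_sqint leT sa.
  have st := tens_sqint T sat.
  rewrite ipC (ip_ae_eq _ _ _ (cutoff_before_ae a leT)); last 3 first.
  - by have [] := before_sqint t sa.
  - by have [] := sat'.
  - by have [] := st.
  rewrite ipC -tint_ip//; last exact: cutoff_le_supported.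
  rewrite /g2 !cutoffE// in sat *.
  have aat : adapted_sqint Pr F t (a' t).
    by split=> //; exact: ito_drift_adapted hZ' _ tT.
  rewrite (ito_mart hZ tT aat) (ipC _ _ (Z t)) (ip_ito_state T0 hZ)//.
  by rewrite !(ipC _ _ (a' t)); ring.
have ig1 : leb.-integrable setT (EFin \o g1).
  apply: eq_integrable (integrableD measurableT
    (integrableB measurableT iaD iaZ) iam) => //.
have ig2 : leb.-integrable setT (EFin \o g2).
  exact: eq_integrable (integrableB measurableT iaZ' iam').
have := time_exchange sa sa' (@cutoff_supported _ _ _ _ _)
  (@cutoff_supported _ _ _ _ _) ig1 ig2 h1 h2.
rewrite /g1 /g2 RintegralD//; last exact: (integrableB measurableT iaD iaZ).
rewrite !RintegralB// aD am am' aZ aZ' => E.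
rewrite (ip_ito_state T0 hZ TT); last exact: ito_state_sqint_at hZ' _ TT.
rewrite !(ipC _ _ (Z' T)) !(ip_ito_state T0 hZ' TT)//.
move: E; rewrite (ipC _ (m' T) (m T)) (ipC _ (tint _) (m' T)).
rewrite (ipC _ (tint (cutoff T a')) (tint (cutoff T a))).
lra.
Qed.

End Rule.
End ProductRule.

(** * Gain certificates *)

Section BilinearForms.
Context (R : realType).

Definition bform a b (M : 'M[R]_(a, b)) (x : 'cV[R]_a) (y : 'cV[R]_b) : R :=
  (x^T *m M *m y) 0 0.

Lemma bformDl a b (M : 'M[R]_(a, b)) x x' y :
  bform M (x + x') y = bform M x y + bform M x' y.
Proof. by rewrite /bform linearD/= !mulmxDl mxE. Qed.

Lemma bformDr a b (M : 'M[R]_(a, b)) x y y' :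
  bform M x (y + y') = bform M x y + bform M x y'.
Proof. by rewrite /bform mulmxDr mxE. Qed.

Lemma bformZl a b (M : 'M[R]_(a, b)) (c : R) x y :
  bform M (c *: x) y = c * bform M x y.
Proof. by rewrite /bform linearZ/= -!scalemxAl mxE. Qed.

Lemma bformZr a b (M : 'M[R]_(a, b)) (c : R) x y :
  bform M x (c *: y) = c * bform M x y.
Proof. by rewrite /bform -scalemxAr mxE. Qed.

Lemma bformNl a b (M : 'M[R]_(a, b)) x y : bform M (- x) y = - bform M x y.
Proof. by rewrite -scaleN1r bformZl mulN1r. Qed.

Lemma bformNr a b (M : 'M[R]_(a, b)) x y : bform M x (- y) = - bform M x y.
Proof. by rewrite -scaleN1r bformZr mulN1r. Qed.

Lemma bform_addmx a b (M M' : 'M[R]_(a, b)) x y :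
  bform (M + M') x y = bform M x y + bform M' x y.
Proof. by rewrite /bform mulmxDr mulmxDl mxE. Qed.

Lemma bform_scalemx a b (c : R) (M : 'M[R]_(a, b)) x y :
  bform (c *: M) x y = c * bform M x y.
Proof. by rewrite /bform -scalemxAr -scalemxAl mxE. Qed.

Lemma bform_oppmx a b (M : 'M[R]_(a, b)) x y : bform (- M) x y = - bform M x y.
Proof. by rewrite -scaleN1r bform_scalemx mulN1r. Qed.

Lemma bform0mx a b x y : bform (0 : 'M[R]_(a, b)) x y = 0.
Proof. by rewrite -(scale0r 0) bform_scalemx mul0r. Qed.

Lemma bform0l a b (M : 'M[R]_(a, b)) y : bform M 0 y = 0.
Proof. by rewrite -(scale0r 0) bformZl mul0r. Qed.

Lemma bform0r a b (M : 'M[R]_(a, b)) x : bform M x 0 = 0.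
Proof. by rewrite -(scale0r 0) bformZr mul0r. Qed.

Lemma bform_summx a b I (s : seq I) (M : I -> 'M[R]_(a, b)) x y :
  bform (\sum_(i <- s) M i) x y = \sum_(i <- s) bform (M i) x y.
Proof.
elim: s => [|i s IH]; first by rewrite !big_nil bform0mx.
by rewrite !big_cons bform_addmx IH.
Qed.

Lemma bform_suml a b (M : 'M[R]_(a, b)) I (s : seq I) (x : I -> 'cV[R]_a) y :
  bform M (\sum_(i <- s) x i) y = \sum_(i <- s) bform M (x i) y.
Proof.
elim: s => [|i s IH]; first by rewrite !big_nil bform0l.
by rewrite !big_cons bformDl IH.
Qed.

Lemma bform_sumr a b (M : 'M[R]_(a, b)) I (s : seq I) x (y : I -> 'cV[R]_b) :
  bform M x (\sum_(i <- s) y i) = \sum_(i <- s) bform M x (y i).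
Proof.
elim: s => [|i s IH]; first by rewrite !big_nil bform0r.
by rewrite !big_cons bformDr IH.
Qed.

Lemma bform_mulmx a a' b b' (L : 'M[R]_(a', a)) (M : 'M[R]_(a', b'))
    (L' : 'M[R]_(b', b)) x y :
  bform (L^T *m M *m L') x y = bform M (L *m x) (L' *m y).
Proof. by rewrite /bform trmx_mul !mulmxA. Qed.

Lemma bform_mulr a b b' (M : 'M[R]_(a, b')) (L' : 'M[R]_(b', b)) x y :
  bform (M *m L') x y = bform M x (L' *m y).
Proof. by rewrite /bform !mulmxA. Qed.

Lemma bform_mull a a' b (L : 'M[R]_(a', a)) (M : 'M[R]_(a', b)) x y :
  bform (L^T *m M) x y = bform M (L *m x) y.
Proof. by rewrite /bform trmx_mul !mulmxA. Qed.

Lemma bformC a b (M : 'M[R]_(a, b)) x y : bform M x y = bform M^T y x.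
Proof.
rewrite /bform -[in LHS](trmxK (x^T *m M *m y)) mxE.
by rewrite !trmx_mul trmxK mulmxA.
Qed.

Lemma bform_sym a (M : 'M[R]_a) x y : M^T = M -> bform M x y = bform M y x.
Proof. by move=> sM; rewrite bformC sM. Qed.

Lemma bform1E a (x y : 'cV[R]_a) : bform 1%:M x y = \sum_i x i 0 * y i 0.
Proof.
by rewrite /bform mulmx1 mxE; apply: eq_bigr => i _; rewrite mxE.
Qed.

Lemma sqnorm2E a (v : 'cV[R]_a) : sqnorm2 v = bform 1%:M v v.
Proof. by rewrite bform1E; apply: eq_bigr => i _; rewrite expr2. Qed.

Lemma sqnorm2_ge0 a (v : 'cV[R]_a) : 0 <= sqnorm2 v.
Proof. by apply: sumr_ge0 => i _; exact: sqr_ge0. Qed.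

Lemma sqnorm2D a (v w : 'cV[R]_a) :
  sqnorm2 (v + w) = sqnorm2 v + 2 * bform 1%:M v w + sqnorm2 w.
Proof.
rewrite !sqnorm2E bformDl !bformDr (bform_sym w v) ?trmx1//; ring.
Qed.

Lemma sqnorm2Z a (c : R) (v : 'cV[R]_a) : sqnorm2 (c *: v) = c ^+ 2 * sqnorm2 v.
Proof. by rewrite !sqnorm2E bformZl bformZr mulrA expr2. Qed.

Lemma sqnorm2N a (v : 'cV[R]_a) : sqnorm2 (- v) = sqnorm2 v.
Proof. by rewrite -scaleN1r sqnorm2Z sqrrN expr1n mul1r. Qed.

Lemma sqnorm2_col_mx a b (v : 'cV[R]_a) (w : 'cV[R]_b) :
  sqnorm2 (col_mx v w) = sqnorm2 v + sqnorm2 w.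
Proof.
rewrite /sqnorm2 big_split_ord/=; congr (_ + _); apply: eq_bigr => i _.
  by rewrite col_mxEu.
by rewrite col_mxEd.
Qed.

(* AM-GM: the weights [g1], [g2] turn norms into a triangle inequality. *)
Lemma sqnorm2D_weighted a (v w : 'cV[R]_a) (g1 g2 : R) : 0 < g1 -> 0 < g2 ->
  sqnorm2 (v + w) <= (g1 + g2) / g1 * sqnorm2 v + (g1 + g2) / g2 * sqnorm2 w.
Proof.
move=> g10 g20; rewrite -subr_ge0.
have -> : (g1 + g2) / g1 * sqnorm2 v + (g1 + g2) / g2 * sqnorm2 w
    - sqnorm2 (v + w) = (g1 * g2)^-1 * sqnorm2 (g2 *: v + (- g1) *: w).
  rewrite !sqnorm2D !sqnorm2Z bformZl bformZr.
  by field; rewrite !gt_eqF.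
by rewrite mulr_ge0 ?sqnorm2_ge0// invr_ge0 mulr_ge0// ltW.
Qed.

Lemma posdefmx_sym a (M : 'M[R]_a) : posdefmx M -> M^T = M.
Proof. by case. Qed.

Lemma posdefmx_ge0 a (M : 'M[R]_a) x : posdefmx M -> 0 <= bform M x x.
Proof.
case=> _ h; have [->|/h/ltW//] := eqVneq x 0.
by rewrite /bform mulmx0 mxE.
Qed.

Lemma posdefmx_unit a (M : 'M[R]_a) : posdefmx M -> M \in unitmx.
Proof.
case=> sM h; rewrite -row_free_unit -kermx_eq0; apply/eqP/row_matrixP => i.
rewrite row0; apply/eqP/negPn/negP => ri0.
have := h (row i (kermx M))^T; rewrite trmxK -row_mul mulmx_ker row0 mul0mx mxE ltxx.
move=> H; suff: false by []. apply: H.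
by apply: contra ri0 => /eqP/(congr1 trmx); rewrite trmxK trmx0 => ->.
Qed.

End BilinearForms.

Section Schur.
Context (R : realType).

(** Completing the square in the last block: [L *m x] minimizes over [z], and [Pi] is the form at
    the minimum. The polarized identity is needed because generators pair the state with its
    drift. *)
Lemma schur_complement a b (Th : 'M[R]_(a + b)) : posdefmx Th ->
  exists (Pi : 'M[R]_a) (L : 'M[R]_(b, a)) (D : 'M[R]_b),
  [/\ posdefmx Pi, (forall v, 0 <= bform D v v) &
    forall x y z w, bform Th (col_mx x z) (col_mx y w) =
      bform Pi x y + bform D (z - L *m x) (w - L *m y)].
Proof.
move=> hTh; have [sTh pTh] := hTh.
pose P := ulsubmx Th; pose E := ursubmx Th; pose D := drsubmx Th.
have sTh' : block_mx P^T (dlsubmx Th)^T E^T D^T = block_mx P E (dlsubmx Th) D.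
  by rewrite -tr_block_mx submxK sTh.
have [sP EF _ sD] := eq_block_mx sTh'.
have ThE : Th = block_mx P E E^T D by rewrite -EF trmxK EF submxK.
have bTh x y z w : bform Th (col_mx x z) (col_mx y w) =
    bform P x y + bform E x w + bform E y z + bform D z w.
  rewrite [bform E y z]bformC /bform ThE tr_col_mx mul_row_block mul_row_col.
  by rewrite !mulmxDl !mxE; ring.
have hD : posdefmx D.
  split=> // v v0; have := pTh (col_mx 0 v).
  rewrite -[X in 0 < X]/(bform Th _ _) bTh !bform0l.
  by rewrite !add0r; apply; rewrite col_mx_eq0 negb_and v0 orbT.
pose L := - (invmx D *m E^T).
have DL x z : bform D z (L *m x) = - bform E x z.
  rewrite -bform_mulr /L mulmxN mulKVmx ?posdefmx_unit// bform_oppmx.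
  by rewrite [in RHS]bformC.
have sum x y z w : bform Th (col_mx x z) (col_mx y w) =
    bform (P + E *m L) x y + bform D (z - L *m x) (w - L *m y).
  rewrite bTh bform_addmx bform_mulr !(bformDl, bformDr, bformNl, bformNr).
  rewrite !DL (bform_sym (L *m x) w sD) DL.
  have := bform_sym (L *m x) (L *m y) sD; rewrite !DL => /oppr_inj ->.
  by ring.
exists (P + E *m L), L, D; split=> //; last by move=> v; exact: posdefmx_ge0.
split=> [|v v0].
  rewrite linearD/= sP trmx_mul; congr (_ + _).
  rewrite /L linearN/= trmx_mul trmxK trmx_inv sD mulNmx mulmxN; congr (- _).
  by rewrite mulmxA.
have := pTh (col_mx v (L *m v)); rewrite -[X in 0 < X]/(bform Th _ _) sum subrr.
rewrite bform0l addr0; apply.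
by rewrite col_mx_eq0 negb_and v0.
Qed.

End Schur.

(** * Composition of gain certificates *)

Section Certificates.
Context (R : realType) (q m p : nat) (K : 'M[R]_q).

(** Positivity of [K] in the shape in which noise terms use it, tensored with a semidefinite form.
    For the covariance of a Wiener process it is [wiener_cov_psd]. *)
Hypothesis K_psd : forall k (D : 'M[R]_k) (y : 'I_q -> 'cV[R]_k),
  (forall v, 0 <= bform D v v) ->
  0 <= \sum_(i < q) \sum_(j < q) K i j * bform D (y i) (y j).

Record lsys n := LSys {
  sA : 'M[R]_n; sB : 'M[R]_(n, m); sC : 'M[R]_(p, n); sN : 'I_q -> 'M[R]_n }.

Definition noise n (M : 'M[R]_n) (y : 'I_q -> 'cV[R]_n) : R :=
  \sum_(i < q) \sum_(j < q) K i j * bform M (y i) (y j).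

Lemma noiseD n (M M' : 'M[R]_n) y : noise (M + M') y = noise M y + noise M' y.
Proof.
rewrite /noise -big_split; apply: eq_bigr => i _; rewrite -big_split.
by apply: eq_bigr => j _; rewrite bform_addmx mulrDr.
Qed.

Lemma noiseZ n c (M : 'M[R]_n) y : noise (c *: M) y = c * noise M y.
Proof.
rewrite /noise mulr_sumr; apply: eq_bigr => i _; rewrite mulr_sumr.
by apply: eq_bigr => j _; rewrite bform_scalemx; ring.
Qed.

Lemma noise_mulmx n n' (M : 'M[R]_n) (L : 'M[R]_(n, n')) y :
  noise (L^T *m M *m L) y = noise M (fun i => L *m y i).
Proof.
by apply: eq_bigr => i _; apply: eq_bigr => j _; rewrite bform_mulmx.
Qed.

Definition drift n (G : lsys n) (x : 'cV[R]_n) (u : 'cV[R]_m) :=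
  sA G *m x + sB G *m u.

(* The generator of [V x = x^T Pi x] along the joint dynamics of the two systems
   is at most [g^2 |u|^2 - |y1 - y2|^2]. *)
Definition gain_cert n1 n2 (G1 : lsys n1) (G2 : lsys n2) (g : R)
    (Pi : 'M[R]_(n1 + n2)) : Prop :=
  posdefmx Pi /\ forall x1 x2 u,
    2 * bform Pi (col_mx x1 x2) (col_mx (drift G1 x1 u) (drift G2 x2 u))
    + noise Pi (fun i => col_mx (sN G1 i *m x1) (sN G2 i *m x2))
    <= g ^+ 2 * sqnorm2 u - sqnorm2 (sC G1 *m x1 - sC G2 *m x2).

(* The storage functions of the two certificates are added and then minimized
   over the state of the middle system, so no trajectory of that system is ever
   needed. *)
Lemma gain_cert_trans n1 n2 n3 (G1 : lsys n1) (G2 : lsys n2) (G3 : lsys n3)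
    g12 g23 P12 P23 : 0 < g12 -> 0 < g23 ->
  gain_cert G1 G2 g12 P12 -> gain_cert G2 G3 g23 P23 ->
  exists P13, gain_cert G1 G3 (g12 + g23) P13.
Proof.
move=> g120 g230 [h12 c12] [h23 c23].
set g := g12 + g23; have g0 : 0 < g by exact: addr_gt0.
(* The middle state comes last because it is the block to be eliminated. *)
pose L12 : 'M[R]_(n1 + n2, (n1 + n3) + n2) :=
  col_mx (row_mx (row_mx 1%:M 0) 0) (row_mx 0 1%:M).
pose L23 : 'M[R]_(n2 + n3, (n1 + n3) + n2) :=
  col_mx (row_mx 0 1%:M) (row_mx (row_mx 0 1%:M) 0).
have L12E x1 x3 x2 : L12 *m col_mx (col_mx x1 x3) x2 = col_mx x1 x2 :> 'cV[R]_(n1 + n2).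
  by rewrite /L12 mul_col_mx !mul_row_col !mul0mx !mul1mx !addr0 add0r.
have L23E x1 x3 x2 : L23 *m col_mx (col_mx x1 x3) x2 = col_mx x2 x3 :> 'cV[R]_(n2 + n3).
  by rewrite /L23 mul_col_mx !mul_row_col !mul0mx !mul1mx !add0r addr0.
(* These weights are those of [sqnorm2D_weighted] for the output errors, and they combine the input
   terms into [g * (g12 + g23) = g ^+ 2]. *)
pose Th := (g / g12) *: (L12^T *m P12 *m L12) + (g / g23) *: (L23^T *m P23 *m L23).
have c120 : 0 < g / g12 by rewrite divr_gt0.
have c230 : 0 < g / g23 by rewrite divr_gt0.
have bTh v w : bform Th v w = g / g12 * bform P12 (L12 *m v) (L12 *m w)
    + g / g23 * bform P23 (L23 *m v) (L23 *m w).
  by rewrite bform_addmx !bform_scalemx !bform_mulmx.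
have hTh : posdefmx Th.
  split.
    rewrite /Th linearD !linearZ/= !trmx_mul !trmxK (posdefmx_sym h12).
    by rewrite (posdefmx_sym h23) !mulmxA.
  move=> v; rewrite -[v]vsubmxK -[usubmx v]vsubmxK.
  set x1 := usubmx _; set x3 := dsubmx (usubmx v); set x2 := dsubmx v => v0.
  rewrite -[X in 0 < X]/(bform Th _ _) bTh L12E L23E.
  have [e12|n12] := eqVneq (col_mx x1 x2) 0.
    apply: ltr_wpDl; first by rewrite mulr_ge0 ?(ltW c120)// posdefmx_ge0.
    rewrite mulr_gt0//; apply: (h23.2); apply: contra v0 => /eqP e23.
    by move: e12 e23 => /eqP + /eqP; rewrite !col_mx_eq0 => /andP[-> ->] /andP[_ ->].
  apply: ltr_pwDl; first by rewrite mulr_gt0//; exact: h12.2.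
  by rewrite mulr_ge0 ?(ltW c230)// posdefmx_ge0.
have [Pi [L [D [hPi hD ThE]]]] := schur_complement hTh.
exists Pi; split=> // x1 x3 u.
(* At the minimizing middle state the [D] term vanishes whatever drift the middle block is given, so
   that of [G2] can be inserted. *)
pose x2 := L *m col_mx x1 x3.
have -> : bform Pi (col_mx x1 x3) (col_mx (drift G1 x1 u) (drift G3 x3 u)) =
    bform Th (col_mx (col_mx x1 x3) x2)
      (col_mx (col_mx (drift G1 x1 u) (drift G3 x3 u)) (drift G2 x2 u)).
  by rewrite ThE subrr bform0l addr0.
(* The noise of the middle system does not follow the minimizer; the discrepancy is a [D] term,
   nonnegative by [K_psd]. *)
have noise_le : noise Pi (fun i => col_mx (sN G1 i *m x1) (sN G3 i *m x3)) <=
    noise Th (fun i => col_mx (col_mx (sN G1 i *m x1) (sN G3 i *m x3)) (sN G2 i *m x2)).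
  rewrite /noise -subr_ge0 -sumrB; under eq_bigr do rewrite -sumrB.
  have := K_psd (fun i => sN G2 i *m x2 - L *m col_mx (sN G1 i *m x1) (sN G3 i *m x3)) hD.
  congr (0 <= _); apply: eq_bigr => i _; apply: eq_bigr => j _.
  by rewrite ThE; ring.
apply: (@le_trans _ _ (g / g12 * (g12 ^+ 2 * sqnorm2 u
    - sqnorm2 (sC G1 *m x1 - sC G2 *m x2))
  + g / g23 * (g23 ^+ 2 * sqnorm2 u - sqnorm2 (sC G2 *m x2 - sC G3 *m x3)))).
  apply: le_trans (lerD (ler_wpM2l (ltW c120) (c12 x1 x2 u))
    (ler_wpM2l (ltW c230) (c23 x2 x3 u))).
  rewrite bTh !L12E !L23E; apply: le_trans (lerD (lexx _) noise_le) _.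
  rewrite noiseD !noiseZ !noise_mulmx.
  rewrite [X in noise P12 X](_ : _ = fun i => col_mx (sN G1 i *m x1) (sN G2 i *m x2));
    last by apply/funext => i; rewrite L12E.
  rewrite [X in noise P23 X](_ : _ = fun i => col_mx (sN G2 i *m x2) (sN G3 i *m x3));
    last by apply/funext => i; rewrite L23E.
  by rewrite le_eqVlt; apply/orP; left; apply/eqP; ring.
have := sqnorm2D_weighted (sC G1 *m x1 - sC G2 *m x2) (sC G2 *m x2 - sC G3 *m x3)
  g120 g230.
rewrite addrA subrK -/g => h.
have -> : g ^+ 2 * sqnorm2 u = (g / g12 * g12 ^+ 2 + g / g23 * g23 ^+ 2) * sqnorm2 u.
  by congr (_ * _); rewrite /g; field; rewrite !gt_eqF.
lra.
Qed.

End Certificates.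

(** * Truncation of balanced systems *)

Section Truncation.
Context (R : realType) (q m p : nat) (K : 'M[R]_q).

Hypothesis K_psd : forall k (D : 'M[R]_k) (y : 'I_q -> 'cV[R]_k),
  (forall v, 0 <= bform D v v) ->
  0 <= \sum_(i < q) \sum_(j < q) K i j * bform D (y i) (y j).

Local Notation lsys := (lsys R q m p).

Definition obs_lmi n (G : lsys n) (Q : 'M[R]_n) : Prop := forall x,
  2 * bform Q x (sA G *m x) + noise K Q (fun i => sN G i *m x)
  + sqnorm2 (sC G *m x) <= 0.

(** [X] stands for the inverse of a controllability Gramian. In this form the inequality passes to a
    compressed system by the same argument as [obs_lmi]. *)
Definition ctr_lmi n (G : lsys n) (X : 'M[R]_n) : Prop := forall x u,
  2 * bform X x (drift G x u) + noise K X (fun i => sN G i *m x) <= sqnorm2 u.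

Definition compress a b (J : 'M[R]_(a, b)) (G : lsys a) : lsys b :=
  LSys (J^T *m sA G *m J) (J^T *m sB G) (sC G *m J) (fun i => J^T *m sN G i *m J).

(** The covariance of scalar noise coefficients, used for the components along [e]. *)
Let sc (f g : 'I_q -> R) := \sum_(i < q) \sum_(j < q) K i j * (f i * g j).

Let sc_ge0 f : 0 <= sc f f.
Proof.
have := K_psd (D := 1%:M) (fun i => const_mx (f i) : 'cV[R]_1).
have -> : \sum_(i < q) \sum_(j < q) K i j *
    bform 1%:M (const_mx (f i) : 'cV[R]_1) (const_mx (f j)) = sc f f.
  apply: eq_bigr => i _; apply: eq_bigr => j _.
  by rewrite bform1E big_ord1 !mxE.
by apply=> v; rewrite -sqnorm2E sqnorm2_ge0.
Qed.

Let scD f g h : sc (fun i => f i + g i) h = sc f h + sc g h.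
Proof.
rewrite /sc -big_split; apply: eq_bigr => i _; rewrite -big_split.
by apply: eq_bigr => j _ /=; ring.
Qed.

Let scDr f g h : sc h (fun i => f i + g i) = sc h f + sc h g.
Proof.
rewrite /sc -big_split; apply: eq_bigr => i _; rewrite -big_split.
by apply: eq_bigr => j _ /=; ring.
Qed.

Let scN f h : sc (fun i => - f i) h = - sc f h.
Proof.
rewrite /sc -sumrN; apply: eq_bigr => i _; rewrite -sumrN.
by apply: eq_bigr => j _ /=; ring.
Qed.

Let scNr f h : sc h (fun i => - f i) = - sc h f.
Proof.
rewrite /sc -sumrN; apply: eq_bigr => i _; rewrite -sumrN.
by apply: eq_bigr => j _ /=; ring.
Qed.

Section OneState.
Variables (a b : nat) (J : 'M[R]_(a, b)) (e : 'cV[R]_a).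
Hypotheses (JJ : J^T *m J = 1%:M) (JtJ : J *m J^T + e *m e^T = 1%:M).
Hypotheses (Je : e^T *m J = 0) (ee : (e^T *m e) 0 0 = 1).

Let es (v : 'cV[R]_a) : R := (e^T *m v) 0 0.

Let esD v w : es (v + w) = es v + es w.
Proof. by rewrite /es mulmxDr mxE. Qed.

Let esN v : es (- v) = - es v.
Proof. by rewrite /es mulmxN mxE. Qed.

Let esJ z : es (J *m z) = 0.
Proof. by rewrite /es mulmxA Je mul0mx mxE. Qed.

Let projE v : J *m (J^T *m v) = v + (- es v) *: e.
Proof.
apply/eqP; rewrite scaleNr eq_sym subr_eq; apply/eqP.
have -> : es v *: e = e *m (e^T *m v).
  by rewrite [e^T *m v]mx11_scalar mul_mx_scalar.
by rewrite !mulmxA -mulmxDl JtJ mul1mx.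
Qed.

Lemma drift_compress (G : lsys a) z u :
  drift (compress J G) z u = J^T *m drift G (J *m z) u.
Proof. by rewrite /drift/= mulmxDr !mulmxA. Qed.

Section Eigen.
Variables (M : 'M[R]_a) (c : R).
Hypotheses (sM : M^T = M) (Me : M *m e = c *: e).

Let bform_e v : bform M v e = c * es v.
Proof.
rewrite /bform -mulmxA Me -scalemxAr mxE; congr (_ * _).
by rewrite /es -[v^T *m e]trmxK trmx_mul trmxK mxE.
Qed.

Let bform_e' v : bform M e v = c * es v.
Proof. by rewrite bform_sym// bform_e. Qed.

Let noise_e y f : noise K M (fun i => y i + f i *: e) =
  noise K M y + c * (sc f (fun i => es (y i)) + sc (fun i => es (y i)) f + sc f f).
Proof.
rewrite /noise /sc -!big_split mulr_sumr -big_split; apply: eq_bigr => i _.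
rewrite -!big_split mulr_sumr -big_split; apply: eq_bigr => j _ /=.
rewrite !(bformDl, bformDr, bformZl, bformZr) !bform_e !bform_e' /es ee.
by ring.
Qed.

(** As [e] is an eigenvector, removing the noise component along it subtracts [c] times a
    variance. *)
Let compress_noise (N : 'I_q -> 'M[R]_a) z : 0 < c ->
  noise K (J^T *m M *m J) (fun i => J^T *m N i *m J *m z) <=
  noise K M (fun i => N i *m (J *m z)).
Proof.
move=> c0; rewrite noise_mulmx.
rewrite [X in noise K M X](_ : _ = fun i => N i *m (J *m z)
    + (- es (N i *m (J *m z))) *: e); last first.
  by apply/funext => i; rewrite -projE !mulmxA.
rewrite noise_e !scN !scNr gerDl pmulr_rle0//.
by have := sc_ge0 (fun i => es (N i *m (J *m z))); lra.
Qed.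

(** [J *m z] has no component along the eigenvector [e], so projecting [v] away from [e] leaves the
    form unchanged. *)
Let compress_bform z v :
  bform (J^T *m M *m J) z (J^T *m v) = bform M (J *m z) v.
Proof.
by rewrite bform_mulmx projE bformDr bformZr bform_e esJ !mulr0 addr0.
Qed.

Lemma obs_lmi_compress (G : lsys a) : 0 < c -> obs_lmi G M ->
  obs_lmi (compress J G) (J^T *m M *m J).
Proof.
move=> c0 lmi z; apply: le_trans (lmi (J *m z)).
rewrite /= (_ : _ *m z = J^T *m (sA G *m (J *m z))); last by rewrite !mulmxA.
by rewrite compress_bform -(mulmxA (sC G)) lerD2r lerD2l; exact: compress_noise.
Qed.

Lemma ctr_lmi_compress (G : lsys a) : 0 < c -> ctr_lmi G M ->
  ctr_lmi (compress J G) (J^T *m M *m J).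
Proof.
move=> c0 lmi z u; apply: le_trans (lmi (J *m z) u).
by rewrite drift_compress compress_bform lerD2l; exact: compress_noise.
Qed.

(* Generators of [|x - J z|_M^2] and [|x + J z|_M^2]. *)
Lemma drift_minus (G : lsys a) x z u :
  let c0 := es (drift G (J *m z) u) in
  bform M (x - J *m z) (drift G x u - J *m drift (compress J G) z u) =
  bform M (x - J *m z) (sA G *m (x - J *m z)) + c * c0 * es x.
Proof.
move=> c0; have -> : J *m drift (compress J G) z u =
    drift G (J *m z) u + (- c0) *: e.
  by rewrite drift_compress projE.
rewrite /drift mulmxBr opprD scaleNr opprK.
rewrite [X in bform M _ X](_ : _ = (sA G *m x - sA G *m (J *m z)) + c0 *: e); last first.
  by rewrite opprD !addrA; congr (_ + _); rewrite addrAC addrK.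
by rewrite bformDr bformZr bform_e esD esN esJ subr0; ring.
Qed.

Lemma drift_plus (G : lsys a) x z u :
  let c0 := es (drift G (J *m z) u) in
  bform M (x + J *m z) (drift G x u + J *m drift (compress J G) z u) =
  bform M (x + J *m z) (drift G (x + J *m z) (2 *: u)) - c * c0 * es x.
Proof.
move=> c0; have -> : J *m drift (compress J G) z u =
    drift G (J *m z) u + (- c0) *: e.
  by rewrite drift_compress projE.
rewrite [X in bform M _ X](_ : _ = drift G (x + J *m z) (2 *: u) + (- c0) *: e); last first.
  rewrite addrA; congr (_ + _); rewrite /drift mulmxDr -scalemxAr scaler_nat mulr2n.
  by rewrite addrACA.
by rewrite bformDr bformZr bform_e esD esJ addr0; ring.
Qed.

(** The deleted component [k i *: e] reappears as a perturbation. Its mixed terms with [n] have the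
    opposite sign in [noise_plus], while [- c * sc k k] occurs in both. *)
Lemma noise_minus (N : 'I_q -> 'M[R]_a) x z :
  let n i := es (N i *m x) in let k i := es (N i *m (J *m z)) in
  noise K M (fun i => N i *m x - J *m (J^T *m N i *m J *m z)) =
  noise K M (fun i => N i *m (x - J *m z)) + c * (sc n k + sc k n - sc k k).
Proof.
move=> n k.
rewrite [X in noise K M X](_ : _ = fun i => N i *m (x - J *m z) + k i *: e); last first.
  apply/funext => i; rewrite -!mulmxA projE scaleNr opprD opprK addrA.
  by rewrite mulmxBr.
rewrite noise_e; congr (_ + c * _).
rewrite [X in sc k X](_ : _ = fun i => n i + - k i); last first.
  by apply/funext => i; rewrite mulmxBr esD esN.
rewrite [X in sc X k](_ : _ = fun i => n i + - k i); last first.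
  by apply/funext => i; rewrite mulmxBr esD esN.
by rewrite scD scDr scN scNr; ring.
Qed.

Lemma noise_plus (N : 'I_q -> 'M[R]_a) x z :
  let n i := es (N i *m x) in let k i := es (N i *m (J *m z)) in
  noise K M (fun i => N i *m x + J *m (J^T *m N i *m J *m z)) =
  noise K M (fun i => N i *m (x + J *m z)) - c * (sc n k + sc k n + sc k k).
Proof.
move=> n k.
rewrite [X in noise K M X](_ : _ = fun i => N i *m (x + J *m z) + (- k i) *: e); last first.
  apply/funext => i; rewrite -!mulmxA projE addrA.
  by rewrite mulmxDr.
rewrite noise_e -mulrN; congr (_ + c * _).
rewrite !scN !scNr.
rewrite [X in sc k X](_ : _ = fun i => n i + k i); last first.
  by apply/funext => i; rewrite mulmxDr esD.
rewrite [X in sc X k](_ : _ = fun i => n i + k i); last first.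
  by apply/funext => i; rewrite mulmxDr esD.
by rewrite scD scDr; ring.
Qed.

End Eigen.

Lemma gain_cert_compress (G : lsys a) (Q X : 'M[R]_a) (cQ cX : R) :
  posdefmx Q -> posdefmx X -> 0 < cQ -> 0 < cX ->
  Q *m e = cQ *: e -> X *m e = cX *: e ->
  obs_lmi G Q -> ctr_lmi G X ->
  exists Pi, gain_cert K G (compress J G) (2 * Num.sqrt (cQ / cX)) Pi.
Proof.
move=> hQ hX cQ0 cX0 Qe Xe obs ctr.
have sQ := posdefmx_sym hQ; have sX := posdefmx_sym hX.
pose Lm : 'M[R]_(a, a + b) := row_mx 1%:M (- J).
pose Lp : 'M[R]_(a, a + b) := row_mx 1%:M J.
have LmE x z : Lm *m col_mx x z = x - J *m z.
  by rewrite mul_row_col mul1mx mulNmx.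
have LpE x z : Lp *m col_mx x z = x + J *m z.
  by rewrite mul_row_col mul1mx.
have r0 : 0 < cQ / cX by rewrite divr_gt0.
(* The weight replaces the eigenvalue [cX] by [cQ] in the terms of [drift_plus] and [noise_plus]
   that are to cancel those of [drift_minus] and [noise_minus]. *)
exists (Lm^T *m Q *m Lm + (cQ / cX) *: (Lp^T *m X *m Lp)); split.
  split=> [|v].
    by rewrite linearD linearZ/= !trmx_mul !trmxK sQ sX !mulmxA.
  rewrite -[v]vsubmxK; set x := usubmx v; set z := dsubmx v => v0.
  rewrite -[X in 0 < X]/(bform _ _ _) bform_addmx bform_scalemx !bform_mulmx LmE LpE.
  have [xz|xz] := eqVneq (x - J *m z) 0.
    (* If [x = J *m z] then [x + J *m z = 2 *: x], and [JJ] recovers [z] from [x], so this cannot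
       vanish. *)
    rewrite xz bform0l add0r mulr_gt0//; apply: hX.2.
    move/eqP: xz; rewrite subr_eq0 => /eqP xz; apply: contra v0.
    rewrite {1}xz -mulr2n -scaler_nat scaler_eq0 pnatr_eq0/= -xz => /eqP x0.
    rewrite col_mx_eq0 x0 eqxx/=; apply/eqP.
    by rewrite -[z]mul1mx -JJ -mulmxA -xz x0 mulmx0.
  apply: ltr_pwDl; first exact: hQ.2.
  by rewrite mulr_ge0 ?(ltW r0)// posdefmx_ge0.
move=> x z u.
rewrite bform_addmx bform_scalemx !bform_mulmx noiseD noiseZ !noise_mulmx.
rewrite !LmE !LpE.
rewrite [Y in noise K Q Y](_ : _ = fun i => sN G i *m x
    - J *m (J^T *m sN G i *m J *m z)); last by apply/funext => i; rewrite LmE.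
rewrite [Y in noise K X Y](_ : _ = fun i => sN G i *m x
    + J *m (J^T *m sN G i *m J *m z)); last by apply/funext => i; rewrite LpE.
rewrite (drift_minus Qe) (drift_plus Xe) (noise_minus sQ Qe) (noise_plus sX Xe).
set c0 := es (drift _ _ _); set k := fun i => es (sN G i *m (J *m z)).
(* The difference is free of input and the sum receives the input twice; the resulting
   [4 * sqnorm2 u] is the origin of the factor 2 in the gain. *)
have := obs (x - J *m z); have := ctr (x + J *m z) (2 *: u).
have skk := sc_ge0 k.
rewrite sqnorm2Z exprMn sqr_sqrtr ?(ltW r0)//.
rewrite (_ : sC (compress J G) *m z = sC G *m (J *m z)); last by rewrite mulmxA.
rewrite -mulmxBr => hX' hQ'.
have {}hX' := ler_wpM2l (ltW r0) hX'.
set S1 := sc _ k + sc k _; have skk' := mulr_ge0 (ltW cQ0) skk.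
move: hX' hQ' skk'; move: (bform Q _ _) (noise K Q _) (bform X _ _) (noise K X _).
move: (sqnorm2 u) (sqnorm2 _) (sc k k) S1 (es x) c0.
move=> uu yy s S1 y c0 bQ nQ bX nX hX' hQ' sQ'.
(* All terms in [c0] and [S1] have cancelled; of the deleted noise only its variance [s] is left,
   with a favourable sign. *)
rewrite [leLHS](_ : _ = (2 * bQ + nQ) + cQ / cX * (2 * bX + nX) - 2 * (cQ * s));
  first by lra.
by field; rewrite gt_eqF.
Qed.

End OneState.

Definition trunc_sys n b (h : (b <= n)%N) (G : lsys n) : lsys b :=
  let f := widen_ord h in
  LSys (mxsub f f (sA G)) (rowsub f (sB G)) (colsub f (sC G))
    (fun i => mxsub f f (sN G i)).

Let inj_mx n b (h : (b <= n)%N) : 'M[R]_(n, b) := colsub (widen_ord h) 1%:M.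

Let tr_inj_mx n b (h : (b <= n)%N) :
  (inj_mx h)^T = rowsub (widen_ord h) (1%:M : 'M[R]_n).
Proof. by apply/matrixP => i j; rewrite !mxE eq_sym. Qed.

Let mul_inj_mx c n b (h : (b <= n)%N) (M : 'M[R]_(c, n)) :
  M *m inj_mx h = colsub (widen_ord h) M.
Proof. by rewrite /inj_mx mulmx_colsub mulmx1. Qed.

Let tr_inj_mx_mul c n b (h : (b <= n)%N) (M : 'M[R]_(n, c)) :
  (inj_mx h)^T *m M = rowsub (widen_ord h) M.
Proof. by rewrite tr_inj_mx mul_rowsub_mx mul1mx. Qed.

Let compress_trunc n b (h : (b <= n)%N) (G : lsys n) :
  compress (inj_mx h) G = trunc_sys h G.
Proof.
rewrite /compress /trunc_sys; congr LSys.
- by rewrite tr_inj_mx_mul mul_inj_mx; apply/matrixP => i j; rewrite !mxE.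
- exact: tr_inj_mx_mul.
- exact: mul_inj_mx.
- apply/funext => i; rewrite tr_inj_mx_mul mul_inj_mx.
  by apply/matrixP => k l; rewrite !mxE.
Qed.

Let trunc_sys_trans n b c (h : (b <= n)%N) (h' : (c <= b)%N) (h'' : (c <= n)%N)
    (G : lsys n) : trunc_sys h' (trunc_sys h G) = trunc_sys h'' G.
Proof.
have E (i : 'I_c) : widen_ord h (widen_ord h' i) = widen_ord h'' i by exact: val_inj.
rewrite /trunc_sys/=; congr LSys.
- by apply/matrixP => i j; rewrite !mxE !E.
- by apply/matrixP => i j; rewrite !mxE !E.
- by apply/matrixP => i j; rewrite !mxE !E.
- by apply/funext => k; apply/matrixP => i j; rewrite !mxE !E.
Qed.

Let compress_diagf n b (h : (b <= n)%N) (s : 'I_n -> R) :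
  (inj_mx h)^T *m diagf s *m inj_mx h = diagf (fun i => s (widen_ord h i)).
Proof.
rewrite tr_inj_mx_mul mul_inj_mx; apply/matrixP => i j; rewrite !mxE.
by rewrite -!val_eqE.
Qed.

Lemma posdefmx_diagf n (s : 'I_n -> R) : (forall i, 0 < s i) -> posdefmx (diagf s).
Proof.
move=> s0; split; first exact: tr_diag_mx.
move=> v v0; rewrite /diagf mul_mx_diag mxE.
have [i vi] : exists i, v i 0 != 0.
  apply/existsP; rewrite -negb_forall; apply: contra v0 => /forallP v0.
  by apply/eqP/matrixP => i j; rewrite (ord1 j) mxE; apply/eqP.
rewrite (bigD1 i)//= !mxE; apply: ltr_pwDl.
  by rewrite mulrAC -expr2 mulr_gt0// exprn_even_gt0.
by apply: sumr_ge0 => j _; rewrite !mxE mulrAC -expr2 mulr_ge0 ?sqr_ge0// ltW.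
Qed.

(* One state is removed at a time. *)
Lemma gain_cert_trunc n b (h : (b <= n)%N) (G : lsys n) (cQ cX : 'I_n -> R) :
  (b < n)%N -> (forall i, 0 < cQ i) -> (forall i, 0 < cX i) ->
  obs_lmi G (diagf cQ) -> ctr_lmi G (diagf cX) ->
  exists Pi, gain_cert K G (trunc_sys h G)
    (2 * \sum_(k < n | (b <= k)%N) Num.sqrt (cQ k / cX k)) Pi.
Proof.
elim: n h G cQ cX => // n IH h G cQ cX bn cQ0 cX0 obs ctr.
pose J := inj_mx (leqnSn n); pose e : 'cV[R]_n.+1 := delta_mx ord_max 0.
have JJ : J^T *m J = 1%:M.
  by rewrite tr_inj_mx_mul; apply/matrixP => i j; rewrite !mxE -!val_eqE.
have JtJ : J *m J^T + e *m e^T = 1%:M.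
  apply/matrixP => i j.
  transitivity ((1%:M *m 1%:M^T : 'M[R]_n.+1) i j); last by rewrite trmx1 mulmx1.
  rewrite !mxE [RHS]big_ord_recr/= [X in _ + X]big_ord1; congr (_ + _).
    by apply: eq_bigr => k _; rewrite !mxE.
  by rewrite !mxE !eqxx !andbT.
have Je : e^T *m J = 0.
  rewrite mul_inj_mx; apply/matrixP => i j; rewrite !mxE.
  by rewrite -val_eqE/= (ltn_eqF (ltn_ord j)).
have ee : (e^T *m e) 0 0 = 1.
  by rewrite trmx_delta mul_delta_mx mxE !eqxx.
have eig (s : 'I_n.+1 -> R) : diagf s *m e = s ord_max *: e.
  apply/matrixP => i j; rewrite mul_diag_mx !mxE (ord1 j) eqxx andbT.
  by case: eqP => [->|]; rewrite ?mulr1 ?mulr0.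
have hQ := posdefmx_diagf cQ0; have hX := posdefmx_diagf cX0.
have [Pi1 cert1] := gain_cert_compress JJ JtJ Je ee hQ hX
  (cQ0 ord_max) (cX0 ord_max) (eig cQ) (eig cX) obs ctr.
rewrite compress_trunc in cert1.
have sum1 : \sum_(k < n.+1 | (b <= k)%N) Num.sqrt (cQ k / cX k) =
    \sum_(k < n | (b <= k)%N) Num.sqrt (cQ (widen_ord (leqnSn n) k) /
      cX (widen_ord (leqnSn n) k)) + Num.sqrt (cQ ord_max / cX ord_max).
  by rewrite big_mkcond big_ord_recr/= -big_mkcond/= -ltnS bn.
(* When a single state is removed, the one-step certificate is the result; composing it with a
   certificate of gain 0 would not be possible. *)
move: bn; rewrite ltnS leq_eqVlt => /orP[/eqP bn|bn].
  subst b; exists Pi1; rewrite sum1 big1 ?add0r; last first.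
    by move=> k; rewrite leqNgt ltn_ord.
  by rewrite (bool_irrelevance h (leqnSn n)).
have obs' : obs_lmi (compress J G) (J^T *m diagf cQ *m J).
  exact: (obs_lmi_compress JtJ Je ee (posdefmx_sym hQ) (eig cQ) (cQ0 _) obs).
have ctr' : ctr_lmi (compress J G) (J^T *m diagf cX *m J).
  exact: (ctr_lmi_compress JtJ Je ee (posdefmx_sym hX) (eig cX) (cX0 _) ctr).
rewrite compress_trunc compress_diagf in obs'.
rewrite compress_trunc compress_diagf in ctr'.
have [Pi2 cert2] := IH (ltnW bn) _ _ _ bn (fun i => cQ0 _) (fun i => cX0 _) obs' ctr'.
rewrite (trunc_sys_trans _ _ h) in cert2.
rewrite sum1 mulrDr addrC; apply: gain_cert_trans cert1 cert2 => //.
  by rewrite mulr_gt0// sqrtr_gt0 divr_gt0.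
(* Composition divides by both gains; the index [b] makes the remaining sum positive. *)
rewrite mulr_gt0// (bigD1 (Ordinal bn))//=; apply: ltr_pwDl.
  by rewrite sqrtr_gt0 divr_gt0.
by apply: sumr_ge0 => k _; exact: sqrtr_ge0.
Qed.

End Truncation.

(** * The closed loop *)

Section ClosedLoop.
Context (R : realType) (q m p : nat) (K : 'M[R]_q).

Definition similar_sys n m' p' (S : 'M[R]_n) (G : lsys R q m' p' n) :=
  LSys (S *m sA G *m invmx S) (S *m sB G) (sC G *m invmx S)
    (fun i => S *m sN G i *m invmx S).

Section Similarity.
Variables (n : nat) (S : 'M[R]_n) (G : lsys R q m p n).
Hypothesis uS : S \in unitmx.

Let drift_similar x u :
  drift (similar_sys S G) x u = S *m drift G (invmx S *m x) u.
Proof. by rewrite /drift/= mulmxDr !mulmxA. Qed.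

Let noise_similar M x :
  noise K ((invmx S)^T *m M *m invmx S) (fun i => sN (similar_sys S G) i *m x) =
  noise K M (fun i => sN G i *m (invmx S *m x)).
Proof.
rewrite noise_mulmx; congr noise; apply/funext => i.
by rewrite /= -!mulmxA mulKmx.
Qed.

Lemma obs_lmi_similar M : obs_lmi K G M ->
  obs_lmi K (similar_sys S G) ((invmx S)^T *m M *m invmx S).
Proof.
move=> lmi x; apply: le_trans (lmi (invmx S *m x)).
by rewrite noise_similar bform_mulmx/= -!mulmxA mulKmx.
Qed.

Lemma ctr_lmi_similar M : ctr_lmi K G M ->
  ctr_lmi K (similar_sys S G) ((invmx S)^T *m M *m invmx S).
Proof.
move=> lmi x u; apply: le_trans (lmi (invmx S *m x) u).
by rewrite noise_similar bform_mulmx drift_similar mulKmx.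
Qed.

(** Only the full state changes coordinates; the output is unaffected, and invertibility of [S]
    keeps the storage function definite. *)
Lemma gain_cert_similar r (H : lsys R q m p r) g Pi :
  gain_cert K (similar_sys S G) H g Pi ->
  gain_cert K G H g ((block_mx S 0 0 1%:M)^T *m Pi *m block_mx S 0 0 1%:M).
Proof.
move=> [[sPi pPi] cert].
have TE x z : block_mx S 0 0 1%:M *m col_mx x z = col_mx (S *m x) z :> 'cV[R]_(n + r).
  by rewrite mul_block_col !mul0mx mul1mx addr0 add0r.
split=> [|x z u].
  split=> [|v]; first by rewrite !trmx_mul sPi trmxK mulmxA.
  rewrite -[v]vsubmxK; set x := usubmx v; set z := dsubmx v => v0.
  rewrite -[X in 0 < X]/(bform _ _ _) bform_mulmx TE; apply: pPi.
  apply: contra v0; rewrite !col_mx_eq0 => /andP[/eqP Sx ->]; rewrite andbT.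
  by rewrite -(mulKmx uS x) Sx mulmx0.
have := cert (S *m x) z u.
rewrite bform_mulmx noise_mulmx !TE drift_similar mulKmx//=.
rewrite -[_ *m invmx S *m _]mulmxA mulKmx//.
congr (_ + _ <= _); congr noise; apply/funext => i.
by rewrite TE -!mulmxA mulKmx.
Qed.

End Similarity.
End ClosedLoop.

(** * Lyapunov inequalities of the LQG closed loop *)

Section LQG.
Context (R : realType) (q m p n : nat) (K : 'M[R]_q).
Variables (A : 'M[R]_n) (B : 'M[R]_(n, m)) (C : 'M[R]_(p, n)) (N : 'I_q -> 'M[R]_n).
Variables (P Q : 'M[R]_n).
Hypotheses (P_pos : posdefmx P) (Q_pos : posdefmx Q).

(* Input [u1], output the pair of the feedback part of the control and of [y]. *)
Definition closed_loop k (A : 'M[R]_k) (B : 'M[R]_(k, m)) (C : 'M[R]_(p, k))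
    (N : 'I_q -> 'M[R]_k) (Q : 'M[R]_k) : lsys R q m (m + p) k :=
  LSys (A - B *m B^T *m Q) B (col_mx (- (B^T *m Q)) C) N.

Let G := closed_loop A B C N Q.

Let noise_sum M x :
  bform (\sum_(i < q) \sum_(j < q) K i j *: ((N i)^T *m M *m N j)) x x =
  noise K M (fun i => N i *m x).
Proof.
rewrite bform_summx; apply: eq_bigr => i _; rewrite bform_summx.
by apply: eq_bigr => j _; rewrite bform_scalemx bform_mulmx.
Qed.

Let bform_gram c (D : 'M[R]_(c, n)) x : bform (D^T *m D) x x = sqnorm2 (D *m x).
Proof. by rewrite sqnorm2E -bform_mulmx mulmx1. Qed.

Let bform_lyap M x : M^T = M ->
  bform (A^T *m M + M *m A) x x = 2 * bform M x (A *m x).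
Proof.
move=> sM; rewrite bform_addmx bform_mull bform_mulr (bform_sym _ x sM).
by ring.
Qed.

Let bform_input M x v : M^T = M ->
  bform M x (B *m v) = bform 1%:M (B^T *m M *m x) v.
Proof.
move=> sM; rewrite -bform_mulr -[RHS]bform_mull mulmx1 trmx_mul trmxK sM.
by [].
Qed.

Hypothesis Q_eq : A^T *m Q + Q *m A
  + \sum_(i < q) \sum_(j < q) K i j *: ((N i)^T *m Q *m N j)
  + C^T *m C - Q *m B *m B^T *m Q = 0.

Let Q_sym : Q^T = Q. Proof. exact: posdefmx_sym. Qed.

Let riccati x : 2 * bform Q x (A *m x) + noise K Q (fun i => N i *m x)
  + sqnorm2 (C *m x) = sqnorm2 (B^T *m Q *m x).
Proof.
have := congr1 (fun M => bform M x x) Q_eq.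
rewrite bform0mx !bform_addmx -bform_addmx bform_lyap// noise_sum bform_gram.
rewrite bform_oppmx (_ : Q *m B *m B^T *m Q = (B^T *m Q)^T *m (B^T *m Q)).
  by rewrite bform_gram => /eqP; rewrite subr_eq0 => /eqP.
by rewrite trmx_mul trmxK Q_sym !mulmxA.
Qed.

Let output (x : 'cV[R]_n) : sqnorm2 (sC G *m x) = sqnorm2 (B^T *m Q *m x) + sqnorm2 (C *m x).
Proof. by rewrite /= mul_col_mx sqnorm2_col_mx mulNmx sqnorm2N. Qed.

Let stateE (x : 'cV[R]_n) : sA G *m x = A *m x - B *m (B^T *m Q *m x).
Proof. by rewrite /= mulmxBl !mulmxA. Qed.

(** An equality in fact: to the value |B^T Q x|^2 given by [riccati], the feedback adds -2 |B^T Q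
    x|^2 and the output adds |B^T Q x|^2. *)
Lemma closed_loop_obs : obs_lmi K G Q.
Proof.
move=> x; rewrite output stateE bformDr bformNr bform_input// -sqnorm2E /=.
by have := riccati x; lra.
Qed.

Hypothesis P_ineq : mxle
  (A^T *m invmx P + invmx P *m A
   + \sum_(i < q) \sum_(j < q) K i j *: ((N i)^T *m invmx P *m N j)
   - C^T *m C + invmx P *m B *m B^T *m invmx P) 0.

Let P_sym : (invmx P)^T = invmx P.
Proof. by rewrite trmx_inv (posdefmx_sym P_pos). Qed.

Let P_form x : 2 * bform (invmx P) x (A *m x)
    + noise K (invmx P) (fun i => N i *m x)
    + sqnorm2 (B^T *m invmx P *m x) <= sqnorm2 (C *m x).
Proof.
have [_ /(_ x)] := P_ineq; rewrite -[X in 0 <= X]/(bform _ _ _) sub0r.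
rewrite bform_oppmx !bform_addmx -bform_addmx bform_lyap// noise_sum bform_oppmx.
rewrite bform_gram (_ : invmx P *m B *m B^T *m invmx P =
  (B^T *m invmx P)^T *m (B^T *m invmx P)); first by rewrite bform_gram; lra.
by rewrite trmx_mul trmxK P_sym !mulmxA.
Qed.

(* The inverse of the controllability Gramian of the closed loop. *)
Lemma closed_loop_ctr : ctr_lmi K G (invmx P + Q).
Proof.
move=> x u; rewrite /drift stateE noiseD !bform_addmx /=.
rewrite !(bformDr, bformNr) !bform_input//.
have := riccati x; have := P_form x.
set al := B^T *m invmx P *m x; set be := B^T *m Q *m x => hP hQ.
(* The terms |C x|^2 of the two Riccati relations cancel, and the left side is bounded by |u|^2
   minus this square. *)
have : 0 <= sqnorm2 (al + be - u) by exact: sqnorm2_ge0.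
rewrite !sqnorm2D bformNr bformDl sqnorm2N.
by move: hP hQ; rewrite !sqnorm2E; lra.
Qed.

Section Balanced.
Variables (r : nat) (sigma : 'I_n -> R) (S : 'M[R]_n).
Hypotheses (hrn : (r < n)%N) (sigma_pos : forall i, 0 < sigma i).
Hypothesis hS : lqg_balancing P Q sigma S.

Let uS : S \in unitmx. Proof. by case: hS. Qed.

Let balQ : (invmx S)^T *m Q *m invmx S = diagf sigma. Proof. by case: hS. Qed.

Let diagfM (s t : 'I_n -> R) : diagf s *m diagf t = diagf (fun i => s i * t i).
Proof.
by apply/matrixP => i j; rewrite mul_diag_mx !mxE; case: eqP => [->|]; rewrite ?mulr0.
Qed.

Let diagf1 (s : 'I_n -> R) : (forall i, s i = 1) -> diagf s = 1%:M.
Proof. by move=> s1; apply/matrixP => i j; rewrite !mxE s1. Qed.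

(** Inverting [S *m P *m S^T = diagf sigma] shows that [S] diagonalizes [invmx P] as well, hence
    both closed-loop forms at once. *)
Let balX : (invmx S)^T *m (invmx P + Q) *m invmx S =
  diagf (fun i => (sigma i)^-1 + sigma i).
Proof.
have balP : (invmx S)^T *m invmx P *m invmx S = diagf (fun i => (sigma i)^-1).
  have inv1 : diagf sigma *m diagf (fun i => (sigma i)^-1) = 1%:M.
    by rewrite diagfM diagf1// => i; rewrite divff// gt_eqF.
  have inv2 : (invmx S)^T *m invmx P *m invmx S *m diagf sigma = 1%:M.
    have [_ <- _] := hS; rewrite -!mulmxA mulKmx// mulKmx ?posdefmx_unit//.
    by rewrite trmx_inv mulVmx// unitmx_tr.
  by rewrite -[LHS]mulmx1 -inv1 mulmxA inv2 mul1mx.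
rewrite mulmxDr mulmxDl balP balQ.
by apply/matrixP => i j; rewrite !mxE -mulrnDl.
Qed.

Let h := ltnW hrn.

(** Truncating and closing the loop commute: in balanced coordinates [Q] is diagonal, so the
    feedback matrix truncates column by column to the one built from the reduced coefficients. *)
Let trunc_similar : trunc_sys h (similar_sys S G) =
  closed_loop (trunc_state h S A) (trunc_input h S B) (trunc_output h S C)
    (fun i => trunc_state h S (N i)) (diagf (fun i : 'I_r => sigma (widen_ord h i))).
Proof.
have feedback : B^T *m Q *m invmx S = (S *m B)^T *m diagf sigma.
  by rewrite -balQ trmx_mul !mulmxA trmx_inv mulmxK// unitmx_tr.
have feedback_r : colsub (widen_ord h) (B^T *m Q *m invmx S) =
    (trunc_input h S B)^T *m diagf (fun i : 'I_r => sigma (widen_ord h i)).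
  rewrite feedback; apply/matrixP => i j; rewrite mxE !mul_mx_diag !mxE.
  by congr (_ * _).
rewrite /trunc_sys /closed_loop /similar_sys/=; congr LSys.
- rewrite mulmxBr mulmxBl -[_ *m _ *m Q]mulmxA !mulmxA.
  rewrite (_ : S *m B *m B^T *m Q *m invmx S = (S *m B) *m (B^T *m Q *m invmx S)); last first.
    by rewrite !mulmxA.
  rewrite -[_ *m _^T *m diagf _]mulmxA -feedback_r /trunc_state /trunc_input.
  rewrite mulmx_colsub mul_rowsub_mx.
  by apply/matrixP => i j; rewrite !mxE.
- rewrite mul_col_mx; apply/matrixP => i j.
  rewrite [LHS]mxE; case: (split_ordP i) => k ->.
    rewrite !col_mxEu mulNmx [LHS]mxE [RHS]mxE -feedback_r; congr (- _).
    by rewrite [RHS]mxE.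
  by rewrite !col_mxEd [RHS]mxE.
Qed.

Lemma lqg_gain_cert :
  (forall k (D : 'M[R]_k) (y : 'I_q -> 'cV[R]_k),
    (forall v, 0 <= bform D v v) ->
    0 <= \sum_(i < q) \sum_(j < q) K i j * bform D (y i) (y j)) ->
  exists Pi, gain_cert K G
    (closed_loop (trunc_state h S A) (trunc_input h S B) (trunc_output h S C)
      (fun i => trunc_state h S (N i)) (diagf (fun i : 'I_r => sigma (widen_ord h i))))
    (2 * \sum_(k < n | (r <= k)%N) sigma k / Num.sqrt (1 + sigma k ^+ 2)) Pi.
Proof.
move=> K_psd.
have xi_pos i : 0 < (sigma i)^-1 + sigma i by rewrite addr_gt0// invr_gt0.
have obs := obs_lmi_similar uS closed_loop_obs; rewrite balQ in obs.
have ctr := ctr_lmi_similar uS closed_loop_ctr; rewrite balX in ctr.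
have [Pi cert] := gain_cert_trunc K_psd h hrn sigma_pos xi_pos obs ctr.
rewrite trunc_similar in cert.
exists ((block_mx S 0 0 1%:M)^T *m Pi *m block_mx S 0 0 1%:M).
apply: gain_cert_similar => //; move: cert; congr gain_cert; congr (2 * _).
apply: eq_bigr => k _; have s0 := sigma_pos k.
have -> : sigma k / ((sigma k)^-1 + sigma k) = sigma k ^+ 2 / (1 + sigma k ^+ 2).
  have -> : (sigma k)^-1 + sigma k = (1 + sigma k ^+ 2) / sigma k.
    by field; rewrite gt_eqF.
  by rewrite invf_div mulrA expr2.
by rewrite sqrtrM ?sqr_ge0// sqrtrV ?addr_ge0 ?sqr_ge0// sqrtr_sqr gtr0_norm.
Qed.

End Balanced.
End LQG.

(** * The error bound *)

Section HasIntegral.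
Context d (T : measurableType d) (R : realType) (mu : {measure set T -> \bar R}).
Implicit Types f g : T -> R.

(** Keeps integrability and value together, so that long linear combinations need no separate
    integrability proofs. *)
Definition has_int f (c : R) :=
  mu.-integrable setT (EFin \o f) /\ \int[mu]_x f x = c.

Lemma has_int_mul f g : sqint mu f -> sqint mu g ->
  has_int (fun x => f x * g x) (ip mu f g).
Proof. by move=> sf sg; split=> //; exact: sqint_mul. Qed.

Lemma has_intD f g c c' : has_int f c -> has_int g c' ->
  has_int (fun x => f x + g x) (c + c').
Proof.
move=> [iF <-] [iG <-]; split; last exact: RintegralD.
exact: (integrableD measurableT iF iG).
Qed.

Lemma has_intZ (k : R) f c : has_int f c -> has_int (fun x => k * f x) (k * c).
Proof.
move=> [iF <-]; split; last exact: RintegralZl.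
exact: (integrableZl measurableT k iF).
Qed.

Lemma has_int_sum n (f : 'I_n -> T -> R) c : (forall i, has_int (f i) (c i)) ->
  has_int (fun x => \sum_(i < n) f i x) (\sum_(i < n) c i).
Proof.
elim: n f c => [|n IH] f c h.
  rewrite big_ord0; split.
    by apply: eq_integrable (integrable0 mu _) => // x _; rewrite /= big_ord0.
  by under eq_Rintegral do rewrite big_ord0; rewrite /Rintegral integral0.
rewrite big_ord_recr/= (_ : (fun x => _) = fun x =>
  \sum_(i < n) f (widen_ord (leqnSn n) i) x + f ord_max x).
  by apply: has_intD => //; exact: IH.
by apply/funext => x; rewrite big_ord_recr.
Qed.

Lemma has_int_le f g c c' : has_int f c -> has_int g c' ->
  (forall x, f x <= g x) -> c <= c'.
Proof.
by move=> [iF <-] [iG <-] fg; apply: le_Rintegral => // x _; exact: fg.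
Qed.

Lemma bformE a b (D : 'M[R]_(a, b)) x y :
  bform D x y = \sum_(i < a) \sum_(j < b) D i j * (x i 0 * y j 0).
Proof.
rewrite exchange_big /bform mxE; apply: eq_bigr => j _.
rewrite mxE mulr_suml; apply: eq_bigr => i _; rewrite mxE; ring.
Qed.

Lemma has_int_bform a b (D : 'M[R]_(a, b)) (X : T -> 'cV[R]_a) (Y : T -> 'cV[R]_b) :
  (forall i, sqint mu (fun z => X z i 0)) -> (forall j, sqint mu (fun z => Y z j 0)) ->
  has_int (fun z => bform D (X z) (Y z))
    (\sum_(i < a) \sum_(j < b) D i j * ip mu (fun z => X z i 0) (fun z => Y z j 0)).
Proof.
move=> sX sY; rewrite (_ : (fun z => _) = fun z =>
  \sum_(i < a) \sum_(j < b) D i j * (X z i 0 * Y z j 0)); last first.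
  by apply/funext => z; rewrite bformE.
apply: has_int_sum => i; apply: has_int_sum => j; apply: has_intZ.
exact: has_int_mul.
Qed.

Lemma has_int_sqnorm2 a (X : T -> 'cV[R]_a) :
  (forall i, sqint mu (fun z => X z i 0)) ->
  has_int (fun z => sqnorm2 (X z))
    (\sum_(i < a) ip mu (fun z => X z i 0) (fun z => X z i 0)).
Proof.
move=> sX; apply: has_int_sum => i.
rewrite (_ : (fun z => _) = fun z => X z i 0 * X z i 0); first exact: has_int_mul.
by apply/funext => z; rewrite expr2.
Qed.

End HasIntegral.

(** * Quadratic forms of solutions *)

Section Solutions.
Context (R : realType) (d : measure_display) (Omega : measurableType d).
Variables (Pr : probability Omega R) (F : R -> set (set Omega)).
Hypothesis hF : usual_filtration Pr F.
Variables (q : nat) (K : 'M[R]_q) (W : R -> Omega -> 'cV[R]_q).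
Hypothesis hW : wiener Pr F K W.

Local Notation leb := (@lebesgue_measure R).
Local Notation prodm := (leb \x Pr)%E.
Local Notation entry v a := (fun t w => v t w a 0).

(** The sum is the expectation of the form [D] at the random vector with coefficients [W 1 w i 0] on
    the [y i]. *)
Lemma wiener_cov_psd k (D : 'M[R]_k) (y : 'I_q -> 'cV[R]_k) :
  (forall v, 0 <= bform D v v) ->
  0 <= \sum_(i < q) \sum_(j < q) K i j * bform D (y i) (y j).
Proof.
move=> D0; pose D' : 'M[R]_q := \matrix_(i, j) bform D (y i) (y j).
have sW i := wiener_entry_sqint hF hW i ler01.
have [_] := has_int_bform D' sW sW.
have -> : \sum_(i < q) \sum_(j < q) D' i j *
    ip Pr (fun w => W 1 w i 0) (fun w => W 1 w j 0) =
    \sum_(i < q) \sum_(j < q) K i j * bform D (y i) (y j).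
  apply: eq_bigr => i _; apply: eq_bigr => j _.
  by rewrite (wiener_ip hF hW)// !mxE mulr1 mulrC.
move=> <-; apply: Rintegral_ge0 => w _.
have -> : bform D' (W 1 w) (W 1 w) =
    bform D (\sum_i W 1 w i 0 *: y i) (\sum_i W 1 w i 0 *: y i).
  rewrite bformE; transitivity (\sum_i \sum_j
      bform D (W 1 w i 0 *: y i) (W 1 w j 0 *: y j)).
    by apply: eq_bigr => i _; apply: eq_bigr => j _; rewrite bformZl bformZr mxE; ring.
  rewrite bform_suml; apply: eq_bigr => i _.
  by rewrite bform_sumr.
exact: D0.
Qed.

Lemma cutoffD T (f g : R -> Omega -> R) z :
  cutoff T (fun t w => f t w + g t w) z = cutoff T f z + cutoff T g z.
Proof. by rewrite /cutoff mulrDr. Qed.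

Lemma cutoff_mulmx T a b (A : 'M[R]_(a, b)) (v : R -> Omega -> 'cV[R]_b) i z :
  cutoff T (fun t w => (A *m v t w) i 0) z =
  \sum_j A i j * cutoff T (entry v j) z.
Proof.
rewrite /cutoff mxE mulr_sumr; apply: eq_bigr => j _; ring.
Qed.

Lemma cutoff_mulmx_sqint T a b (A : 'M[R]_(a, b)) (v : R -> Omega -> 'cV[R]_b) i :
  (forall j, sqint prodm (cutoff T (entry v j))) ->
  sqint prodm (cutoff T (fun t w => (A *m v t w) i 0)).
Proof.
move=> sv; rewrite (funext (cutoff_mulmx T A v i)).
by apply: sqint_sum => j; exact: sqintZ.
Qed.

Lemma smeas_mulmx t a b (A : 'M[R]_(a, b)) (v : Omega -> 'cV[R]_b) i : 0 <= t ->
  (forall j, smeas (F t) (fun w => v w j 0)) ->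
  smeas (F t) (fun w => (A *m v w) i 0).
Proof.
move=> t0 mv; have sF := filtration_sigma_algebra hF t0.
rewrite (_ : (fun w => _) = fun w => \sum_j A i j * v w j 0); last first.
  by apply/funext => w; rewrite mxE.
by apply: smeas_sum => // j; apply: smeasM => //; exact: smeas_cst.
Qed.

Section OneSolution.
Variables (T : R) (T0 : 0 < T) (n m : nat) (A : 'M[R]_n) (B : 'M[R]_(n, m)).
Variables (N : 'I_q -> 'M[R]_n) (u : R -> Omega -> 'cV[R]_m) (x : R -> Omega -> 'cV[R]_n).
Hypothesis su : forall b, sqint prodm (cutoff T (entry u b)).
Hypothesis mu : forall t b, 0 <= t <= T -> smeas (F t) (fun w => u t w b 0).
Hypothesis hx : solution_on Pr F W T A B N 0 u x.

Lemma solution_sqint a : sqint prodm (cutoff T (entry x a)).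
Proof. by case: hx => hx' _; exact: (L2process_sqint a hx'). Qed.

Lemma solution_smeas t a : 0 <= t <= T -> smeas (F t) (fun w => x t w a 0).
Proof.
move=> tT; case: hx => -[_ mx _] _; have := mx t; rewrite /= in_itv/=.
by move=> /(_ tT); exact.
Qed.

(** The integrals [M] are exposed along with the martingale part because [solution_isometry] must
    know their integrands. *)
Lemma solution_ito_process : exists M : 'I_q -> R -> Omega -> 'cV[R]_n,
  (forall i, ito_integral Pr F T (fun t w => N i *m x t w) (fun t w => W t w i 0) (M i)) /\
  forall a, ito_process Pr F T (fun t w => (A *m x t w + B *m u t w) a 0)
    (entry x a) (fun t w => (\sum_(i < q) M i t w) a 0).
Proof.
case: (hx) => _ [M [hM eqx]]; exists M; split=> // a.
have sNx i b : sqint prodm (cutoff T (fun t w => (N i *m x t w) b 0)).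
  by apply: cutoff_mulmx_sqint; exact: solution_sqint.
have TT : 0 <= T <= T by rewrite (ltW T0) lexx.
have aM t i : 0 <= t <= T -> adapted_sqint Pr F t (fun w => M i t w a 0).
  by move=> tT; exact: (ito_adapted hF hW (ltW T0) (hM i) (sNx i)).
have sumE t : (fun w => (\sum_(i < q) M i t w) a 0) =
    fun w => \sum_(i < q) M i t w a 0.
  by apply/funext => w; rewrite summxE.
split.
- rewrite (_ : cutoff T _ = fun z => cutoff T (fun t w => (A *m x t w) a 0) z
      + cutoff T (fun t w => (B *m u t w) a 0) z); last first.
    by apply/funext => z; rewrite -cutoffD /cutoff mxE.
  by apply: sqintD; apply: cutoff_mulmx_sqint => //; exact: solution_sqint.
- move=> t tT; have /andP[t0 _] := tT; have sF := filtration_sigma_algebra hF t0.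
  rewrite (_ : (fun w => _) = fun w => (A *m x t w) a 0 + (B *m u t w) a 0); last first.
    by apply/funext => w; rewrite mxE.
  apply: smeasD => //; apply: smeas_mulmx => // b; last exact: mu.
  exact: solution_smeas.
- exact: solution_sqint.
- move=> t tT; have /andP[t0 _] := tT.
  apply: (smeas_measurable (filtration_measurable hF t0)).
  exact: solution_smeas.
- move=> t tT; rewrite sumE; have /andP[t0 _] := tT; split.
    apply: smeas_sum => [|i]; first exact: filtration_sigma_algebra hF _ t0.
    by have [] := aM t i tT.
  by apply: sqint_sum => i; have [] := aM t i tT.
- move=> t Y tT aY; have sY : sqint Pr Y by case: aY.
  have sM s i : 0 <= s <= T -> sqint Pr (fun w => M i s w a 0).
    by move=> sT; have [] := aM s i sT.
  rewrite !sumE !ip_sumr//; try by move=> i; exact: sM.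
  apply: eq_bigr => i _.
  exact: (ito_orth hF hW (ltW T0) (hM i) (sNx i)).
- move=> t tT; apply: filterS (eqx t tT) => w ->.
  rewrite add0r 2!mxE; congr (_ + _).
  rewrite /tint Rintegral_mkcond; apply: eq_Rintegral => s _.
  by rewrite patchE /cutoff indicE/=; case: (_ \in _); rewrite ?mul1r ?mul0r.
Qed.

End OneSolution.

Lemma solution_isometry T n n' (N : 'I_q -> 'M[R]_n) (N' : 'I_q -> 'M[R]_n')
    (x : R -> Omega -> 'cV[R]_n) (x' : R -> Omega -> 'cV[R]_n')
    (M : 'I_q -> R -> Omega -> 'cV[R]_n) (M' : 'I_q -> R -> Omega -> 'cV[R]_n') a b :
  0 < T ->
  (forall a, sqint prodm (cutoff T (entry x a))) ->
  (forall a, sqint prodm (cutoff T (entry x' a))) ->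
  (forall i, ito_integral Pr F T (fun t w => N i *m x t w) (fun t w => W t w i 0) (M i)) ->
  (forall i, ito_integral Pr F T (fun t w => N' i *m x' t w) (fun t w => W t w i 0) (M' i)) ->
  ip Pr (fun w => (\sum_(i < q) M i T w) a 0) (fun w => (\sum_(i < q) M' i T w) b 0) =
  \sum_(i < q) \sum_(j < q) K i j *
    ip prodm (cutoff T (fun t w => (N i *m x t w) a 0))
      (cutoff T (fun t w => (N' j *m x' t w) b 0)).
Proof.
move=> T0 sx sx' hM hM'.
have TT : 0 <= T <= T by rewrite (ltW T0) lexx.
have sNx i c : sqint prodm (cutoff T (fun t w => (N i *m x t w) c 0)).
  exact: cutoff_mulmx_sqint.
have sNx' i c : sqint prodm (cutoff T (fun t w => (N' i *m x' t w) c 0)).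
  exact: cutoff_mulmx_sqint.
have sM i : sqint Pr (fun w => M i T w a 0).
  by have [] := ito_adapted hF hW (ltW T0) (hM i) (sNx i) a TT.
have sM' i : sqint Pr (fun w => M' i T w b 0).
  by have [] := ito_adapted hF hW (ltW T0) (hM' i) (sNx' i) b TT.
rewrite (_ : (fun w => (\sum_(i < q) M i T w) a 0) =
    fun w => \sum_(i < q) M i T w a 0); last by apply/funext => w; rewrite summxE.
rewrite (_ : (fun w => (\sum_(i < q) M' i T w) b 0) =
    fun w => \sum_(i < q) M' i T w b 0); last by apply/funext => w; rewrite summxE.
rewrite ip_suml//; last exact: sqint_sum.
apply: eq_bigr => i _; rewrite ip_sumr//; apply: eq_bigr => j _.
exact: (ito_isometry hF hW a b (ltW T0) (hM i) (hM' j) (sNx i) (sNx' j)).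
Qed.

(** Dynkin's formula for the form [D]: the product rule for each pair of components, summed against
    the entries of [D]. The hypothesis on [ip Pr (m c T) (m c' T)] turns the martingale terms into
    the noise term. *)
Lemma has_int_generator T k (D : 'M[R]_k) (a Z m : 'I_k -> R -> Omega -> R)
    (v : 'I_q -> 'I_k -> R -> Omega -> R) : 0 < T -> D^T = D ->
  (forall c, ito_process Pr F T (a c) (Z c) (m c)) ->
  (forall i c, sqint prodm (cutoff T (v i c))) ->
  (forall c c', ip Pr (m c T) (m c' T) = \sum_(i < q) \sum_(j < q)
     K i j * ip prodm (cutoff T (v i c)) (cutoff T (v j c'))) ->
  has_int prodm (fun z =>
      2 * bform D (\col_c cutoff T (Z c) z) (\col_c cutoff T (a c) z)
      + noise K D (fun i => \col_c cutoff T (v i c) z))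
    (\int[Pr]_w bform D (\col_c Z c T w) (\col_c Z c T w)).
Proof.
move=> T0 sD hZ sv iso.
have TT : 0 <= T <= T by rewrite (ltW T0) lexx.
have entryE (f : 'I_k -> R -> Omega -> R) c :
    (fun z => (\col_c cutoff T (f c) z) c 0) = cutoff T (f c).
  by apply/funext => z; rewrite mxE.
have sZ c : sqint prodm (fun z => (\col_c cutoff T (Z c) z) c 0).
  by rewrite entryE; exact: ito_state_sqint (hZ c).
have sa c : sqint prodm (fun z => (\col_c cutoff T (a c) z) c 0).
  by rewrite entryE; exact: ito_drift_sqint (hZ c).
have sv' i c : sqint prodm (fun z => (\col_c cutoff T (v i c) z) c 0).
  by rewrite entryE.
have sZT c : sqint Pr (fun w => (\col_c Z c T w) c 0).
  rewrite (_ : (fun w => _) = Z c T); last by apply/funext => w; rewrite mxE.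
  exact: (ito_state_sqint_at T0 (hZ c) TT).
have [_ ->] := has_int_bform D sZT sZT.
have := has_intD (has_intZ 2 (has_int_bform D sZ sa))
  (has_int_sum (fun i => has_int_sum (fun j =>
    has_intZ (K i j) (has_int_bform D (sv' i) (sv' j))))).
congr has_int.
(* By symmetry of [D] the two drift terms of the product rule have the same sum, which gives the
   factor 2. *)
have swap : \sum_i \sum_j D i j * ip prodm (cutoff T (a i)) (cutoff T (Z j)) =
    \sum_i \sum_j D i j * ip prodm (cutoff T (Z i)) (cutoff T (a j)).
  rewrite exchange_big; apply: eq_bigr => i _; apply: eq_bigr => j _.
  by rewrite -[in LHS]sD mxE ipC.
have noiseE : \sum_(i < q) \sum_(j < q) K i j * (\sum_c \sum_c' D c c' *
      ip prodm (cutoff T (v i c)) (cutoff T (v j c'))) =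
    \sum_c \sum_c' D c c' * ip Pr (m c T) (m c' T).
  under [RHS]eq_bigr do under eq_bigr do rewrite iso.
  rewrite pair_big/= [RHS]pair_big/=.
  under [LHS]eq_bigr do rewrite pair_big/= mulr_sumr.
  under [RHS]eq_bigr do rewrite pair_big/= mulr_sumr.
  rewrite exchange_big; apply: eq_bigr => c _; apply: eq_bigr => i _; ring.
transitivity (\sum_i \sum_j D i j * (ip prodm (cutoff T (a i)) (cutoff T (Z j))
    + ip prodm (cutoff T (Z i)) (cutoff T (a j)) + ip Pr (m i T) (m j T))); last first.
  apply: eq_bigr => i _; apply: eq_bigr => j _; congr (_ * _).
  rewrite [in RHS](_ : (fun w => (\col_c Z c T w) i 0) = Z i T); last first.
    by apply/funext => w; rewrite mxE.
  rewrite [in RHS](_ : (fun w => (\col_c Z c T w) j 0) = Z j T); last first.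
    by apply/funext => w; rewrite mxE.
  by rewrite (product_rule T0 (hZ i) (hZ j)) (ipC prodm (cutoff T (a j))).
transitivity (\sum_i \sum_j D i j * ip prodm (cutoff T (a i)) (cutoff T (Z j))
  + \sum_i \sum_j D i j * ip prodm (cutoff T (Z i)) (cutoff T (a j))
  + \sum_i \sum_j D i j * ip Pr (m i T) (m j T)); last first.
  rewrite -!big_split; apply: eq_bigr => i _; rewrite -!big_split.
  by apply: eq_bigr => j _ /=; ring.
rewrite swap -noiseE -mulr2n mulr_natl.
congr (_ *+ _ + _).
  by apply: eq_bigr => i _; apply: eq_bigr => j _; rewrite !entryE.
apply: eq_bigr => i _; apply: eq_bigr => j _; congr (_ * _).
by apply: eq_bigr => c _; apply: eq_bigr => c' _; rewrite !entryE.
Qed.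

End Solutions.

Section Feedback.
Context (R : realType) (d : measure_display) (Omega : measurableType d).
Variables (Pr : probability Omega R) (F : R -> set (set Omega)).
Hypothesis hF : usual_filtration Pr F.

Local Notation leb := (@lebesgue_measure R).
Local Notation prodm := (leb \x Pr)%E.
Local Notation entry v a := (fun t w => v t w a 0).

Lemma L2normE T k (v : R -> Omega -> 'cV[R]_k) :
  (forall a, sqint prodm (cutoff T (entry v a))) ->
  L2norm Pr `[0, T] v =
  (Num.sqrt (\sum_a ip prodm (cutoff T (entry v a)) (cutoff T (entry v a))))%:E.
Proof.
move=> sv; rewrite /L2norm integral_sqnorm2_cutoff; last first.
  by move=> a; have [] := sv a.
rewrite (eq_bigr (fun a => (ip prodm (cutoff T (entry v a)) (cutoff T (entry v a)))%:E)).
  by rewrite sumEFin.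
by move=> a _; rewrite ipE//; apply: eq_integral => z _; rewrite expr2.
Qed.

Lemma L2process_smeas T k (v : R -> Omega -> 'cV[R]_k) t a :
  L2process Pr F `[0, T] v -> 0 <= t <= T -> smeas (F t) (fun w => v t w a 0).
Proof.
by move=> [_ mv _] tT; have := mv t; rewrite /= in_itv/= => /(_ tT); exact.
Qed.

Section Control.
Variables (T : R) (n m : nat) (L : 'M[R]_(m, n)).
Variables (x : R -> Omega -> 'cV[R]_n) (v : R -> Omega -> 'cV[R]_m).
Hypotheses (hx : L2process Pr F `[0, T] x) (hv : L2process Pr F `[0, T] v).

(** [solution_on] puts no condition on its control; the integrability of the feedback comes from the
    state and the external input. *)
Lemma feedback_sqint b :
  sqint prodm (cutoff T (fun t w => (- (L *m x t w) + v t w) b 0)).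
Proof.
rewrite (_ : cutoff T _ = fun z => - cutoff T (fun t w => (L *m x t w) b 0) z
    + cutoff T (entry v b) z); last first.
  by apply/funext => z; rewrite /cutoff !mxE mulrDr mulrN.
apply: sqintD; last exact: (L2process_sqint b hv).
apply: sqintN; apply: cutoff_mulmx_sqint => j; exact: (L2process_sqint j hx).
Qed.

Lemma feedback_smeas t b : 0 <= t <= T ->
  smeas (F t) (fun w => (- (L *m x t w) + v t w) b 0).
Proof.
move=> tT; have /andP[t0 _] := tT; have sF := filtration_sigma_algebra hF t0.
rewrite (_ : (fun w => _) = fun w => v t w b 0 - (L *m x t w) b 0); last first.
  by apply/funext => w; rewrite !mxE addrC.
apply: smeasB => //; first exact: L2process_smeas hv tT.
by apply: (smeas_mulmx hF) => // j; exact: L2process_smeas hx tT.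
Qed.

End Control.
End Feedback.

Theorem corollary5p2 (R : realType) (d : measure_display)
  (Omega : measurableType d) (Pr : probability Omega R)
  (F : R -> set (set Omega)) (hF : usual_filtration Pr F)
  (q : nat) (K : 'M[R]_q) (W : R -> Omega -> 'cV[R]_q)
  (hW : wiener Pr F K W)
  (n m p : nat) (A : 'M[R]_n) (B : 'M[R]_(n, m)) (C : 'M[R]_(p, n))
  (N : 'I_q -> 'M[R]_n)
  (hstab : stabilizable Pr F W A B N)
  (hobs : observable Pr F W A C N)
  (P Q : 'M[R]_n)
  (P_pos : posdefmx P)
  (P_ineq : mxle
     (A^T *m invmx P + invmx P *m A
        + \sum_(i < q) \sum_(j < q) K i j *: ((N i)^T *m invmx P *m N j)
        - C^T *m C + invmx P *m B *m B^T *m invmx P) 0)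
  (Q_pos : posdefmx Q)
  (Q_eq : A^T *m Q + Q *m A
        + \sum_(i < q) \sum_(j < q) K i j *: ((N i)^T *m Q *m N j)
        + C^T *m C - Q *m B *m B^T *m Q = 0)
  (Q_stab : stable Pr F W (A - B *m B^T *m Q) N)
  (r : nat) (hr : (1 <= r)%N) (hrn : (r < n)%N)
  (sigma : 'I_n -> R)
  (sigma_pos : forall i, 0 < sigma i)
  (sigma_noninc : forall i j : 'I_n, (i <= j)%N -> sigma j <= sigma i)
  (sigma_eig : char_poly (P *m Q) = \prod_(i < n) ('X - (sigma i ^+ 2)%:P))
  (Sb : 'M[R]_n) (hSb : lqg_balancing P Q sigma Sb)
  (T : R) (hT : 0 < T)
  (u1 : R -> Omega -> 'cV[R]_m) (hu1 : L2process Pr F `[0, T] u1) :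
  let Ar := trunc_state (ltnW hrn) Sb A in
  let Nr := fun i => trunc_state (ltnW hrn) Sb (N i) in
  let Br := trunc_input (ltnW hrn) Sb B in
  let Cr := trunc_output (ltnW hrn) Sb C in
  let Sigmar := diagf (fun i : 'I_r => sigma (widen_ord (ltnW hrn) i)) in
  forall (x : R -> Omega -> 'cV[R]_n) (xr : R -> Omega -> 'cV[R]_r),
  let u := fun (t : R) (w : Omega) => - (B^T *m Q *m x t w) + u1 t w in
  let ur := fun (t : R) (w : Omega) => - (Br^T *m Sigmar *m xr t w) + u1 t w in
  let y := fun t w => C *m x t w in
  let yr := fun t w => Cr *m xr t w in
  let err := fun (t : R) (w : Omega) => col_mx (u t w - ur t w) (y t w - yr t w) in
  let bound :=
    2 * \sum_(k < n | (r <= k)%N) sigma k / Num.sqrt (1 + sigma k ^+ 2) in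
  solution_on Pr F W T A B N 0 u x ->
  solution_on Pr F W T Ar Br Nr 0 ur xr ->
  (L2norm Pr `[0%R, T] err <= bound%:E * L2norm Pr `[0%R, T] u1)%E.
Proof.
move=> Ar Nr Br Cr Sigmar x xr u ur y yr err bound hx hxr.
pose G := closed_loop A B C N Q; pose Gr := closed_loop Ar Br Cr Nr Sigmar.
have [Pi [hPi cert]] : exists Pi, gain_cert K G Gr bound Pi.
  apply: (lqg_gain_cert P_pos Q_pos Q_eq P_ineq hrn sigma_pos hSb) => k D z.
  exact: (wiener_cov_psd hF hW).
have [hx2 _] := hx; have [hxr2 _] := hxr.
have sx a := L2process_sqint a hx2; have sxr a := L2process_sqint a hxr2.
have su1 b := L2process_sqint b hu1.
have [M [hM pM]] := solution_ito_process hF hW hT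
  (feedback_sqint (B^T *m Q) hx2 hu1) (feedback_smeas hF (B^T *m Q) hx2 hu1) hx.
have [Mr [hMr pMr]] := solution_ito_process hF hW hT
  (feedback_sqint (Br^T *m Sigmar) hxr2 hu1)
  (feedback_smeas hF (Br^T *m Sigmar) hxr2 hu1) hxr.
(* Both systems are driven by the same Wiener process and are treated as one process with [n + r]
   components. *)
pose a c t w := col_mx (A *m x t w + B *m u t w) (Ar *m xr t w + Br *m ur t w) c 0.
pose Z c t w := col_mx (x t w) (xr t w) c 0.
pose mt c t w := col_mx (\sum_(i < q) M i t w) (\sum_(i < q) Mr i t w) c 0.
pose v i c t w := col_mx (N i *m x t w) (Nr i *m xr t w) c 0.
have lE (f : R -> Omega -> 'cV[R]_n) (g : R -> Omega -> 'cV[R]_r) k :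
    (fun t w => col_mx (f t w) (g t w) (lshift r k) 0) = (fun t w => f t w k 0).
  by apply/funext => t; apply/funext => w; rewrite col_mxEu.
have rE (f : R -> Omega -> 'cV[R]_n) (g : R -> Omega -> 'cV[R]_r) k :
    (fun t w => col_mx (f t w) (g t w) (rshift n k) 0) = (fun t w => g t w k 0).
  by apply/funext => t; apply/funext => w; rewrite col_mxEd.
have pZ c : ito_process Pr F T (a c) (Z c) (mt c).
  by case: (split_ordP c) => k ->; rewrite /a /Z /mt ?lE ?rE.
have sv i c : sqint (lebesgue_measure \x Pr)%E (cutoff T (v i c)).
  by case: (split_ordP c) => k ->; rewrite /v ?lE ?rE; exact: cutoff_mulmx_sqint.
have iso c c' : ip Pr (mt c T) (mt c' T) = \sum_(i < q) \sum_(j < q)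
    K i j * ip (lebesgue_measure \x Pr)%E (cutoff T (v i c)) (cutoff T (v j c')).
  have mE k : mt (lshift r k) = fun t w => (\sum_(i < q) M i t w) k 0 by exact: lE.
  have mrE k : mt (rshift n k) = fun t w => (\sum_(i < q) Mr i t w) k 0 by exact: rE.
  have vE i k : v i (lshift r k) = fun t w => (N i *m x t w) k 0 by exact: lE.
  have vrE i k : v i (rshift n k) = fun t w => (Nr i *m xr t w) k 0 by exact: rE.
  by case: (split_ordP c) => k ->; case: (split_ordP c') => k' ->;
    rewrite ?mE ?mrE; under eq_bigr do under eq_bigr do rewrite ?vE ?vrE;
    exact: (solution_isometry hF hW).
have gen := has_int_generator hT (posdefmx_sym hPi) pZ sv iso.
have E_ge0 : 0 <= \int[Pr]_w bform Pi (\col_c Z c T w) (\col_c Z c T w).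
  by apply: Rintegral_ge0 => w _; exact: posdefmx_ge0.
have colE k (f : R -> Omega -> 'cV[R]_k) z :
    \col_c cutoff T (fun t w => f t w c 0) z = \1_(`[0, T]%classic) z.1 *: f z.1 z.2.
  by apply/colP => c; rewrite !mxE.
(* The external input [u1] cancels in [u - ur], so the error is the difference of the two
   closed-loop outputs. *)
have errE t w : err t w = sC G *m x t w - sC Gr *m xr t w.
  rewrite /err /u /ur /y /yr /= !mul_col_mx opp_col_mx add_col_mx !mulNmx.
  by rewrite opprD opprK addrACA addrN addr0.
have serr e : sqint (lebesgue_measure \x Pr)%E (cutoff T (fun t w => err t w e 0)).
  rewrite (_ : cutoff T _ = fun z => cutoff T (fun t w => (sC G *m x t w) e 0) z
      - cutoff T (fun t w => (sC Gr *m xr t w) e 0) z); last first.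
    apply/funext => z; rewrite /cutoff errE -mulrBr; congr (_ * _).
    by rewrite [LHS]mxE [X in _ + X]mxE.
  by apply: sqintB; exact: cutoff_mulmx_sqint.
have entryE k (f : R -> Omega -> 'cV[R]_k) c :
    (fun z => (\col_c cutoff T (fun t w => f t w c 0) z) c 0) =
    cutoff T (fun t w => f t w c 0).
  by apply/funext => z; rewrite mxE.
rewrite !L2normE//; set E := \sum_(_ < m + p) _; set U := \sum_(_ < m) _.
have hU : has_int (lebesgue_measure \x Pr)%E
    (fun z => sqnorm2 (\col_b cutoff T (fun t w => u1 t w b 0) z)) U.
  rewrite /U; under eq_bigr do rewrite -entryE.
  by apply: has_int_sqnorm2 => b; rewrite entryE.
have hE : has_int (lebesgue_measure \x Pr)%E
    (fun z => sqnorm2 (\col_e cutoff T (fun t w => err t w e 0) z)) E.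
  rewrite /E; under eq_bigr do rewrite -entryE.
  by apply: has_int_sqnorm2 => e; rewrite entryE.
have EU : E <= bound ^+ 2 * U.
  (* The expected storage at [T] is nonnegative and equals the integral of the generator, which the
     certificate bounds pointwise by the supply rate. *)
  rewrite -subr_ge0; apply: le_trans E_ge0 _.
  have rhs := has_intD (has_intZ (bound ^+ 2) hU) (has_intZ (-1) hE).
  rewrite mulN1r in rhs; apply: has_int_le gen rhs _ => z.
  (* Every cutoff is a multiple by [s], and both sides are quadratic, so the claim is the
     certificate multiplied by [s ^+ 2]. *)
  set s : R := \1_(`[0, T]%classic) z.1.
  have -> : \col_c cutoff T (Z c) z = s *: col_mx (x z.1 z.2) (xr z.1 z.2).
    exact: (colE _ (fun t w => col_mx (x t w) (xr t w))).
  have -> : \col_c cutoff T (a c) z =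
      s *: col_mx (drift G (x z.1 z.2) (u1 z.1 z.2)) (drift Gr (xr z.1 z.2) (u1 z.1 z.2)).
    rewrite [LHS](colE _ (fun t w => col_mx (A *m x t w + B *m u t w)
      (Ar *m xr t w + Br *m ur t w))); congr (_ *: col_mx _ _).
      by rewrite /u /drift/= mulmxDr mulmxN mulmxBl addrA !mulmxA.
    by rewrite /ur /drift/= mulmxDr mulmxN mulmxBl addrA !mulmxA.
  have -> : (fun i => \col_c cutoff T (v i c) z) =
      fun i => s *: col_mx (sN G i *m x z.1 z.2) (sN Gr i *m xr z.1 z.2).
    by apply/funext => i; exact: (colE _ (fun t w => col_mx (N i *m x t w) (Nr i *m xr t w))).
  rewrite !colE -/s errE bformZl bformZr !sqnorm2Z.
  have -> : noise K Pi (fun i => s *: col_mx (sN G i *m x z.1 z.2)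
      (sN Gr i *m xr z.1 z.2)) = s ^+ 2 * noise K Pi (fun i =>
      col_mx (sN G i *m x z.1 z.2) (sN Gr i *m xr z.1 z.2)).
    rewrite /noise mulr_sumr; apply: eq_bigr => i _; rewrite mulr_sumr.
    by apply: eq_bigr => j _; rewrite bformZl bformZr; ring.
  have := ler_wpM2l (sqr_ge0 s) (cert (x z.1 z.2) (xr z.1 z.2) (u1 z.1 z.2)).
  by congr (_ <= _); ring.
have bound0 : 0 <= bound.
  rewrite mulr_ge0// sumr_ge0// => k _.
  by rewrite mulr_ge0 ?(ltW (sigma_pos _))// invr_ge0 sqrtr_ge0.
rewrite -EFinM lee_fin; apply: le_trans (ler_wsqrtr EU) _.
by rewrite sqrtrM ?sqr_ge0// sqrtr_sqr ger0_norm.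
Qed.
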